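(* Let $q = p^d$ be a prime power ($p$ prime, $d \ge 1$). Then $\mathrm{PSL}(2,q)$ is wexp-solvable if and only if either $q = 4$, or $q = 9$, or \[ p \equiv 2, 3, 5, 7, 17, 43, 53, 67, 77, 103, 113 \pmod{120} \] and $d$ is odd. Consequently, $\mathrm{PSL}(2,q)$ is wexp-solvable for infinitely many values of $q$ and is wexp-nonsolvable (and hence minimal wexp-nonsolvable) for infinitely many values of $q$.
   Context: Let $G$ be a finite group. A subgroup $H \le G$ is called weakly exponential with respect to $G$ if, for all $x \in G$, there exists $g \in G$ such that $x^{|G:H|} \in H^g$, where $H^g = g^{-1}Hg$. The group $G$ is called wexp-solvable if every subgroup of $G$ is weakly exponential with respect to $G$, and wexp-nonsolvable if it is not wexp-solvable. The group $G$ is called minimal wexp-nonsolvable if $G$ is wexp-nonsolvable but all proper quotients of $G$ (quotients by nontrivial normal subgroups) are wexp-solvable. $\mathrm{PSL}(2,q)$ denotes the projective special linear group of degree 2 over the field with $q$ elements. *)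

(* Defs.v *)
From mathcomp Require Import all_boot all_order all_algebra.
From mathcomp Require Import all_fingroup all_solvable all_field.

Set Implicit Arguments.
Unset Strict Implicit.
Unset Printing Implicit Defensive.

Import GroupScope.

Definition weakly_exponential (gT : finGroupType) (H G : {group gT}) : Prop :=
  forall x, x \in G -> exists2 g, g \in G & x ^+ #|G : H| \in H :^ g.

Definition wexp_solvable (gT : finGroupType) (G : {group gT}) : Prop :=
  forall H : {group gT}, H \subset G -> weakly_exponential H G.

Definition wexp_nonsolvable (gT : finGroupType) (G : {group gT}) : Prop :=
  ~ wexp_solvable G.

Definition minimal_wexp_nonsolvable (gT : finGroupType) (G : {group gT}) :
    Prop :=
  wexp_nonsolvable G /\
  forall N : {group gT}, N <| G -> N :!=: 1 -> wexp_solvable (G / N)%G.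

Definition SL2 (F : finFieldType) : {set {'GL_2[F]}} :=
  [set A : {'GL_2[F]} | (\det (GLval A) == 1)%R].

Lemma SL2_group_set (F : finFieldType) : group_set (SL2 F).
Proof.
apply/group_setP; split=> [|A B]; rewrite !inE ?GL_1E ?det1 //.
by move=> /eqP detA /eqP detB; rewrite GL_ME det_mulmx detA detB GRing.mulr1.
Qed.

Canonical SL2_group (F : finFieldType) : {group {'GL_2[F]}} :=
  Group (SL2_group_set F).

Definition PSL2 (F : finFieldType) : {group coset_of 'Z(SL2 F)} :=
  (SL2 F / 'Z(SL2 F))%G.

(* Main.v *)
Require Import Defs.
From mathcomp Require Import all_boot all_order all_algebra.
From mathcomp Require Import all_fingroup all_solvable all_field.
From mathcomp Require Import zify ring lra.

(** In SL(2,q) an element of order prime to p is determined up to conjugacy by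
    its trace, that is by a pair {l, 1/l} of eigenvalues with l^(q-1) = 1 or
    l^(q+1) = 1, and every other element is a central element times an element of
    order p.  A subgroup of PSL(2,q) is the image of a subgroup H of G = SL(2,q)
    that contains the centre Z, and weak exponentiality is the same for both
    ([wexp_solvable_PSL2]).  If H is weakly exponential, then for m = q - 1 and
    m = q + 1, provided that m > 2, the power x^|G:H| of an element x of order m
    forces H to contain an element of order n = m / gcd(m, |G:H|)
    ([weakly_exponential_order]).
    Conversely these two orders suffice ([weakly_exponential_of_orders]).

    By counting and Sylow's theorem each primary part of n divides the order of
    the centralizer in H of some noncentral element.  The question is whether a
    single centralizer serves all primes at once, because centralizers of elements
    of order prime to p are cyclic ([cent1_cyclic]).  The centralizers in H of
    noncentral elements are abelian, they meet pairwise in Z, and those of order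
    prime to p have index at most 2 in their normalizers.  So H/Z obeys the class
    equation of Dickson's classification of the subgroups of PSL(2,q), which
    resembles that of the finite rotation groups.  If two nonconjugate
    centralizers were needed for two different primes, the equation would only
    leave configurations like A4, S4, A5, PSL(2,p^k) and PGL(2,p^k)
    ([three_split_classes], [parabolic_split_classes]).  The first three need
    12 | q - 1, 12 | q + 1 or 5 | q^2 - 1, and the last two, where p^k + 1 would
    divide q - 1, are impossible when q = p^d with d odd.  So if d is odd, 12
    divides neither q - 1 nor q + 1, and 5 does not divide q^2 - 1, then PSL(2,q)
    is wexp-solvable ([two_tori_absurd], [realizes_orders_odd]).

    In the other cases an explicit H fails.  For d even it is SL(2, sqrt q): its
    elements of order prime to p have order at most sqrt q + 1, and n is at least
    (q - 1)/2, which leaves only q = 4 and q = 9 ([SL_subfield_wexp_le3]).  If 12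
    divides m, it is the binary tetrahedral group, which would need an element of
    order 12 ([all_wexp_ndvd12]).  If 5 divides m, it is the binary icosahedral
    group, which would need an element of order 20 or of an order divisible by 15
    ([all_wexp_ndvd5]).  Both groups are written down as groups of unit
    quaternions.  For q = 4 and q = 9 only one prime matters in each of q - 1 and
    q + 1, since H contains Z ([realizes_orders_prime_power]).  The divisibility
    conditions on q = p^d, d odd, are conditions on p mod 120
    ([good_residue_pow], [bad_residue_pow]).

    Minimality is simplicity of PSL(2,q): its only proper quotient is trivial when
    q > 5 ([PSL2_quotient]), and for q at most 5 the criterion holds. *)

Set Implicit Arguments.
Unset Strict Implicit.
Unset Printing Implicit Defensive.

Import GRing.Theory.

Local Open Scope ring_scope.

(** * Two by two matrices through their entries *)

(** Reduces an equation to the polynomial identity which says that it is [k] times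
    a known equation; the certificate [k] is found by hand and the identity is
    left to [ring]. *)
Lemma lincomb (R : comRingType) (k a b l r : R) :
  l = r -> a - b = k * (l - r) -> a = b.
Proof. by move=> ->; rewrite subrr mulr0 => /eqP; rewrite subr_eq0 => /eqP. Qed.

Lemma lincomb2 (R : comRingType) (k1 k2 a b l1 r1 l2 r2 : R) :
  l1 = r1 -> l2 = r2 -> a - b = k1 * (l1 - r1) + k2 * (l2 - r2) -> a = b.
Proof. by move=> -> ->; rewrite !subrr !mulr0 addr0 => /eqP; rewrite subr_eq0 => /eqP. Qed.

(** The group structure on invertible matrices is named once and for all, so that
    it is not inferred anew from the matrix ring in every product. *)
Definition GL2 (F : finFieldType) : finGroupType := {'GL_2[F]}.
Definition SL (F : finFieldType) : {group GL2 F} := SL2_group F.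

Section Entries.
Variable F : finFieldType.
Implicit Types x y : GL2 F.

Definition ea x : F := GLval x 0 0.
Definition eb x : F := GLval x 0 1.
Definition ec x : F := GLval x 1 0.
Definition ed x : F := GLval x 1 1.
Definition tr x : F := ea x + ed x.

Lemma entries_inj x y :
  ea x = ea y -> eb x = eb y -> ec x = ec y -> ed x = ed y -> x = y.
Proof.
move=> ha hb hc hd; apply: val_inj; apply/matrixP=> i j /=.
have [-> | ->] : i = 0 \/ i = 1.
  by case: i => [[|[|//]] hi]; [left | right]; apply: val_inj.
all: have [-> | ->] : j = 0 \/ j = 1;
  by [case: j => [[|[|//]] hj]; [left | right]; apply: val_inj | ].
Qed.

Lemma ea1 : ea 1%g = 1. Proof. by rewrite /ea GL_1E mxE. Qed.
Lemma eb1 : eb 1%g = 0. Proof. by rewrite /eb GL_1E mxE. Qed.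
Lemma ec1 : ec 1%g = 0. Proof. by rewrite /ec GL_1E mxE. Qed.
Lemma ed1 : ed 1%g = 1. Proof. by rewrite /ed GL_1E mxE. Qed.

(** The statement about one pair of indices, from which the four entries of a
    product follow. *)
Lemma entM i j x y :
  GLval (x * y)%g i j = GLval x i 0 * GLval y 0 j + GLval x i 1 * GLval y 1 j.
Proof.
rewrite GL_ME mxE !big_ord_recl big_ord0 addr0.
by congr (_ + _ * _); [congr (GLval x _ _) | congr (GLval y _ _)]; apply: val_inj.
Qed.
Lemma eaM x y : ea (x * y)%g = ea x * ea y + eb x * ec y. Proof. exact: entM. Qed.
Lemma ebM x y : eb (x * y)%g = ea x * eb y + eb x * ed y. Proof. exact: entM. Qed.
Lemma ecM x y : ec (x * y)%g = ec x * ea y + ed x * ec y. Proof. exact: entM. Qed.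
Lemma edM x y : ed (x * y)%g = ec x * eb y + ed x * ed y. Proof. exact: entM. Qed.
Definition entE := (ea1, eb1, ec1, ed1, eaM, ebM, ecM, edM).

Lemma det2E (M : 'M[F]_2) : \det M = M 0 0 * M 1 1 - M 0 1 * M 1 0.
Proof.
rewrite (expand_det_row _ 0) !big_ord_recl big_ord0 addr0 /cofactor !det_mx11 !mxE.
rewrite /= expr0 mul1r expr1 mulN1r mulrN; congr (_ * M _ _ - M _ _ * M _ _); exact: val_inj.
Qed.

Lemma in_SL x : (x \in SL F) = (ea x * ed x - eb x * ec x == 1).
Proof. by rewrite inE det2E. Qed.

Lemma SL_det x : x \in SL F -> ea x * ed x - eb x * ec x = 1.
Proof. by rewrite in_SL => /eqP. Qed.

Definition mat2 (a b c d : F) : 'M[F]_2 :=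
  \matrix_(i, j) (if i == 0 then (if j == 0 then a else b)
                  else (if j == 0 then c else d)).

(** The value is the identity when the determinant is zero, so the entries are as
    given only under the determinant hypotheses below. *)
Definition gl2 (a b c d : F) : GL2 F := insubd (1%g : {'GL_2[F]}) (mat2 a b c d : 'M[F]_2.-1.+1).

Section Gl2.
Variables a b c d : F.
Hypothesis det_neq0 : a * d - b * c != 0.

Lemma GLval_gl2 : GLval (gl2 a b c d) = mat2 a b c d.
Proof. 
rewrite /gl2 (insubdK (T:='M[F]_2.-1.+1)) // -topredE /= unitmxE det2E !mxE /=.
by rewrite unitfE.
Qed.
Lemma ea_gl2 : ea (gl2 a b c d) = a. Proof. by rewrite /ea GLval_gl2 mxE. Qed.
Lemma eb_gl2 : eb (gl2 a b c d) = b. Proof. by rewrite /eb GLval_gl2 mxE. Qed.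
Lemma ec_gl2 : ec (gl2 a b c d) = c. Proof. by rewrite /ec GLval_gl2 mxE. Qed.
Lemma ed_gl2 : ed (gl2 a b c d) = d. Proof. by rewrite /ed GLval_gl2 mxE. Qed.
Definition gl2E := (ea_gl2, eb_gl2, ec_gl2, ed_gl2).
End Gl2.

Section Sl2.
Variables a b c d : F.
Hypothesis det1 : a * d - b * c = 1.
Let nz : a * d - b * c != 0. Proof. by rewrite det1 oner_eq0. Qed.
Lemma sl2E : (ea (gl2 a b c d) = a) * (eb (gl2 a b c d) = b) *
  (ec (gl2 a b c d) = c) * (ed (gl2 a b c d) = d).
Proof. by rewrite !gl2E. Qed.
Lemma gl2_SL : gl2 a b c d \in SL F.
Proof. by rewrite in_SL !gl2E // det1. Qed.
End Sl2.

Lemma SL_V x : x \in SL F ->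
  (ea x^-1%g = ed x) * (eb x^-1%g = - eb x) * (ec x^-1%g = - ec x) * (ed x^-1%g = ea x).
Proof.
move/SL_det=> dx.
have d' : ed x * ea x - (- eb x) * (- ec x) = 1 by rewrite -dx; ring.
have E : x^-1%g = gl2 (ed x) (- eb x) (- ec x) (ea x).
  apply/eqP; rewrite eq_sym -(mulg1 (gl2 _ _ _ _)) -(mulgV x) mulgA.
  rewrite -{2}(mul1g (x^-1)%g); apply/eqP; congr (_ * _)%g.
  by apply: entries_inj; rewrite !entE ?(sl2E d') -?dx; ring.
by rewrite E !(sl2E d').
Qed.

(** The difference x y - y x depends only on the vectors (b, c, a - d) of x and y:
    its entries are up to sign those of their cross product. *)
Lemma commuteE x y :
  commute x y <->
  [/\ eb x * ec y = ec x * eb y, (ea x - ed x) * eb y = (ea y - ed y) * eb x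
    & (ea x - ed x) * ec y = (ea y - ed y) * ec x].
Proof.
split=> [cxy | [h1 h2 h3]].
  have ha : ea (x * y)%g = ea (y * x)%g by rewrite cxy.
  have hb : eb (x * y)%g = eb (y * x)%g by rewrite cxy.
  have hc : ec (x * y)%g = ec (y * x)%g by rewrite cxy.
  move: ha hb hc; rewrite !entE => ha hb hc; split.
  - by apply: (lincomb (k := 1) ha); ring.
  - by apply: (lincomb (k := 1) hb); ring.
  by apply: (lincomb (k := -1) hc); ring.
apply: entries_inj; rewrite !entE.
- by apply: (lincomb (k := 1) h1); ring.
- by apply: (lincomb (k := 1) h2); ring.
- by apply: (lincomb (k := -1) h3); ring.
by apply: (lincomb (k := -1) h1); ring.
Qed.

End Entries.
(* From here on entries are handled only through the equations above. *)
#[global] Opaque ea eb ec ed.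

Local Close Scope ring_scope.
Local Open Scope group_scope.
Local Open Scope ring_scope.

(** * Commuting matrices and traces *)

Section Commutation.
Variable F : finFieldType.
Implicit Types x y w : GL2 F.

(** The scalar matrices. In SL(2,q) they form the centre. *)
Definition homothety x := [&& eb x == 0, ec x == 0 & ea x == ed x].

Lemma homothetyP x : reflect [/\ eb x = 0, ec x = 0 & ea x = ed x] (homothety x).
Proof. by apply: (iffP and3P) => [] [/eqP-> /eqP-> /eqP->]. Qed.

Lemma scalar_commute x y : homothety x -> commute x y.
Proof. by move=> /homothetyP[b0 c0 ad]; apply/commuteE; rewrite b0 c0 ad; split; ring. Qed.

(** Commuting with one upper and one lower elementary matrix already forces a
    matrix to be scalar. *)
Lemma center_SL x : (x \in 'Z(SL F)) = (x \in SL F) && homothety x.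
Proof.
apply/idP/andP=> [Zx | [Gx sx]]; last first.
  by apply/centerP; split=> // y _; apply: scalar_commute.
have /centerP[Gx cx] := Zx; split=> //.
have du : 1 * 1 - 1 * 0 = 1 :> F by ring.
have dl : 1 * 1 - 0 * 1 = 1 :> F by ring.
have /commuteE[] := cx _ (gl2_SL du); have /commuteE[] := cx _ (gl2_SL dl).
rewrite !(sl2E du, sl2E dl) !(mulr0, mulr1, subrr, mul0r).
by move=> b0 _ _ /esym c0 d0 _; apply/homothetyP; split=> //; apply/eqP; rewrite -subr_eq0 d0.
Qed.

(** The form of [commuteE] that allows division: the vector (b, c, a - d) of a
    non-scalar matrix is nonzero. *)
Lemma parallel_commute x y : ~~ homothety y -> commute x y ->
  exists k, [/\ eb x = k * eb y, ec x = k * ec y & ea x - ed x = k * (ea y - ed y)].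
Proof.
move=> nsy /commuteE[h1 h2 h3].
have [b0 | bn] := eqVneq (eb y) 0; last first.
  exists (eb x / eb y); split; first by rewrite mulfVK.
    by apply: (mulIf bn); rewrite mulrAC mulfVK // h1.
  by apply: (mulIf bn); rewrite mulrAC mulfVK // h2 mulrC.
have [c0 | cn] := eqVneq (ec y) 0; last first.
  exists (ec x / ec y); split; last 2 first.
  - by rewrite mulfVK.
  - by apply: (mulIf cn); rewrite mulrAC mulfVK // h3 mulrC.
  by apply: (mulIf cn); rewrite mulrAC mulfVK // h1 mulrC.
have dn : ea y - ed y != 0.
  by apply: contra nsy; rewrite subr_eq0 /homothety b0 c0 !eqxx.
exists ((ea x - ed x) / (ea y - ed y)); rewrite b0 c0 !mulr0 mulfVK //.
move: h2 h3; rewrite b0 c0 !mulr0 => /esym/eqP; rewrite mulf_eq0 (negPf dn) => /eqP->.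
by move=> /esym/eqP; rewrite mulf_eq0 (negPf dn) => /eqP->.
Qed.

(** Being parallel to a fixed nonzero vector is transitive. This is why
    centralizers of noncentral elements are abelian and partition the noncentral
    elements. *)
Lemma commute_trans x y w :
  ~~ homothety y -> commute x y -> commute y w -> commute x w.
Proof.
move=> nsy /(parallel_commute nsy)[k [b1 c1 d1]].
move=> /commute_sym/(parallel_commute nsy)[l [b2 c2 d2]].
by apply/commuteE; rewrite b1 b2 c1 c2 d1 d2; split; ring.
Qed.

(** The discriminant of the characteristic polynomial is a quadratic form in (b,
    c, a - d), so it is multiplied by a square along a parallel vector. *)
Lemma discE x : x \in SL F ->
  tr x ^+ 2 - 4 = (ea x - ed x) ^+ 2 + 4 * eb x * ec x.
Proof. by move/SL_det=> dx; apply: (lincomb (k := 4) dx); rewrite /tr; ring. Qed.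

(** By [discE], elements commuting with a non-scalar element of discriminant zero
    have discriminant zero. *)
Lemma disc_commute x y : x \in SL F -> y \in SL F -> ~~ homothety y ->
  commute x y -> tr y ^+ 2 = 4 -> tr x ^+ 2 = 4.
Proof.
move=> Gx Gy nsy /(parallel_commute nsy)[k [b1 c1 d1]] ty.
apply/eqP; rewrite -subr_eq0 discE // b1 c1 d1.
rewrite (_ : _ + _ = k ^+ 2 * ((ea y - ed y) ^+ 2 + 4 * eb y * ec y)); last by ring.
by rewrite -discE // ty subrr mulr0.
Qed.

Lemma tr1 : tr (1%g : GL2 F) = 2.
Proof. by rewrite /tr !entE. Qed.

Lemma trJ x y : tr (x ^ y)%g = tr x.
Proof.
have trC u v : tr (u * v)%g = tr (v * u)%g by rewrite /tr !entE; ring.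
by rewrite /conjg trC -mulgA mulgV mulg1.
Qed.

(** Cayley-Hamilton. *)
Lemma tr_expSS x n : x \in SL F ->
  tr (x ^+ n.+2)%g = tr x * tr (x ^+ n.+1)%g - tr (x ^+ n)%g.
Proof.
move=> /SL_det dx; rewrite !expgS; set y := (x ^+ n)%g; rewrite /tr !entE.
by apply: (lincomb (k := - (ea y + ed y)) dx); ring.
Qed.

Lemma scalar_tr2 x : x \in SL F -> homothety x -> tr x = 2 -> x = 1%g.
Proof.
move=> /SL_det dx /homothetyP[b0 c0 ad]; rewrite /tr -ad => t2.
have a1 : ea x = 1.
  move: dx; rewrite b0 c0 mulr0 subr0 -ad => a2.
  apply/eqP; rewrite -subr_eq0 -sqrf_eq0; apply/eqP.
  by apply: (lincomb2 (k1 := 1) (k2 := -1) a2 t2); ring.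
by apply: entries_inj; rewrite !entE -?ad.
Qed.

Lemma scalar_tr x : x \in SL F -> homothety x -> tr x ^+ 2 = 4.
Proof.
move=> /SL_det dx /homothetyP[b0 c0 ad]; rewrite /tr -ad.
by apply: (lincomb (k := 4) dx); rewrite b0 c0 -ad; ring.
Qed.

Lemma scalar_ext x y : x \in SL F -> y \in SL F -> homothety x -> homothety y ->
  tr x = tr y -> x = y.
Proof.
move=> Gx Gy sx sy txy.
apply/eqP; rewrite eq_mulgV1; apply/eqP; apply: scalar_tr2.
- by rewrite groupMr ?groupV.
- case/homothetyP: sx sy => [b0 c0 ad] /homothetyP[b0' c0' ad'].
  by apply/homothetyP; rewrite !entE !(SL_V Gy) b0 c0 ad b0' c0' ad'; split; ring.
move: (SL_det Gx) txy; case/homothetyP: sx => b0 c0 ad; case/homothetyP: sy => b0' c0' ad'.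
rewrite /tr !entE !(SL_V Gy) b0 c0 -ad b0' c0' -ad' !(oppr0, mulr0, addr0, add0r, subr0) => d1 tt.
move: (ea x) (ea y) d1 tt => a b d1 tt.
by apply: (lincomb2 (k1 := 2) (k2 := - a) d1 tt); ring.
Qed.

(** With x = e + N, where N is nilpotent, the binomial formula has two terms; the
    exponent of e is written n + 1 because e = 1/e. *)
Lemma parabolic_exp (e : F) x n : x \in SL F -> e ^+ 2 = 1 -> tr x = 2 * e ->
  [/\ ea (x ^+ n)%g = e ^+ n + n%:R * e ^+ n.+1 * (ea x - e),
      eb (x ^+ n)%g = n%:R * e ^+ n.+1 * eb x,
      ec (x ^+ n)%g = n%:R * e ^+ n.+1 * ec x &
      ed (x ^+ n)%g = e ^+ n - n%:R * e ^+ n.+1 * (ea x - e)].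
Proof.
move=> /SL_det dx e2 tx; have dE : ed x = 2 * e - ea x by rewrite -tx /tr; ring.
have bc : eb x * ec x = - (ea x - e) ^+ 2.
  by apply: (lincomb2 (k1 := -1) (k2 := 1) dx e2); rewrite dE; ring.
elim: n => [|n [IHa IHb IHc IHd]].
  by rewrite !entE; split; ring.
rewrite expgSr !entE IHa IHb IHc IHd dE -natr1 !(exprS e n.+1) (exprS e n).
split.
- by apply: (lincomb2 (k1 := n%:R * e * e ^+ n) (k2 := -(e ^+ n * (ea x - e))) bc e2); ring.
- by apply: (lincomb (k := - e ^+ n * eb x) e2); ring.
- by apply: (lincomb (k := - e ^+ n * ec x) e2); ring.
by apply: (lincomb2 (k1 := n%:R * e * e ^+ n) (k2 := e ^+ n * (ea x - e)) bc e2); ring.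
Qed.

(** The square of the trace is 4 exactly when there is a double eigenvalue e, and
    then e = 1 or e = -1. *)
Lemma sqr_tr4 x : tr x ^+ 2 = 4 -> exists2 e, e ^+ 2 = 1 & tr x = 2 * e.
Proof.
move=> t4; have : (tr x - 2) * (tr x + 2) == 0.
  by apply/eqP; apply: (lincomb (k := 1) t4); ring.
rewrite mulf_eq0 subr_eq0 addr_eq0 => /orP[] /eqP ->.
  by exists 1; ring.
by exists (-1); ring.
Qed.

Lemma parabolic_expp p x : p \in [pchar F] -> x \in SL F -> tr x ^+ 2 = 4 ->
  homothety (x ^+ p)%g.
Proof.
move=> chp Gx /sqr_tr4[e e2 te]; have [ha hb hc hd] := parabolic_exp p Gx e2 te.
by apply/homothetyP; rewrite ha hb hc hd (pcharf0 chp) !mul0r subr0 addr0.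
Qed.

End Commutation.

(** * Eigenvalues *)

Section Eigenvalues.
Variables (F : finFieldType) (K : closedFieldType) (f : {rmorphism F -> K}).
Implicit Types (x y w : GL2 F) (l : K).

(** The eigenvalues of a matrix of determinant 1 are l and 1/l, so its trace alone
    says whether l is one of them. *)
Definition eigen x l := (l != 0) && (f (tr x) == l + l^-1).

Lemma eigenP x l : reflect (l != 0 /\ f (tr x) = l + l^-1) (eigen x l).
Proof. by apply: (iffP andP) => -[-> /eqP->]. Qed.

Lemma root_of_sum (t : K) : exists2 l, l != 0 & t = l + l^-1.
Proof.
have [l] := @solve_monicpoly K 2 (fun i => if i == 0%N then -1 else t) isT.
rewrite !big_ord_recl big_ord0 /= /bump /= expr0 mulr1 addr0 expr1 => el.
have ln0 : l != 0.
  apply/eqP => l0; move: el; rewrite l0 mulr0 addr0 expr2 mul0r => /esym/eqP.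
  by rewrite oppr_eq0 oner_eq0.
exists l => //; apply: (mulIf ln0).
by rewrite mulrDl mulVf // -expr2 el; ring.
Qed.

Lemma eigen_exists x : exists l, eigen x l.
Proof. by have [l ln0 e] := root_of_sum (f (tr x)); exists l; apply/eigenP. Qed.

Lemma eigen_exp x l n : x \in SL F -> eigen x l -> eigen (x ^+ n)%g (l ^+ n).
Proof.
move=> Gx /eigenP[ln0 e].
suff h m : f (tr (x ^+ m)%g) = l ^+ m + l ^- m /\
           f (tr (x ^+ m.+1)%g) = l ^+ m.+1 + l ^- m.+1.
  by apply/eigenP; rewrite expf_neq0 // (h n).1.
elim: m => [|m [IH1 IH2]].
  by rewrite expg0 expg1 tr1 e !expr0 expr1 invr1 rmorph_nat; split.
split=> //; rewrite tr_expSS // rmorphB rmorphM IH1 IH2 e !exprS !invfM.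
by field; rewrite ln0 expf_neq0.
Qed.

Lemma sumV_eq (a b : K) : a != 0 -> b != 0 -> a + a^-1 = b + b^-1 ->
  a = b \/ a = b^-1.
Proof.
move=> a0 b0 e.
have : (a - b) * (a - b^-1) == 0.
  have e2 : a * (a + a^-1) = a * (b + b^-1) by rewrite e.
  apply/eqP; move: e2; rewrite mulrDr mulfV // => e2.
  by apply: (lincomb (k := 1) e2); field.
by rewrite mulf_eq0 !subr_eq0 => /orP[] /eqP; [left | right].
Qed.

Lemma sumV_eq2 (a : K) : a != 0 -> (a + a^-1 == 2) = (a == 1).
Proof.
move=> a0; apply/eqP/eqP => [e | ->]; last by rewrite invr1.
have := @sumV_eq a 1 a0 (oner_neq0 _); rewrite invr1 => h.
by case: h.
Qed.

Lemma eigen_tr x y l : eigen x l -> eigen y l -> tr x = tr y.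
Proof. by move=> /eigenP[_ ex] /eigenP[_ ey]; apply: (fmorph_inj f); rewrite ex ey. Qed.

Lemma eigen_tr2 x l : eigen x l -> (tr x == 2) = (l == 1).
Proof.
move=> /eigenP[l0 e]; rewrite -(sumV_eq2 l0) -e.
by rewrite -(inj_eq (fmorph_inj f)) rmorph_nat.
Qed.

Lemma eigen_root l x : eigen x l -> tr x ^+ 2 = 4 -> l ^+ 2 = 1.
Proof.
move=> /eigenP[l0 e] /(congr1 f); rewrite rmorphXn e rmorph_nat /= => h.
apply/eqP; rewrite -subr_eq0 -sqrf_eq0; apply/eqP; apply: (lincomb (k := l ^+ 2) h).
by field.
Qed.

Lemma card_pnat (R : fieldType) : [pchar F] =i [pchar R] -> [pchar R].-nat #|F|.
Proof.
move=> eqch; have [p p_pr chp] := finPcharP F.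
have chK : p \in [pchar R] by rewrite -eqch.
rewrite (eq_pnat _ (pcharf_eq chK)).
have := fin_ring_pchar_abelem chp; case/and3P => pF _ _.
by move: pF; rewrite /pgroup cardsT.
Qed.

(** The Frobenius map x -> x^q fixes the trace, hence permutes the two
    eigenvalues. *)
Lemma eigen_pow_card x l : eigen x l -> l ^+ #|F| = l \/ l ^+ #|F| = l^-1.
Proof.
move=> /eigenP[l0 e].
have qn : [pchar K].-nat #|F| by apply: card_pnat => p; rewrite (fmorph_pchar f).
apply: sumV_eq; rewrite ?expf_neq0 // -exprVn -exprDn_pchar // -e -rmorphXn /=.
by rewrite expf_card.
Qed.

(** The split case, where Frobenius fixes the eigenvalues, and the nonsplit case,
    where it exchanges them. *)
Lemma eigen_type x l : eigen x l -> l ^+ #|F|.-1 = 1 \/ l ^+ #|F|.+1 = 1.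
Proof.
move=> ex; have /eigenP[l0 _] := ex.
have q0 : (0 < #|F|)%N by rewrite (cardD1 0) inE.
case: (eigen_pow_card ex) => h; [left | right].
  by apply: (mulfI l0); rewrite -exprS prednK // mulr1.
by rewrite exprS h mulfV.
Qed.

End Eigenvalues.

(** * Elements of order prime to the characteristic *)

Section Semisimple.
Variables (F : finFieldType) (p : nat).
Hypothesis chp : p \in [pchar F].
Implicit Types (x y w : GL2 F) (H : {group GL2 F}).
Local Notation G := (SL F).

Let p_pr : prime p. Proof. exact: pcharf_prime chp. Qed.

Lemma card_char : exists2 n, (0 < n)%N & #|F| = (p ^ n)%N.
Proof.
have : p.-nat #|F|.
  by have /and3P[pF _ _] := fin_ring_pchar_abelem chp; move: pF; rewrite /pgroup cardsT.
case/p_natP=> n e; exists n => //; case: n e => // e.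
by have := finNzRing_gt1 F; rewrite e.
Qed.

Lemma groupX_SL x (n : nat) : x \in SL F -> (x ^+ n)%g \in SL F.
Proof. exact: groupX. Qed.

Lemma scalarX x (n : nat) : x \in SL F -> homothety x -> homothety (x ^+ n)%g.
Proof.
move=> Gx sx; have : x \in 'Z(G) by rewrite center_SL Gx.
by move/(groupX n); rewrite center_SL => /andP[].
Qed.

Lemma scalar_p' x : x \in SL F -> homothety x -> ~~ (p %| #[x])%N.
Proof.
move=> Gx sx; have [b0 c0 ad] := homothetyP _ sx; have := SL_det Gx.
rewrite b0 c0 -ad mul0r subr0 => a2.
have x2 : (x ^+ 2)%g = 1%g.
  apply: entries_inj; rewrite expgS expg1 !entE ?b0 ?c0 -?ad ?a2; ring.
apply/negP=> px; have : (#[x] %| 2)%N by rewrite order_dvdn x2.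
move/(dvdn_trans px); rewrite dvdn_prime2 // => /eqP p2.
have ch2 : 2%:R = 0 :> F by rewrite -p2 (pcharf0 chp).
have a1 : ea x = 1.
  by apply/eqP; rewrite -subr_eq0 -sqrf_eq0; apply/eqP;
    apply: (lincomb2 (k1 := 1) (k2 := 1 - ea x) a2 ch2); ring.
have : x = 1%g by apply: entries_inj; rewrite !entE // -?ad.
by move=> x1; move: px; rewrite x1 order1 p2.
Qed.

(** An eigenvalue satisfies l^(p^k) = 1, hence (l - 1)^(p^k) = 0. *)
Lemma p_elt_tr2 x : x \in SL F -> p.-elt x -> tr x = 2.
Proof.
move=> Gx /p_natP[k ox].
have [K [f _]] := countable_algebraic_closure F.
have [l el] := eigen_exists f x.
have l1 : l ^+ (p ^ k) = 1.
  have := eigen_tr2 (eigen_exp (p ^ k) Gx el).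
  by rewrite -ox expg_order tr1 eqxx => /esym/eqP.
have chK : p \in [pchar K] by rewrite (fmorph_pchar f).
apply/eqP; rewrite (eigen_tr2 el) -subr_eq0.
have kn : [pchar K].-nat (p ^ k)%N by rewrite (eq_pnat _ (pcharf_eq chK)) pnatX pnat_id.
have : (l - 1) ^+ (p ^ k) == 0.
  by rewrite exprDn_pchar // exprNn_pchar // expr1n l1 subrr.
by rewrite expf_eq0 => /andP[].
Qed.

(** An element of order p in the cyclic group has trace 2, and discriminant zero
    passes to everything that commutes with it. Conversely the p-th power of an
    element with discriminant zero is scalar, by [parabolic_expp]. *)
Lemma p_dvd_order x : x \in SL F -> ~~ homothety x ->
  (p %| #[x])%N = (tr x ^+ 2 == 4).
Proof.
move=> Gx nsx; apply/idP/eqP=> [px | t4].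
  pose u := (x ^+ (#[x] %/ p))%g.
  have ou : #[u] = p by rewrite orderXdiv ?dvdn_div // divnA // mulKn.
  have Gu : u \in SL F by apply: groupX_SL.
  have tu : tr u = 2 by apply: p_elt_tr2 => //; rewrite /p_elt ou pnat_id.
  have nsu : ~~ homothety u.
    apply/negP => su; have u1 := scalar_tr2 Gu su tu.
    by move: ou p_pr; rewrite u1 order1 => <-.
  apply: (disc_commute Gx Gu nsu); last by rewrite tu; ring.
  exact: commuteX.
apply: contraR nsx => npx.
have cop : coprime #[x] p by rewrite coprime_sym prime_coprime.
have : x \in <[(x ^+ p)%g]>%g by rewrite -(eqP (_ : generator <[x]> (x ^+ p)%g)) ?cycle_id ?generator_coprime.
case/cycleP=> i ->; apply: scalarX; first exact: groupX_SL.
exact: parabolic_expp.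
Qed.

Lemma p'_tr x : x \in SL F -> ~~ homothety x -> ~~ (p %| #[x])%N -> tr x ^+ 2 != 4.
Proof. by move=> Gx nsx; rewrite p_dvd_order. Qed.

Lemma p'X x (n : nat) : ~~ (p %| #[x])%N -> ~~ (p %| #[(x ^+ n)%g])%N.
Proof. by apply: contra => /dvdn_trans; apply; apply: orderXdvd. Qed.

Lemma p'_tr2 x : x \in SL F -> ~~ (p %| #[x])%N -> tr x = 2 -> x = 1%g.
Proof.
move=> Gx px t2; apply: scalar_tr2 => //; apply: contraR px => nsx.
by rewrite p_dvd_order // t2; apply/eqP; ring.
Qed.

Section Eigen.
Variables (K : closedFieldType) (f : {rmorphism F -> K}).

(** Away from p, only the identity has trace 2, so the order can be read off the
    eigenvalue. *)
Lemma eigen_exp_eq1 x l n : x \in SL F -> ~~ (p %| #[x])%N -> eigen f x l ->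
  (x ^+ n == 1)%g = (l ^+ n == 1).
Proof.
move=> Gx px el; rewrite -(eigen_tr2 (eigen_exp n Gx el)).
apply/eqP/eqP=> [-> | t2]; first exact: tr1.
by apply: p'_tr2; rewrite ?groupX_SL ?p'X.
Qed.

Lemma eigen_prim x l : x \in SL F -> ~~ (p %| #[x])%N -> eigen f x l ->
  #[x].-primitive_root l.
Proof.
move=> Gx px el; apply/andP; split; first exact: order_gt0.
apply/forallP=> i; rewrite unity_rootE -(eigen_exp_eq1 _ Gx px el) -order_dvdn.
apply/eqP; apply/idP/eqP=> [d | -> //].
by apply/eqP; rewrite eqn_leq ltn_ord /= dvdn_leq.
Qed.
End Eigen.

(** By [eigen_type] an element of order prime to p lies in a split torus, of order
    q - 1, or in a nonsplit one, of order q + 1. *)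
Lemma p'_type x : x \in SL F -> ~~ (p %| #[x])%N ->
  (#[x] %| #|F|.-1)%N \/ (#[x] %| #|F|.+1)%N.
Proof.
move=> Gx px; have [K [f _]] := countable_algebraic_closure F.
have [l el] := eigen_exists f x.
rewrite !order_dvdn !(eigen_exp_eq1 _ Gx px el).
by case: (eigen_type el) => ->; rewrite eqxx; [left | right].
Qed.

(** An eigenvalue of w is a primitive root of unity of order #[w], so every
    eigenvalue of y is one of its powers. *)
Lemma p'_tr_cycle w y : w \in SL F -> y \in SL F ->
  ~~ (p %| #[w])%N -> ~~ (p %| #[y])%N -> (y ^+ #[w] = 1)%g ->
  exists i, tr y = tr (w ^+ i)%g.
Proof.
move=> Gw Gy pw py yw; have [K [f _]] := countable_algebraic_closure F.
have [l el] := eigen_exists f w; have [m em] := eigen_exists f y.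
have /(prim_rootP (eigen_prim Gw pw el))[i mi] : m ^+ #[w] = 1.
  by apply/eqP; rewrite -(eigen_exp_eq1 _ Gy py em) yw.
by exists i; apply: (eigen_tr em); rewrite mi; apply: eigen_exp.
Qed.

(** By [parallel_commute] and [discE] the vectors (b, c, a - d) of x and y differ
    by a factor k with k^2 = 1. In odd characteristic the trace finishes the
    proof; in characteristic 2 the difference of the diagonals is the s of the
    proof, with s = 0 or s = tr x. *)
Lemma commute_same_tr x y : x \in SL F -> y \in SL F -> ~~ homothety x ->
  tr x ^+ 2 != 4 -> commute y x -> tr y = tr x -> y = x \/ y = (x^-1)%g.
Proof.
move=> Gx Gy nsx tx cyx txy.
have [k [kb kc kd]] := parallel_commute nsx cyx.
have k2 : (k - 1) * (k + 1) == 0.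
  have D0 : tr x ^+ 2 - 4 != 0 by rewrite subr_eq0.
  have D := discE Gx; have D' := discE Gy.
  rewrite txy kb kc kd in D'.
  apply/eqP; apply: (mulIf D0); rewrite mul0r.
  by apply: (lincomb2 (k1 := k ^+ 2) (k2 := -1) D D'); ring.
have dx := SL_det Gx; have dy := SL_det Gy; rewrite kb kc in dy.
rewrite /tr in txy.
have V := SL_V Gx.
have two (a b : F) : 2 * a = 0 -> a != 0 -> b = - b :> F.
  move=> /eqP; rewrite mulf_eq0 => /orP[/eqP h _ | ->] //.
  by apply: (lincomb (k := b) h); ring.
move: k2; rewrite mulf_eq0 subr_eq0 addr_eq0 => /orP[] /eqP kk; rewrite kk in kb kc kd dy.
  pose s := ea y - ea x.
  have ay : ea y = ea x + s by rewrite /s; ring.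
  have dyy : ed y = ed x + s by rewrite /s; apply: (lincomb (k := -1) kd); ring.
  have s2 : 2 * s = 0 by rewrite ay dyy in txy; apply: (lincomb (k := 1) txy); ring.
  have : s * (s + ea x + ed x) == 0.
    by apply/eqP; rewrite ay dyy in dy; apply: (lincomb2 (k1 := 1) (k2 := -1) dy dx); ring.
  (* If s is nonzero then 2 = 0 by s2, and y is the inverse of x. *)
  have [s0 _ | sn0] := eqVneq s 0.
    left; apply: entries_inj; rewrite ?kb ?kc ?ay ?dyy ?s0; ring.
  rewrite mulf_eq0 (negPf sn0) /= => /eqP sE.
  have tw b := two s b s2 sn0.
  right; apply: entries_inj; rewrite !V ?kb ?kc ?ay ?dyy.
  - by rewrite [RHS]tw; apply: (lincomb (k := 1) sE); ring.
  - by rewrite mul1r [LHS]tw.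
  - by rewrite mul1r [LHS]tw.
  by rewrite [RHS]tw; apply: (lincomb (k := 1) sE); ring.
pose s := ea y - ed x.
have ay : ea y = ed x + s by rewrite /s; ring.
have dyy : ed y = ea x + s by rewrite /s; apply: (lincomb (k := -1) kd); ring.
have s2 : 2 * s = 0 by rewrite ay dyy in txy; apply: (lincomb (k := 1) txy); ring.
have : s * (s + ea x + ed x) == 0.
  by apply/eqP; rewrite ay dyy in dy; apply: (lincomb2 (k1 := 1) (k2 := -1) dy dx); ring.
have [s0 _ | sn0] := eqVneq s 0.
  right; apply: entries_inj; rewrite !V ?kb ?kc ?ay ?dyy ?s0; ring.
rewrite mulf_eq0 (negPf sn0) /= => /eqP sE.
have tw b := two s b s2 sn0.
left; apply: entries_inj; rewrite ?kb ?kc ?ay ?dyy.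
- by rewrite [RHS]tw; apply: (lincomb (k := 1) sE); ring.
- by rewrite mulN1r -tw.
- by rewrite mulN1r -tw.
by rewrite [RHS]tw; apply: (lincomb (k := 1) sE); ring.
Qed.

Lemma cent1_same_tr H x y w : H \subset G -> x \in H -> ~~ homothety x -> 
  ~~ (p %| #[x])%N -> y \in 'C_H[x]%g -> w \in 'C_H[x]%g -> tr y = tr w ->
  y = w \/ y = (w^-1)%g.
Proof.
move=> sHG Hx nsx px /setIP[Hy /cent1P cxy] /setIP[Hw /cent1P cxw] tyw.
have [Gx Gy Gw] : [/\ x \in SL F, y \in SL F & w \in SL F] by split; apply: (subsetP sHG).
have tx := p'_tr Gx nsx px.
have t_ns z : z \in SL F -> commute x z -> tr z ^+ 2 = 4 -> homothety z.
  move=> Gz cz t4; apply: contraR tx => nsz.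
  by rewrite (disc_commute Gx Gz nsz cz t4).
have [sw | nsw] := boolP (homothety w).
  have sy : homothety y by apply: t_ns => //; rewrite tyw; apply: scalar_tr.
  by left; apply: scalar_ext.
apply: commute_same_tr => //; last by apply: (commute_trans nsx) => //; apply: commute_sym.
by apply: contra nsw => /eqP t4; apply: t_ns.
Qed.

Lemma cent1_p' H x y : H \subset G -> x \in H -> ~~ homothety x -> 
  ~~ (p %| #[x])%N -> y \in 'C_H[x]%g -> ~~ (p %| #[y])%N.
Proof.
move=> sHG Hx nsx px /setIP[Hy /cent1P cxy].
have [Gx Gy] : x \in SL F /\ y \in SL F by split; apply: (subsetP sHG).
have [sy | nsy] := boolP (homothety y); first exact: scalar_p'.
rewrite p_dvd_order //; apply: contra (p'_tr Gx nsx px) => /eqP ty.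
by rewrite (disc_commute Gx Gy nsy (commute_sym cxy) ty).
Qed.

Lemma cent1_abelian H x : H \subset G -> ~~ homothety x -> abelian 'C_H[x]%g.
Proof.
move=> sHG nsx; apply/centsP=> y /setIP[_ /cent1P cxy] z /setIP[_ /cent1P cxz].
by apply: (commute_trans nsx) => //; apply: commute_sym.
Qed.

(** An abelian group contains an element w of order its exponent. Each element has
    the trace of a power of w by [p'_tr_cycle], and equals that power or its
    inverse by [cent1_same_tr]. *)
Lemma cent1_cyclic H x : H \subset G -> x \in H -> ~~ homothety x -> 
  ~~ (p %| #[x])%N -> cyclic 'C_H[x]%g.
Proof.
move=> sHG Hx nsx px; have abC := cent1_abelian sHG nsx.
have [w Cw ew] := exponent_witness (abelian_nil abC).
have sCG : 'C_H[x]%g \subset G by rewrite subIset ?sHG.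
apply/cyclicP; exists w; apply/eqP; rewrite eqEsubset cycle_subG Cw andbT.
apply/subsetP=> y Cy.
have [i ti] : exists i, tr y = tr (w ^+ i)%g.
  apply: (p'_tr_cycle (subsetP sCG _ Cw) (subsetP sCG _ Cy)).
  - exact: cent1_p' Cw.
  - exact: cent1_p' Cy.
  - by rewrite -ew expg_exponent.
have Cwi : (w ^+ i)%g \in 'C_H[x]%g by rewrite groupX.
case: (cent1_same_tr sHG Hx nsx px Cy Cwi ti) => ->; first exact: mem_cycle.
by rewrite groupV mem_cycle.
Qed.

Lemma cent1_type H x : H \subset G -> x \in H -> ~~ homothety x -> 
  ~~ (p %| #[x])%N ->
  ~~ (p %| #|('C_H[x])%g|)%N /\ ((#|('C_H[x])%g| %| #|F|.-1)%N \/ (#|('C_H[x])%g| %| #|F|.+1)%N).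
Proof.
move=> sHG Hx nsx px; have /cyclicP[w Cw] := cent1_cyclic sHG Hx nsx px.
have Cxw : w \in 'C_H[x]%g by rewrite Cw cycle_id.
have Gw : w \in SL F by case/setIP: Cxw => /(subsetP sHG).
have pw := cent1_p' sHG Hx nsx px Cxw.
by rewrite Cw; split=> //; apply: p'_type.
Qed.

End Semisimple.

(** * The order of SL(2,q) *)

Section Counting.
Variable F : finFieldType.
Implicit Types x y : GL2 F.

(** This is a subgroup when S is a subfield. Counting it for any such S gives both
    |SL(2,q)| and the order of the subgroup over a subfield. *)
Definition SL_over (S : {set F}) : {set GL2 F} :=
  [set x in SL F | [&& ea x \in S, eb x \in S, ec x \in S & ed x \in S]].

(** The first column is any nonzero vector, and then one free entry fixes the
    second column: b if a is nonzero and d otherwise. *)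
Lemma card_SL_over (S : {set F}) :
  0 \in S -> 1 \in S -> {in S &, forall a b, a * b \in S} ->
  {in S &, forall a b, a - b \in S} -> {in S, forall a, a^-1 \in S} ->
  #|SL_over S| = (#|S| * (#|S| ^ 2).-1)%N.
Proof.
move=> S0 S1 SM SB SV.
have SN a : a \in S -> - a \in S by move=> Sa; rewrite -sub0r SB.
have SD a b : a \in S -> b \in S -> a + b \in S.
  by move=> Sa Sb; rewrite -(opprK b) SB ?SN.
(* The bijection between SL_over S and its parameters. *)
pose phi x : F * F * F := (ea x, ec x, if ea x == 0 then ed x else eb x).
pose T := setX (setX S S :\ (0, 0)) S.
have cT : #|T| = (#|S| * (#|S| ^ 2).-1)%N.
  rewrite cardsX mulnC; congr (_ * _)%N.
  by rewrite -mulnn -cardsX [in RHS](cardsD1 (0, 0)) !inE /= S0.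
rewrite -cT -(@card_in_imset _ _ phi (SL_over S)); last first.
  move=> x y; rewrite inE => /andP[/SL_det dx _]; rewrite inE => /andP[/SL_det dy _].
  move=> [ha hc]; move: dx dy.
  rewrite ha hc; have [a0 | an0] := eqVneq (ea y) 0 => dx dy h.
    have cn : ec y != 0.
      by apply: contraPneq dy => c0; rewrite a0 c0 mul0r mulr0 subr0 => /esym/eqP; rewrite oner_eq0.
    apply: entries_inj => //; apply: (mulIf cn).
    by rewrite a0 !mul0r !sub0r in dx dy; apply: oppr_inj; rewrite dx dy.
  apply: entries_inj => //; apply: (mulfI an0).
  by apply: (addIr (- (eb y * ec y))); rewrite dy -h dx.
apply: eq_card => -[[a c] e].
rewrite !inE /= xpair_eqE; apply/imsetP/idP.
  move=> [x]; rewrite inE => /andP[/SL_det dx /and4P[Sa Sb Sc Sd]] [-> -> ->].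
  rewrite Sa Sc; case: eqP => [a0 | _] /=; rewrite ?Sb ?Sd ?andbT //.
  apply: contraPneq dx => c0; rewrite a0 c0 mul0r mulr0 subr0 => /esym/eqP.
  by rewrite oner_eq0.
case/andP=> /andP[nz /andP[Sa Sc]] Se.
have [a0 | an0] := eqVneq a 0.
  rewrite a0 eqxx /= in nz.
  have d1 : a * e - (- c^-1) * c = 1 by rewrite a0; field.
  exists (gl2 a (- c^-1) c e); last by rewrite /phi !(sl2E d1) a0 eqxx.
  by rewrite inE !(sl2E d1) Sa Sc Se SN ?SV // gl2_SL.
have d1 : a * ((1 + e * c) / a) - e * c = 1 by field.
exists (gl2 a e c ((1 + e * c) / a)); last by rewrite /phi !(sl2E d1) (negPf an0).
rewrite inE !(sl2E d1) Sa Sc Se gl2_SL //=.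
exact: (SM _ _ (SD _ _ S1 (SM _ _ Se Sc)) (SV _ Sa)).
Qed.

Lemma card_SL : #|SL F| = (#|F| * #|F|.-1 * #|F|.+1)%N.
Proof.
have -> : #|SL F| = #|SL_over [set: F]|.
  by apply: eq_card => x; rewrite [RHS]inE !in_setT !andbT.
rewrite card_SL_over ?cardsT //; try by move=> *; rewrite inE.
rewrite -mulnA; congr (_ * _)%N.
have := finNzRing_gt1 F; case: #|F| => // n _; lia.
Qed.

End Counting.

(** * Binary quadratic forms over a finite field *)

Section Forms.
Variables (F : finFieldType) (p : nat).
Hypothesis chp : p \in [pchar F].

Lemma odd_card : (2 : F) != 0 -> odd #|F|.
Proof.
have [n n0 ->] := card_char chp; move=> two; rewrite oddX orbC.
apply/orP; left; case: (even_prime (pcharf_prime chp)) => // p2.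
by move: two; rewrite -(pcharf0 chp) p2 eqxx.
Qed.

(** Every element is a chosen square root of its square or the opposite of one, so
    the squares make up at least half of the field. *)
Lemma card_squares : (#|F| <= 2 * #|[set u ^+ 2 | u : F]|)%N.
Proof.
set S := [set _ | u : _].
pose r (s : F) : F := odflt 0 [pick u : F | s == u ^+ 2].
have rE (u : F) : r (u ^+ 2) ^+ 2 = u ^+ 2.
  by rewrite /r; case: pickP => [v /eqP <- //| /(_ u)]; rewrite eqxx.
rewrite -cardsT; apply: (@leq_trans #|(r @: S) :|: [set - u | u in r @: S]|).
  apply/subset_leq_card/subsetP=> u _; rewrite inE.
  have ru : r (u ^+ 2) \in r @: S by apply/imset_f/imset_f.
  have := rE u => /eqP; rewrite eqf_sqr => /orP[] /eqP h; first by rewrite -{1}h ru.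
  by apply/orP; right; rewrite -(opprK u) -h; apply: imset_f.
rewrite mul2n -addnn (leq_trans (leq_card_setU _ _)) // leq_add ?leq_imset_card //.
by rewrite (leq_trans (leq_imset_card _ _)) // leq_imset_card.
Qed.

(** The sets of values u^2 and e - D v^2 each contain more than half of the field,
    since q is odd, so they meet. *)
Lemma sum_of_squares (D e : F) : (2 : F) != 0 -> D != 0 ->
  exists u v, u ^+ 2 + D * v ^+ 2 = e.
Proof.
move=> /odd_card oF D0; pose S : {set F} := [set u ^+ 2 | u : F].
pose S' : {set F} := [set e - D * s | s in S].
have cS' : #|S'| = #|S|.
  by apply: card_imset => a b /addrI/oppr_inj/(mulfI D0).
have : ~~ [disjoint S & S'].
  rewrite -setI_eq0 -cards_eq0 -lt0n.
  pose k := #|S|; pose m := #|S :|: S'|; pose q := #|F|.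
  have km : (m + #|S :&: S'| = k + k)%N by rewrite cardsUI cS'.
  have kq : (q <= 2 * k)%N by apply: card_squares.
  have mq : (m <= q)%N by apply: max_card.
  have oq : odd q by [].
  by have := odd_double_half q; rewrite oq; lia.
case/pred0Pn=> s /andP[/imsetP[u _ su] /imsetP[t /imsetP[v _ ->]] sv].
by exists u, v; rewrite -su sv; ring.
Qed.

Lemma char2_sqrt (a : F) : (2 : F) = 0 -> exists u, u ^+ 2 = a.
Proof.
move=> two; have inj : injective (fun u : F => u ^+ 2).
  move=> u v uv; apply/eqP; rewrite -subr_eq0 -sqrf_eq0; apply/eqP.
  by apply: (lincomb2 (k1 := 1) (k2 := v ^+ 2 - u * v) uv two); ring.
by exists (invF inj a); rewrite (f_invF inj).
Qed.

(** Completing the square reduces to [sum_of_squares]; in characteristic 2 every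
    element is a square. *)
Lemma form_universal (a b c : F) : b ^+ 2 - 4 * a * c != 0 ->
  exists u v, a * u ^+ 2 + b * u * v + c * v ^+ 2 = 1.
Proof.
move=> D0; have [two | two] := eqVneq (2 : F) 0.
  have bn0 : b != 0.
    apply: contra D0 => /eqP ->; apply/eqP.
    by apply: (lincomb (k := - 2 * a * c) two); ring.
  have [a0 | an0] := eqVneq a 0.
    by exists ((1 - c) / b), 1; rewrite a0; field.
  have [u uE] := char2_sqrt a^-1 two.
  by exists u, 0; rewrite uE; field.
have [a0 | an0] := eqVneq a 0.
  have bn0 : b != 0 by apply: contra D0 => /eqP ->; rewrite a0; apply/eqP; ring.
  by exists ((1 - c) / b), 1; rewrite a0; field.
have [|u [v uv]] := sum_of_squares (D := - (b ^+ 2 - 4 * a * c)) (4 * a) two.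
  by rewrite oppr_eq0.
exists ((u - b * v) / (2 * a)), v.
have n4 : 4 * a != 0 by rewrite (_ : 4 = 2 * 2 :> F) ?mulf_neq0 //; ring.
apply: (mulfI n4); rewrite mulr1 -[RHS]uv; field.
by rewrite two an0.
Qed.

End Forms.

(** * Conjugacy classes of SL(2,q) *)

Section Conjugacy.
Variables (F : finFieldType) (p : nat).
Hypothesis chp : p \in [pchar F].
Implicit Types (x y w g : GL2 F).
Local Notation G := (SL F).

(** A conjugating matrix has rows r and r x, and its determinant is a quadratic
    form in r whose discriminant is that of x. Such a form represents 1, so
    conjugacy already holds in SL(2,q) and not only in GL(2,q). *)
Lemma conj_companion x : x \in G -> tr x ^+ 2 != 4 ->
  exists2 g, g \in G & (x ^ g)%g = gl2 0 1 (-1) (tr x).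
Proof.
move=> Gx t4.
have [|u [v uv]] := form_universal chp (a := eb x) (b := ed x - ea x) (c := - ec x).
  rewrite (_ : _ - _ = tr x ^+ 2 - 4) ?subr_eq0 // discE //; ring.
have dx := SL_det Gx.
(* The rows of the matrix m are (u, v) and (u, v) x. *)
have dm : u * (u * eb x + v * ed x) - v * (u * ea x + v * ec x) = 1.
  by rewrite -uv; ring.
have dc : 0 * tr x - 1 * -1 = 1 by ring.
have Gm := gl2_SL dm; set m := gl2 _ _ _ _ in Gm.
exists (m^-1)%g; first by rewrite groupV.
set C := gl2 0 1 _ _.
have mx : (m * x = C * m)%g.
  apply: entries_inj; rewrite !entE !(sl2E dc) !(sl2E dm) /tr.
  - ring.
  - ring.
  - by apply: (lincomb (k := - u) dx); ring.
  by apply: (lincomb (k := - v) dx); ring.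
by rewrite /conjg invgK mulgA mx mulgK.
Qed.

Lemma conj_same_tr x y : x \in G -> y \in G -> tr x ^+ 2 != 4 -> tr y = tr x ->
  exists2 g, g \in G & y = (x ^ g)%g.
Proof.
move=> Gx Gy tx tyx; have [g Gg xg] := conj_companion Gx tx.
have [|h Gh yh] := conj_companion Gy; first by rewrite tyx.
exists (g * h^-1)%g; first by rewrite groupM ?groupV.
by rewrite conjgM xg -tyx -yh conjgK.
Qed.

(** By [p'_tr_cycle] y has the trace of a power of w, and equal traces mean
    conjugacy. Scalar matrices, for which [conj_same_tr] fails, are compared
    directly. *)
Lemma conj_cycle w y : w \in G -> y \in G -> ~~ (p %| #[w])%N ->
  (y ^+ #[w] = 1)%g -> exists2 g, g \in G & (y \in <[w]> :^ g)%g.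
Proof.
move=> Gw Gy pw yw.
have py : ~~ (p %| #[y])%N.
  by apply: contra pw => /dvdn_trans; apply; rewrite order_dvdn yw.
have [i ti] := p'_tr_cycle chp Gw Gy pw py yw.
have Gwi : (w ^+ i)%g \in G by rewrite groupX.
have [sy | nsy] := boolP (homothety y); last first.
  have ty := p'_tr chp Gy nsy py.
  have [|g Gg ->] := conj_same_tr Gwi Gy _ ti; first by rewrite -ti.
  by exists g; rewrite // memJ_conjg mem_cycle.
have swi : homothety (w ^+ i)%g.
  apply: contraT => nsw; have := p'_tr chp Gwi nsw (p'X _ pw).
  by rewrite -ti scalar_tr ?eqxx.
exists 1%g; first exact: group1.
by rewrite conjsg1 (scalar_ext Gy Gwi sy swi ti) mem_cycle.
Qed.

(** The double eigenvalue is rational, so there is an invariant line. *)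
Lemma conj_upper x : x \in G -> tr x ^+ 2 = 4 ->
  exists2 g, g \in G & ec (x ^ g)%g = 0.
Proof.
move=> Gx /sqr_tr4[e e2 te]; have dx := SL_det Gx.
have [c0 | cn] := eqVneq (ec x) 0; first by exists 1%g; rewrite ?group1 // conjg1.
have dE : ed x = 2 * e - ea x by rewrite -te /tr; ring.
(* The lower row (c, e - a) of m is a left eigenvector of x for the eigenvalue e.
   *)
have dm : 0 * (e - ea x) - (- (ec x)^-1) * ec x = 1 by field.
have Gm := gl2_SL dm; set m := gl2 _ _ _ _ in Gm.
exists (m^-1)%g; first by rewrite groupV.
rewrite /conjg invgK !entE !(SL_V Gm) !(sl2E dm).
rewrite dE in dx *; apply: (lincomb2 (k1 := ec x) (k2 := - ec x) dx e2); ring.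
Qed.

End Conjugacy.

(** * Elements of given order *)

Section Existence.
Variables (F : finFieldType) (p : nat).
Hypothesis chp : p \in [pchar F].
Local Notation G := (SL F).

(** The polynomial X^n - 1 is separable, so it has n roots, and a group of n-th
    roots of unity with n elements is cyclic. *)
Lemma closed_prim_root (K : closedFieldType) n : (0 < n)%N -> (n%:R : K) != 0 ->
  exists z : K, n.-primitive_root z.
Proof.
move=> n0 nK; have [rs rsE] := closed_field_poly_normal ('X^n - 1 : {poly K}).
have lc : lead_coef ('X^n - 1 : {poly K}) = 1 by apply/eqP/monic_Xn_sub_1.
rewrite lc scale1r in rsE.
have urs : uniq rs by rewrite -separable_prod_XsubC -rsE separable_Xn_sub_1.
have rrs : all n.-unity_root rs.
  by apply/allP=> z zrs; rewrite /root_of_unity rsE root_prod_XsubC.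
have srs : (n <= size rs)%N.
  by rewrite -ltnS -(size_prod_XsubC rs id) -rsE size_Xn_sub_1.
by have /hasP[z _] := has_prim_root n0 rrs urs srs; exists z.
Qed.

(** For a primitive n-th root of unity l, the sum l + 1/l is fixed by Frobenius,
    hence is in F; a matrix with this trace and determinant 1 has eigenvalue l,
    and n > 2 makes the eigenvalues distinct. *)
Lemma SL_order_exists n : (2 < n)%N -> (n %| #|F|.-1)%N \/ (n %| #|F|.+1)%N ->
  exists2 x, x \in G & #[x]%g = n.
Proof.
move=> n2 nq; have [K [f _]] := countable_algebraic_closure F.
have chK : p \in [pchar K] by rewrite (fmorph_pchar f).
have n0 : (0 < n)%N by apply: ltnW; apply: ltnW.
have q1 := finNzRing_gt1 F.
have pn : ~~ (p %| n)%N.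
  have [k k0 cF] := card_char chp; have pq : (p %| #|F|)%N by rewrite cF dvdn_exp.
  have p1 := prime_gt1 (pcharf_prime chp).
  apply/negP=> pn; have : (p %| 1)%N; last by rewrite dvdn1; case: p p1 => [|[|]].
  case: nq => /(dvdn_trans pn) h.
    by rewrite -(dvdn_addr _ h) addn1 prednK // ltnW.
  by rewrite -(dvdn_addr _ pq) addn1.
have nK : (n%:R : K) != 0 by rewrite -(dvdn_pcharf chK).
have [m pm] := closed_prim_root n0 nK.
have mn := prim_expr_order pm.
have m0 : m != 0.
  by apply/eqP=> m0; move/eqP: mn; rewrite m0 expr0n -[n]prednK //= eq_sym oner_eq0.
have qn : [pchar K].-nat #|F| by apply: card_pnat => r; rewrite (fmorph_pchar f).
(* Frobenius fixes or exchanges m and 1/m. *)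
have tq : (m + m^-1) ^+ #|F| = m + m^-1.
  rewrite exprDn_pchar // exprVn.
  case: nq => /dvdnP[k kE].
    by rewrite -(prednK (ltnW q1)) exprS kE mulnC exprM mn expr1n mulr1.
  have -> : m ^+ #|F| = m^-1.
    by apply: (mulfI m0); rewrite -exprS kE mulnC exprM mn expr1n mulfV.
  by rewrite invrK addrC.
(* The fixed points of Frobenius are the elements of F. *)
have [t tE] : exists t, f t = m + m^-1.
  have : root (map_poly f ('X^#|F| - 'X)) (m + m^-1).
    by rewrite rmorphB /= map_polyXn map_polyX rootE !hornerE tq subrr.
  rewrite finField_genPoly rmorph_prod /=.
  under eq_bigr do rewrite map_polyXsubC.
  rewrite -(big_map f xpredT (fun y => 'X - y%:P)) root_prod_XsubC.
  by case/mapP=> t _ tE; exists t.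
have dc : 0 * t - 1 * -1 = 1 by ring.
have Gc := gl2_SL dc; set c := gl2 _ _ _ _ in Gc.
have ec : eigen f c m by apply/eigenP; split=> //; rewrite /tr !(sl2E dc) add0r.
have m2 : m ^+ 2 != 1 by rewrite -(prim_order_dvd pm); apply: contraL n2 => h; rewrite -leqNgt dvdn_leq.
have t4 : tr c ^+ 2 != 4 by apply: contra m2 => /eqP/(eigen_root ec) ->.
have nsc : ~~ homothety c by apply: contra t4 => /(scalar_tr Gc) ->.
have pc : ~~ (p %| #[c])%N by rewrite (p_dvd_order chp).
exists c => //; apply/eqP; rewrite eqn_dvd order_dvdn.
rewrite (eigen_exp_eq1 chp _ Gc pc ec) mn eqxx (prim_order_dvd pm).
by rewrite -(eigen_exp_eq1 chp _ Gc pc ec) expg_order eqxx.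
Qed.

End Existence.

Local Close Scope ring_scope.

(** * Groups in which centralizers of noncentral elements are abelian *)

Section CentralizerPartition.
Variables (gT : finGroupType) (H Z : {group gT}).
Hypotheses (sZH : Z \subset H) (cZH : H \subset 'C(Z)).
Hypothesis abC : {in H :\: Z, forall x, abelian 'C_H[x]}.
Implicit Types x y : gT.

(** The union of the conjugates of the centralizer of x, without Z. When
    centralizers of noncentral elements are abelian these sets partition H - Z,
    which is the class equation. *)
Definition noncentral_class x := class_support ('C_H[x] :\: Z) H.

(** Both centralizers are abelian, so each centralizes the element defining the
    other. *)
Lemma cent1_eq x y : x \in H :\: Z -> y \in 'C_H[x] :\: Z -> 'C_H[y] = 'C_H[x].
Proof.
move=> HZx /setDP[Cy nZy]; have Hy : y \in H by case/setIP: Cy.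
have HZy : y \in H :\: Z by rewrite inE nZy.
have Cx : x \in 'C_H[y].
  have /setDP[Hx _] := HZx; have /setIP[_ cyx] := Cy.
  by rewrite inE Hx cent1C.
apply/eqP; rewrite eqEsubset; apply/andP; split.
  apply/subsetP=> u Cu; have /setIP[Hu _] := Cu; rewrite inE Hu; apply/cent1P.
  exact: (centsP (abC HZy)).
apply/subsetP=> u Cu; have /setIP[Hu _] := Cu; rewrite inE Hu; apply/cent1P.
exact: (centsP (abC HZx)).
Qed.

Lemma cent1JH x g : g \in H -> 'C_H[x ^ g] = 'C_H[x] :^ g.
Proof. by move=> Hg; rewrite conjIg conjGid // cent1J. Qed.

Lemma centralJ g : g \in H -> Z :^ g = Z.
Proof.
move=> Hg; apply: normP; apply: (subsetP (cent_sub Z)); exact: (subsetP cZH).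
Qed.

Lemma memJ_noncentral x g : g \in H -> (x ^ g \in H :\: Z) = (x \in H :\: Z).
Proof.
by move=> Hg; rewrite !in_setD memJ_norm ?groupJr // (subsetP (cent_sub Z)) ?(subsetP cZH).
Qed.

Lemma noncentral_classP x y : x \in H :\: Z -> reflect
  (y \in H :\: Z /\ exists2 g, g \in H & 'C_H[y] = 'C_H[x] :^ g) (y \in noncentral_class x).
Proof.
move=> HZx; rewrite /noncentral_class class_supportEr; apply: (iffP bigcupP) => [[g Hg] | [HZy [g Hg Cy]]].
  rewrite conjDg centralJ // => /setDP[Cg nZy].
  have Hy : y \in H by move: Cg; rewrite -cent1JH // => /setIP[].
  split; first by rewrite inE nZy.
  exists g => //; rewrite -cent1JH //; apply: cent1_eq.
    by rewrite memJ_noncentral.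
  by rewrite inE nZy cent1JH.
exists g => //; rewrite conjDg centralJ // -Cy.
by case/setDP: HZy => Hy nZy; rewrite in_setD nZy in_setI Hy cent1id.
Qed.

Lemma cent_class_refl x : x \in H :\: Z -> x \in noncentral_class x.
Proof.
move=> HZx; apply/noncentral_classP => //; split=> //; exists 1; first exact: group1.
by rewrite conjsg1.
Qed.

Lemma cent_class_sub x : x \in H :\: Z -> noncentral_class x \subset H :\: Z.
Proof. by move=> HZx; apply/subsetP=> y /noncentral_classP[]. Qed.

Lemma cent_class_eq x y : x \in H :\: Z -> y \in noncentral_class x ->
  noncentral_class y = noncentral_class x.
Proof.
move=> HZx /(noncentral_classP _ HZx)[HZy [g Hg Cy]]; rewrite /noncentral_class Cy.
rewrite -{1}(centralJ Hg) -conjDg; apply/setP=> u; rewrite !class_supportEr.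
apply/bigcupP/bigcupP=> -[h Hh].
  by rewrite -conjsgM => ?; exists (g * h); rewrite // groupM.
move=> uh; exists (g^-1 * h); first by rewrite groupM ?groupV.
by rewrite -conjsgM mulKVg.
Qed.

Lemma card_cent_conj x y : x \in H :\: Z -> y \in noncentral_class x ->
  #|'C_H[y]| = #|'C_H[x]|.
Proof. by move=> HZx /(noncentral_classP _ HZx)[_ [g _ ->]]; rewrite cardJg. Qed.

Lemma cent_class_disjoint x y : x \in H :\: Z -> y \in H :\: Z ->
  y \notin noncentral_class x -> [disjoint noncentral_class x & noncentral_class y].
Proof.
move=> HZx HZy; apply: contraR => /pred0Pn[u /andP[xu yu]].
by rewrite -(cent_class_eq HZx xu) (cent_class_eq HZy yu) cent_class_refl.
Qed.

(** Two distinct centralizers of noncentral elements share only central elements,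
    by [cent1_eq]. *)
Lemma cent_normedTI x : x \in H :\: Z ->
  normedTI ('C_H[x] :\: Z) H 'N_H('C_H[x]).
Proof.
move=> HZx; apply/normedTI_P; split.
- apply/set0Pn; exists x; case/setDP: HZx => Hx nZx.
  by rewrite in_setD nZx in_setI Hx cent1id.
- apply/subsetP=> g /setIP[Hg nCg]; rewrite inE Hg; apply/normP.
  by rewrite conjDg centralJ // (normP nCg).
move=> g Hg /pred0Pn[y /andP[Cy Cgy]].
have E1 := cent1_eq HZx Cy.
have Cu : y ^ g^-1 \in 'C_H[x] :\: Z by rewrite -mem_conjg.
have E2 := cent1_eq HZx Cu.
by rewrite inE Hg; apply/normP; rewrite -{1}E2 -cent1JH // conjgKV.
Qed.

Lemma card_cent_class x : x \in H :\: Z ->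
  #|noncentral_class x| = ((#|'C_H[x]| - #|Z|) * #|H : 'N_H('C_H[x])|)%N.
Proof.
move=> HZx; rewrite (card_support_normedTI (cent_normedTI HZx)) cardsD.
suff /setIidPr-> : Z \subset 'C_H[x] by [].
have /setDP[Hx _] := HZx.
by rewrite subsetI sZH sub_cent1 (subsetP cZH).
Qed.

End CentralizerPartition.

(** * Centralizers in a subgroup of SL(2,q) *)

Section Classes.
Variables (F : finFieldType) (p : nat).
Hypothesis chp : p \in [pchar F]%R.
Local Notation G := (SL F).
Local Notation Z := ('Z(SL F))%G.
Local Notation z := #|'Z(SL F)|.
Implicit Types (x y g : GL2 F).

Lemma card_center_le2 : z <= 2.
Proof.
pose A : {set F} := [set 1; -1]%R.
have inj : {in 'Z(G) &, injective (@ea F)}.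
  move=> x y; rewrite !center_SL => /andP[_ /homothetyP[bx cx ax]] /andP[_ /homothetyP[b_y cy ay]] e.
  by apply: entries_inj; rewrite -?ax -?ay ?bx ?cx ?b_y ?cy.
rewrite -(card_in_imset inj); apply: (@leq_trans #|A|); last first.
  by rewrite cards2 ltnS leq_b1.
apply/subset_leq_card/subsetP=> _ /imsetP[x Zx ->].
move: Zx; rewrite center_SL => /andP[/SL_det dx /homothetyP[bx cx ax]].
move/eqP: dx; rewrite bx cx -ax mul0r subr0 -expr2 sqrf_eq1.
by rewrite !inE.
Qed.

Lemma card_center_odd : odd #|F| -> z = 2.
Proof.
move=> oq; apply/eqP; rewrite eqn_leq card_center_le2.
have p2 : p != 2.
  by apply/eqP=> p2; have [n n0 e] := card_char chp; move: oq; rewrite e p2 oddX orbF => /eqP n0'; rewrite n0' in n0.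
have d1 : (-1 * -1 - 0 * 0 = 1 :> F)%R by ring.
have : gl2 (-1)%R 0%R 0%R (-1)%R \in 'Z(G).
  rewrite center_SL gl2_SL //; apply/homothetyP; by rewrite !(sl2E d1).
set m := gl2 _ _ _ _ => Zm.
have m1 : m != 1.
  apply/eqP=> /(congr1 (@ea F)); rewrite !entE (sl2E d1) => h.
  have two : (2 = 0 :> F)%R by apply: (lincomb (k := (-1)%R) h); ring.
  have : (p %| 2)%N by rewrite (dvdn_pcharf chp) two.
  by rewrite dvdn_prime2 ?(pcharf_prime chp) // (negPf p2).
have : [set 1; m] \subset 'Z(G).
  by apply/subsetP=> u; rewrite in_set2 => /orP[] /eqP ->; rewrite ?group1.
by move/subset_leq_card; rewrite cards2 eq_sym m1.
Qed.

Variable H : {group GL2 F}.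
Hypotheses (sHG : H \subset G) (sZH : Z \subset H).

Lemma center_cent : H \subset 'C(Z).
Proof. by rewrite centsC (subset_trans _ (centS sHG)) // subsetIr. Qed.

Lemma in_noncentral x : (x \in H :\: Z) = (x \in H) && ~~ homothety x.
Proof.
rewrite in_setD center_SL andbC; case Hx: (x \in H) => //=.
by rewrite (subsetP sHG).
Qed.

Lemma noncentral_abelian : {in H :\: Z, forall x, abelian 'C_H[x]}.
Proof. by move=> x; rewrite in_noncentral => /andP[Hx nsx]; apply: cent1_abelian. Qed.

Local Notation cl := (noncentral_class H Z).

Definition cl_refl := cent_class_refl center_cent noncentral_abelian.
Definition cl_sub := cent_class_sub center_cent noncentral_abelian.
Definition clP := noncentral_classP center_cent noncentral_abelian.
Definition cl_eq := cent_class_eq center_cent noncentral_abelian.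
Definition cl_card := card_cent_conj center_cent noncentral_abelian.
Definition cl_disj := cent_class_disjoint center_cent noncentral_abelian.
Definition card_cl := card_cent_class sZH center_cent noncentral_abelian.

Lemma dvd_center_cent1 x : x \in H :\: Z -> z %| #|'C_H[x]|.
Proof.
move=> /setDP[Hx _]; apply: cardSg.
by rewrite subsetI sZH sub_cent1 (subsetP center_cent).
Qed.

(** The normalizer of a cyclic centralizer permutes the elements of the
    centralizer that have the trace of x, and these are x and its inverse. *)
Lemma card_norm_cent1 x : x \in H :\: Z -> ~~ (p %| #[x]) ->
  exists s, [/\ 0 < s <= 2, #|'N_H('C_H[x])| = (s * #|'C_H[x]|)%N &
    s = 2 -> exists2 h, h \in 'N_H('C_H[x]) & x ^ h = x^-1].
Proof.
move=> HZx px; have := HZx; rewrite in_noncentral => /andP[Hx nsx].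
set C := 'C_H[x]; pose N := 'N_H(C).
have sCN : C \subset N by rewrite subsetI subsetIl normG.
have CNx : 'C_N[x] = C.
  apply/eqP; rewrite eqEsubset; apply/andP; split; first by rewrite setSI // subsetIl.
  by rewrite subsetI sCN subsetIr.
have Cx : x \in C by rewrite in_setI Hx cent1id.
have orb h : h \in N -> x ^ h = x \/ x ^ h = x^-1.
  case/setIP=> Hh nCh; apply: (cent1_same_tr chp sHG Hx nsx px _ Cx); last exact: trJ.
  by rewrite memJ_norm.
have cN : #|N| = (#|x ^: N| * #|C|)%N by rewrite -index_cent1 CNx mulnC Lagrange.
exists #|x ^: N|; split=> //.
  apply/andP; split; first by rewrite (cardD1 x) class_refl.
  apply: (@leq_trans #|[set x; x^-1]|); last by rewrite cards2 ltnS leq_b1.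
  by apply/subset_leq_card/subsetP=> _ /imsetP[h Nh ->]; rewrite !inE; case: (orb _ Nh) => ->; rewrite eqxx ?orbT.
move=> c2; have [| h] := boolP [exists h in N, x ^ h == x^-1].
  by case/existsP=> h /andP[Nh /eqP xh]; exists h.
have : x ^: N \subset [set x].
  apply/subsetP=> _ /imsetP[g Ng ->]; rewrite inE; case: (orb _ Ng) => [-> // | xg].
  by case/negP: h; apply/existsP; exists g; rewrite Ng xg eqxx.
by move/subset_leq_card; rewrite c2 cards1.
Qed.

(** The contribution of x to the class equation in terms of H/Z: a is the order of
    the torus, s is the index in its normalizer and k is the number of conjugates
    of the torus. *)
Lemma semisimple_class x : x \in H :\: Z -> ~~ (p %| #[x]) ->
  exists a s k, [/\ #|'C_H[x]| = (z * a)%N, 1 < a, (0 < s <= 2) &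
   [/\ #|'N_H('C_H[x])| = (s * (z * a))%N, #|H| = (z * (s * a * k))%N,
      #|cl x| = (z * (a.-1 * k))%N &
      s = 2 -> exists2 h, h \in 'N_H('C_H[x]) & x ^ h = x^-1]].
Proof.
move=> HZx px; have /dvdnP[a Ca] := dvd_center_cent1 HZx.
have [s [s12 Ns inv]] := card_norm_cent1 HZx px.
pose k := #|H : 'N_H('C_H[x])|.
have z0 : 0 < z := cardG_gt0 _.
exists a, s, k; split=> //; first by rewrite Ca mulnC.
  have [Hx nZx] := setDP HZx.
  have : Z \proper 'C_H[x].
    rewrite properE subsetI sZH sub_cent1 (subsetP center_cent) //=.
    by apply/subsetPn; exists x; rewrite // in_setI Hx cent1id.
  by move/proper_card; rewrite Ca; case: a {Ca} => [|[|]] //; rewrite ?mul0n ?mul1n ?ltnn // ltn0.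
split=> //; first by rewrite Ns Ca; congr (_ * _)%N; rewrite mulnC.
  by rewrite -(Lagrange (subsetIl H 'N('C_H[x]))) Ns Ca -/k; nia.
rewrite card_cl // Ca -/k; case: a {Ca Ns} => [|a]; rewrite ?mul0n ?muln0 //=.
by rewrite mulSn addKn; nia.
Qed.

Lemma cl_sum2 x y : x \in H :\: Z -> y \in H :\: Z -> y \notin cl x ->
  #|cl x :|: cl y| = (#|cl x| + #|cl y|)%N.
Proof.
move=> HZx HZy nyx; have d := cl_disj HZx HZy nyx.
by rewrite cardsU (disjoint_setI0 d) cards0 subn0.
Qed.

Lemma noncentral_card : #|H :\: Z| = (#|H| - z)%N.
Proof. by rewrite cardsD (setIidPr sZH). Qed.

End Classes.

Local Close Scope group_scope.

(** * The arithmetic of the class equation *)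

(** Divided by g the equation reads 1/a1 + 1/a2 + 1/a3 = 1 + 2/g, as for a finite
    group of rotations of the sphere. Its solutions are the dihedral ones (a, 2,
    2) and (2, 3, 3), (2, 3, 4), (2, 3, 5) up to order; the arithmetic hypotheses
    exclude all of them. *)
Lemma three_split_classes (g a1 a2 a3 k1 k2 k3 : nat) :
  0 < g -> g = 2 * a1 * k1 -> g = 2 * a2 * k2 -> g = 2 * a3 * k3 ->
  g + 2 = 2 * (k1 + k2 + k3) ->
  2 < a1 -> a1 != 4 -> a1 != 5 -> 1 < a2 -> a2 != 5 -> 1 < a3 ->
  (a1 = 3 -> odd a2) -> (a1 = 3 -> a2 != 3) -> ~~ (a2 %| a1) -> False.
Proof.
move=> g0 g1 g2 g3 E A1 n4 n5 A2 m5 A3 odd2 n33 nd.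
have lb c a k : g = 2 * a * k -> c <= a -> 2 * c * k <= g.
  by move=> -> ca; rewrite leq_mul // leq_mul.
have ub c a k : g = 2 * a * k -> g < 2 * c * k -> a < c.
  by move=> e; rewrite ltnNge; apply: contraR; rewrite -leqNgt => /(lb _ _ _ e).
have h6 : a1 <> 3 -> 12 * k1 <= g by move=> ?; apply: (lb 6 _ _ g1); lia.
have B1 := lb 3 _ _ g1 A1; have B2 := lb 2 _ _ g2 A2; have B3 := lb 2 _ _ g3 A3.
case: (ltnP 2 a2) => a2g.
  have B2' := lb 3 _ _ g2 a2g.
  case: (ltnP 2 a3) => a3g; first by have := lb 3 _ _ g3 a3g; lia.
  have a32 : a3 = 2 by lia.
  rewrite a32 in g3.
  have [e3 | ne3] := eqVneq a1 3.
    rewrite e3 in g1; have o2 := odd2 e3; have n3 := n33 e3.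
    have : a2 < 6 by apply: (ub _ _ _ g2); lia.
    by case: a2 o2 n3 m5 a2g {A2 odd2 n33 nd g2 B2 B2'} => [|[|[|[|[|[|?]]]]]].
  have := h6 (elimN eqP ne3) => h.
  have : a2 < 3 by apply: (ub _ _ _ g2); lia.
  lia.
have a22 : a2 = 2 by lia.
have ne3 : a1 <> 3 by move/odd2; rewrite a22.
rewrite a22 in g2; have h := h6 ne3.
have : a3 < 3 by apply: (ub _ _ _ g3); lia.
move=> a3l; have a32 : a3 = 2 by lia.
rewrite a32 in g3.
have k11 : k1 = 1 by lia.
have : a1 = 2 * k2 by rewrite k11 in g1; lia.
by move=> e; case/negP: nd; rewrite a22 e dvdn_mulr.
Qed.

(** A group of order g = P t n with P t the order of the normalizer of a Sylow
    p-subgroup of order P, a torus of order t in this normalizer and another torus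
    of order a, both inverted by their normalizers, and no further classes. In the
    end n = P m' + 1, and (P - 2) m' + 1 divides 2 t < 2 P. Here m' = 1 is
    PSL(2,P) or PGL(2,P) and P = 3, m' = 3 is A5. *)
Lemma parabolic_split_classes (P t n a g k k' : nat) :
  1 < t -> t < P -> 1 < n -> 0 < a -> coprime a P ->
  odd P \/ (4 %| P) && odd t ->
  g = P * t * n -> g = 2 * t * k -> g = 2 * a * k' ->
  P.-1 * n + t.-1 * k + a.-1 * k' + 1 = g ->
  a = 5 \/ P.+1 %| 2 * a.
Proof.
move=> t1 tP n1 a0 cop par gE gk gk' E.
have P0 : 0 < P by lia.
have t0 : 0 < t by lia.
have kE : 2 * k = P * n.
  by apply/eqP; rewrite -(eqn_pmul2l t0); apply/eqP; move: gk; rewrite gE; clear; lia.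
have k'E : 2 * k' + 2 * n = P * n + 2.
  have e1 : P.-1 * n + n = P * n by rewrite -{2}(prednK P0) mulSn addnC.
  have e2 : t.-1 * k + k = t * k by rewrite -{2}(prednK t0) mulSn addnC.
  have e3 : a.-1 * k' + k' = a * k' by rewrite -{2}(prednK a0) mulSn addnC.
  rewrite -mulnA in gk; rewrite -mulnA in gk'; lia.
have Pk'0 : P %| a * (2 * k') by apply/dvdnP; exists (t * n); rewrite mulnCA mulnA -gk' gE; lia.
have Pk' : P %| 2 * k' by move: Pk'0; rewrite Gauss_dvdr // coprime_sym.
have : P %| 2 * (n - 1).
  have e : 2 * k' + 2 * (n - 1) = P * n by clear -k'E n1; lia.
  by rewrite -(dvdn_addr _ Pk') e dvdn_mulr.
case/dvdnP=> m mE.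
have m0 : 0 < m by clear -mE n1 P0; case: m mE => // mE; lia.
have k'D : 2 * k' = P * (n - m) by rewrite mulnBr; clear -k'E mE n1; lia.
have aD : a * (n - m) = t * n.
  apply/eqP; rewrite -(eqn_pmul2l P0); apply/eqP.
  by rewrite mulnCA -k'D (mulnCA P) mulnA; move: gk'; rewrite gE; clear; lia.
have mn : m < n.
  rewrite -subn_gt0; case: (n - m) aD => //; rewrite muln0 => /esym/eqP; rewrite muln_eq0; lia.
(* The parity hypothesis is used here: an odd m forces P to be even, so 4 | P and
   n is odd, and then odd t contradicts aD. *)
have em : ~~ odd m.
  apply/negP=> om; case: par => [oP | /andP[/dvdnP[P' PE] ot]].
    by have := oddM 2 (n - 1); rewrite mE oddM om oP.
  have on : odd n.
    have -> : n = (m * P').*2.+1 by rewrite PE in mE; clear -mE n1; lia.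
    by rewrite /= odd_double.
  have : odd (t * n) by rewrite oddM ot.
  by rewrite -aD oddM oddB ?on ?om ?andbF // ltnW.
have [m' m'E] : exists m', m = 2 * m'.
  by exists m./2; rewrite mul2n -[LHS]odd_double_half (negPf em).
have nE : n = P * m' + 1 by rewrite m'E in mE; clear -mE n1; lia.
have DE : n - m = (P - 2) * m' + 1.
  have h : 2 * m' <= P * m' by rewrite leq_mul2r orbC (leq_trans t1) // ltnW.
  by rewrite mulnBl nE m'E; clear -h; lia.
(* n - m is prime to m' and divides t n, hence t m. *)
have D2t : n - m %| 2 * t.
  have d1 : n - m %| t * n by rewrite -aD dvdn_mull.
  have d3 : n - m %| t * m.
    have -> : t * m = t * n - t * (n - m) by rewrite -mulnBr subKn // ltnW.
    by rewrite dvdn_sub // dvdn_mull.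
  have cD : coprime (n - m) m'.
    by rewrite DE coprime_sym /coprime gcdnMDl gcdn1.
  rewrite -(Gauss_dvdr _ cD); have -> // : m' * (2 * t) = t * m.
  by rewrite m'E; clear; lia.
have /dvdnP[c cE] := D2t.
have m'0 : 0 < m' by clear -m0 m'E; lia.
clear - t1 tP P0 t0 a0 aD cE nE DE m'0 D2t mn.
have Dle : (P - 2) * m' + 1 <= 2 * t by rewrite -DE dvdn_leq // muln_gt0.
(* The divisor (P - 2) m' + 1 of 2 t is at most 2 P - 2, so m' is 1 or 2, or else
   P = 3. *)
case: (ltnP m' 2) => m'2.
  have m1 : m' = 1 by lia.
  rewrite m1 in nE DE; right.
  have DP : n - m = P - 1 by lia.
  have c2 : c <= 2.
    rewrite leqNgt; apply/negP=> c3.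
    have : 3 * (n - m) <= c * (n - m) by rewrite leq_mul2r c3 orbT.
    lia.
  have E2 : 2 * a = c * n.
    apply/eqP; rewrite -(@eqn_pmul2r (n - m)); last by lia.
    by rewrite -mulnA aD mulnA cE; apply/eqP; lia.
  by rewrite E2 nE muln1 addn1 dvdn_mull.
have hP : (P - 2) * m' <= 2 * P - 3 by lia.
case: (ltnP m' 3) => m'3.
  have m2 : m' = 2 by lia.
  rewrite m2 in nE DE.
  have : n - m %| t.
    rewrite -(@Gauss_dvdr _ 2) //; rewrite coprimen2.
    have -> : n - m = (P - 2).*2.+1 by lia.
    by rewrite /= odd_double.
  by move/(dvdn_leq t0); lia.
have : (P - 2) * 3 <= (P - 2) * m' by rewrite leq_mul2l m'3 orbT.
move=> h3; have P3 : P = 3 by lia.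
have t2 : t = 2 by lia.
rewrite P3 t2 /= in nE DE aD hP cE.
have : m' = 3.
  have h4 : m' <= 3 by lia.
  lia.
by move=> m33; left; rewrite m33 in nE DE; lia.
Qed.

Local Open Scope group_scope.

(** * Subgroups containing a unipotent element *)

Section Parabolic.
Variables (F : finFieldType) (p : nat).
Hypothesis chp : p \in [pchar F]%R.
Local Notation G := (SL F).
Local Notation Z := ('Z(SL F))%G.
Local Notation z := #|'Z(SL F)|.
Implicit Types (x y g : GL2 F).
Variable H : {group GL2 F}.
Hypotheses (sHG : H \subset G) (sZH : Z \subset H).
Local Notation cl := (noncentral_class H Z).
Let inHZ := in_noncentral sHG.
Let p_pr := pcharf_prime chp.

Lemma upper_mul x y : ec x = 0%R -> ec y = 0%R ->
  [/\ ec (x * y) = 0%R, ea (x * y) = (ea x * ea y)%R & ed (x * y) = (ed x * ed y)%R].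
Proof. by move=> cx cy; rewrite !entE cx cy !(mulr0, mul0r, addr0, add0r). Qed.

Lemma upper_conj x y : x \in G -> y \in G -> ec x = 0%R -> ec y = 0%R ->
  [/\ ec (x ^ y) = 0%R, ea (x ^ y) = ea x & ed (x ^ y) = ed x].
Proof.
move=> Gx Gy cx cy; have dy := SL_det Gy.
rewrite cy mulr0 subr0 in dy.
rewrite /conjg !entE !(SL_V Gy) cx cy; split; first by ring.
  by apply: (lincomb (k := ea x) dy); ring.
by apply: (lincomb (k := ed x) dy); ring.
Qed.

Variable u0 : GL2 F.
Hypotheses (Hu0 : u0 \in H) (nsu0 : ~~ homothety u0) (cu0 : ec u0 = 0%R).
Hypothesis tu0 : (tr u0 ^+ 2 = 4)%R.

Let A := 'C_H[u0].
Let N := 'N_H(A).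

Let HG x : x \in H -> x \in G. Proof. exact: subsetP. Qed.

Lemma upper_unip_diag : ea u0 = ed u0.
Proof.
have := discE (HG Hu0); rewrite tu0 cu0 subrr mulr0 addr0 => /esym/eqP.
by rewrite sqrf_eq0 subr_eq0 => /eqP.
Qed.

Lemma upper_unip_b : eb u0 != 0%R.
Proof. by apply: contra nsu0 => /eqP b0; apply/homothetyP; rewrite b0 cu0 upper_unip_diag. Qed.

Lemma mem_unip_cent x : x \in H -> (x \in A) = (ec x == 0%R) && (ea x == ed x).
Proof.
move=> Hx; rewrite in_setI Hx; apply/cent1P/andP.
  move/(parallel_commute nsu0)=> [k [_ ->]].
  by rewrite cu0 upper_unip_diag subrr !mulr0 => /eqP; rewrite subr_eq0.
move=> [/eqP cx /eqP ax]; apply/commuteE.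
by rewrite cx cu0 ax upper_unip_diag; split; ring.
Qed.

(** Together with [mem_unip_cent]: the centralizer A of u0 and its normalizer N
    are the parts of H in the groups of upper triangular matrices with equal, and
    with arbitrary, diagonal entries. *)
Lemma mem_unip_norm x : x \in H -> (x \in N) = (ec x == 0%R).
Proof.
move=> Hx; have Gx := HG Hx; have HZu0 : u0 \in H :\: Z by rewrite inHZ Hu0.
rewrite in_setI Hx; apply/idP/eqP=> [nx | cx].
  have : u0 ^ x \in A by rewrite memJ_norm // in_setI Hu0 cent1id.
  rewrite mem_unip_cent ?groupJ // /conjg !entE !(SL_V Gx) cu0 -upper_unip_diag => /andP[/eqP h _].
  have : (eb u0 * ec x ^+ 2 == 0)%R by apply/eqP; apply: (lincomb (k := (-1)%R) h); ring.
  by rewrite mulf_eq0 (negPf upper_unip_b) /= sqrf_eq0 => /eqP.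
have [c a d] := upper_conj (HG Hu0) Gx cu0 cx.
have Ax : u0 ^ x \in A by rewrite mem_unip_cent ?groupJ // c a d upper_unip_diag !eqxx.
have HZx : u0 ^ x \in H :\: Z by rewrite (memJ_noncentral (center_cent sHG)).
have /setDP[_ nZx] := HZx.
apply/normP; rewrite /A -cent1JH //.
by apply: (cent1_eq (noncentral_abelian sHG) HZu0); rewrite in_setD nZx.
Qed.

Definition upper_unip : {set GL2 F} := [set x in H | (ec x == 0%R) && (ea x == 1%R)].
Local Notation U := upper_unip.

Lemma upper_unip_group_set : group_set U.
Proof.
apply/group_setP; split=> [|x y]; first by rewrite inE group1 !entE !eqxx.
rewrite !inE => /and3P[Hx /eqP cx /eqP ax] /and3P[Hy /eqP cy /eqP ay].
by have [-> -> _] := upper_mul cx cy; rewrite groupM // ax ay mulr1 !eqxx.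
Qed.
Canonical upper_unip_group := Group upper_unip_group_set.

Lemma mem_upper_unip x : x \in U -> [/\ x \in H, ec x = 0%R, ea x = 1%R & ed x = 1%R].
Proof.
rewrite inE => /and3P[Hx /eqP cx /eqP ax]; split=> //.
by have := SL_det (HG Hx); rewrite cx ax mulr0 subr0 mul1r.
Qed.

Lemma upper_unip_sub_cent : U \subset A.
Proof. by apply/subsetP=> x /mem_upper_unip[Hx cx ax dx]; rewrite mem_unip_cent // cx ax dx !eqxx. Qed.

Lemma upper_unip_expp x : x \in U -> x ^+ p = 1.
Proof.
move=> /mem_upper_unip[Hx cx ax dx]; have [||h1 h2 h3 h4] := parabolic_exp (e := 1%R) p (HG Hx).
- by ring.
- by rewrite /tr ax dx; ring.
by apply: entries_inj; rewrite !entE ?h1 ?h2 ?h3 ?h4 (pcharf0 chp); rewrite expr1n; ring.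
Qed.

Lemma upper_unip_pgroup : p.-group U.
Proof.
apply/pgroupP=> r r_pr /Cauchy[]// x Ux ox.
by rewrite inE -dvdn_prime2 // -ox order_dvdn upper_unip_expp.
Qed.

Lemma card_unip_cent : #|A| = (z * #|U|)%N.
Proof.
have ZUA : 'Z(SL F) * U = A.
  apply/eqP; rewrite eqEsubset mul_subG ?upper_unip_sub_cent //=; last first.
    by rewrite subsetI sZH sub_cent1 (subsetP (center_cent sHG)).
  apply/subsetP=> x Ax; have Hx : x \in H by case/setIP: Ax.
  move: Ax; rewrite mem_unip_cent // => /andP[/eqP cx /eqP ax].
  have a2 : (ea x * ea x = 1)%R by rewrite -[RHS](SL_det (HG Hx)) cx -ax; ring.
  have d1 : (ea x * ea x - 0 * 0 = 1)%R by rewrite a2; ring.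
  pose m := gl2 (ea x) 0%R 0%R (ea x).
  have Zm : m \in 'Z(SL F).
    by rewrite center_SL gl2_SL //; apply/homothetyP; rewrite !(sl2E d1).
  have Hm : m \in H by apply: (subsetP sZH).
  apply/mulsgP; exists m (m^-1 * x) => //; last by rewrite mulKVg.
  rewrite inE groupM ?groupV // !entE !(SL_V (HG Hm)) !(sl2E d1) cx a2.
  by apply/and3P; split=> //; apply/eqP; ring.
rewrite -ZUA TI_cardMg //; apply/trivgP/subsetP=> x /setIP[].
rewrite center_SL => /andP[Gx /homothetyP[bx cx dx]] /mem_upper_unip[_ _ ax d1].
by apply/set1gP; apply: entries_inj; rewrite !entE.
Qed.

Lemma upper_unip_noncentral x : x \in U -> x != 1 -> x \in H :\: Z.
Proof.
move=> Ux x1; have [Hx cx ax dx] := mem_upper_unip Ux.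
rewrite inHZ Hx; apply: contra x1 => sx; apply/eqP.
by apply: (scalar_tr2 (HG Hx) sx); rewrite /tr ax dx; ring.
Qed.

Lemma upper_unip_ntriv : exists2 u1, u1 \in U & u1 != 1.
Proof.
apply/exists_inP; apply: contraNT nsu0; rewrite negb_exists_in => /forall_inP h.
have U1 : #|U| = 1%N.
  apply/eqP; rewrite -trivg_card1; apply/eqP/trivgP/subsetP=> x Ux.
  by apply/set1gP/eqP; have := h x Ux; rewrite negbK.
have : u0 \in 'Z(SL F).
  have -> : 'Z(SL F) = A; last by rewrite in_setI Hu0 cent1id.
  apply/eqP; rewrite eqEcard card_unip_cent U1 muln1 leqnn andbT.
  by rewrite subsetI sZH sub_cent1 (subsetP (center_cent sHG)).
by rewrite center_SL => /andP[].
Qed.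

Lemma p_elt_unip_cent x : x \in A -> p.-elt x -> x \in U.
Proof.
move=> Ax px; have Hx : x \in H by case/setIP: Ax.
move: Ax; rewrite mem_unip_cent // inE Hx => /andP[/eqP cx /eqP ax].
rewrite cx eqxx /=; have := p_elt_tr2 chp (HG Hx) px; rewrite /tr -ax => h2.
have a2 := SL_det (HG Hx); rewrite cx -ax in a2.
rewrite -subr_eq0 -sqrf_eq0; apply/eqP.
by apply: (lincomb2 (k1 := 1%R) (k2 := (-1)%R) a2 h2); ring.
Qed.

(** A central element v of a Sylow subgroup above U commutes with the elements of
    U, so that by transitivity the whole Sylow subgroup commutes with u0. *)
Lemma upper_unip_Sylow : p.-Sylow(H) U.
Proof.
have sUH : U \subset H by apply/subsetP=> x /mem_upper_unip[].
have [S sylS sUS] := Sylow_superset sUH upper_unip_pgroup.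
suff SU : S :=: U by rewrite -SU.
have [u1 Uu1 u1n] := upper_unip_ntriv.
have pS := pHall_pgroup sylS; have sSH := pHall_sub sylS.
have [v Zv v1] : exists2 v, v \in 'Z(S) & v != 1.
  apply/trivgPn; apply: contraNneq u1n => /(trivg_center_pgroup pS) S1.
  by have := subsetP sUS _ Uu1; rewrite S1 => /set1gP ->.
have /centerP[Sv cv] := Zv; have Hv := subsetP sSH _ Sv.
have nsv : ~~ homothety v.
  apply/negP=> sv; have /negP[] := scalar_p' chp (HG Hv) sv.
  have := mem_p_elt pS Sv; rewrite /p_elt => /p_natP[[|k] ok]; last by rewrite ok dvdn_exp.
  by case/eqP: v1; apply/eqP; rewrite -order_eq1 ok.
have nsu1 : ~~ homothety u1 by have := upper_unip_noncentral Uu1 u1n; rewrite inHZ => /andP[].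
have cu : commute u1 u0 by apply/cent1P; have /setIP[] := subsetP upper_unip_sub_cent _ Uu1.
have vu0 : commute v u0 by apply: (commute_trans nsu1) => //; apply: cv; apply: (subsetP sUS).
apply/eqP; rewrite eqEsubset sUS andbT; apply/subsetP=> s Ss.
apply: p_elt_unip_cent; last exact: mem_p_elt pS Ss.
rewrite in_setI (subsetP sSH) //; apply/cent1P.
by apply: (commute_trans nsv) => //; apply/commute_sym/cv.
Qed.

(** The p-part of x has a conjugate in U, by Sylow, and the same centralizer as x.
    *)
Lemma p_singular_class x : x \in H :\: Z -> p %| #[x] -> x \in cl u0.
Proof.
move=> HZx px; have HZu0 : u0 \in H :\: Z by rewrite inHZ Hu0.
have [Hx nZx] := setDP HZx.
have xp1 : x.`_p != 1.
  by apply/eqP=> /constt1P; rewrite /p_elt p'natE // px.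
have pxp : p.-group <[x.`_p]> by exact: p_elt_constt.
have [|h Hh] := Sylow_Jsub upper_unip_Sylow _ pxp; first by rewrite cycle_subG groupX.
rewrite -cycleJ cycle_subG => Uy.
have y1 : x.`_p ^ h != 1 by rewrite conjg_eq1.
have HZy := upper_unip_noncentral Uy y1.
have HZxp : x.`_p \in H :\: Z by move: HZy; rewrite (memJ_noncentral (center_cent sHG)).
have e1 : 'C_H[x.`_p ^ h] = A.
  apply: (cent1_eq (noncentral_abelian sHG)) => //.
  by rewrite in_setD (subsetP upper_unip_sub_cent) // andbT; have /setDP[] := HZy.
have e2 : 'C_H[x] = 'C_H[x.`_p].
  apply: (cent1_eq (noncentral_abelian sHG)) => //.
  by rewrite in_setD nZx in_setI Hx; apply/cent1P; apply: commuteX.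
apply/(clP sHG) => //; split=> //; exists h^-1; first by rewrite groupV.
by rewrite e2 -/A -e1 cent1JH // conjsgK.
Qed.

Section Torus.
Variable y : GL2 F.
Hypotheses (Ny : y \in N) (nAy : y \notin A).

Let Hy : y \in H. Proof. by case/setIP: Ny. Qed.
Let cy : ec y = 0%R. Proof. by apply/eqP; rewrite -mem_unip_norm. Qed.
Let dy : ea y != ed y. Proof. by apply: contra nAy => e; rewrite mem_unip_cent // cy eqxx. Qed.

Lemma torus_tr : (tr y ^+ 2 != 4)%R.
Proof.
rewrite -subr_eq0 (discE (HG Hy)) cy mulr0 addr0 sqrf_eq0 subr_eq0.
exact: dy.
Qed.

Lemma torus_noncentral : y \in H :\: Z.
Proof.
by rewrite inHZ Hy; apply: contra torus_tr => /(scalar_tr (HG Hy)) ->.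
Qed.

Let nsy : ~~ homothety y.
Proof. by have := torus_noncentral; rewrite inHZ => /andP[]. Qed.

Lemma torus_p' : ~~ (p %| #[y]).
Proof. by rewrite (p_dvd_order chp) ?torus_tr ?HG. Qed.

Lemma torus_upper x : x \in 'C_H[y] -> ec x = 0%R.
Proof.
case/setIP=> Hx /cent1P cxy; have [k [_ -> _]] := parallel_commute nsy cxy.
by rewrite cy mulr0.
Qed.

Lemma torus_sub_N : 'C_H[y] \subset N.
Proof.
apply/subsetP=> x Cx; have Hx : x \in H by case/setIP: Cx.
by rewrite mem_unip_norm // torus_upper.
Qed.

Lemma torus_unip x w : x \in U -> x != 1 -> w \in 'C_H[y] -> commute x w -> homothety w.
Proof.
move=> Ux x1 /setIP[Hw /cent1P cwy] cxw; apply: contraNT torus_tr => nsw.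
have [Hx cx ax dx] := mem_upper_unip Ux.
have nsx : ~~ homothety x by have := upper_unip_noncentral Ux x1; rewrite inHZ => /andP[].
apply/eqP; apply: (disc_commute (HG Hy) (HG Hx) nsx).
  by apply: (commute_trans nsw); apply: commute_sym.
by rewrite /tr ax dx; ring.
Qed.

Lemma class_torus_sub : #|y ^: N| <= #|U|.
Proof.
have sub : y ^: N \subset y *: U.
  apply/subsetP=> _ /imsetP[n Nn ->]; have Hn : n \in H by case/setIP: Nn.
  have cn : ec n = 0%R by apply/eqP; rewrite -mem_unip_norm.
  have [c a d] := upper_conj (HG Hy) (HG Hn) cy cn.
  have V := SL_V (HG Hy); have D := SL_det (HG Hy).
  rewrite cy mulr0 subr0 in D.
  have Hv : y ^ n \in H by rewrite groupJ.
  move: (y ^ n) c a Hv => v c a Hv; rewrite mem_lcoset inE groupM ?groupV //.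
  rewrite !entE !V c a cy; apply/and3P; split=> //; apply/eqP; first by ring.
  by rewrite mulr0 addr0 mulrC.
by rewrite -(card_lcoset U y) subset_leq_card.
Qed.

(** N is the product of U with the torus C_H[y], because the conjugates of y under
    N differ from y by factors in U. *)
Lemma card_N_torus : (#|N| * z = #|A| * #|'C_H[y]|)%N.
Proof.
set C := 'C_H[y].
have sCN : C \subset N := torus_sub_N.
have CN : 'C_N[y] = C.
  apply/eqP; rewrite eqEsubset; apply/andP; split; first by rewrite setSI // subsetIl.
  by rewrite subsetI sCN subsetIr.
have cN : #|N| = (#|y ^: N| * #|C|)%N by rewrite -index_cent1 CN mulnC Lagrange.
have le1 : #|N| <= #|U| * #|C| by rewrite cN leq_mul2r class_torus_sub orbT.
have sUN : U \subset N.
  by apply: subset_trans upper_unip_sub_cent _; rewrite subsetI subsetIl normG.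
have le2 : #|U| * #|C| <= #|N|.
  rewrite -TI_cardMg; first by apply: subset_leq_card; rewrite mul_subG.
  apply/trivgP/subsetP=> x /setIP[Ux Cx]; apply/set1gP/eqP; apply: contraT => x1.
  have sx := torus_unip Ux x1 Cx (commute_refl x).
  by have := upper_unip_noncentral Ux x1; rewrite inHZ sx andbF.
have -> : #|N| = (#|U| * #|C|)%N by apply/eqP; rewrite eqn_leq le1.
by rewrite card_unip_cent mulnC mulnA.
Qed.

(** Modulo the centre the torus acts freely on the elements of U other than 1. *)
Lemma card_torus_lt : #|'C_H[y]| < z * #|U|.
Proof.
have [u1 Uu1 u1n] := upper_unip_ntriv; set C := 'C_H[y].
have CZ : 'C_C[u1] \subset 'Z(SL F).
  apply/subsetP=> x /setIP[Cx /cent1P cx].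
  have Hx : x \in H by case/setIP: Cx.
  by rewrite center_SL HG //= (torus_unip Uu1 u1n Cx) //; apply: commute_sym.
have sub : u1 ^: C \subset U :\ 1.
  apply/subsetP=> _ /imsetP[n Cn ->]; have Hn : n \in H by case/setIP: Cn.
  have [Hu1 cu1 au1 du1] := mem_upper_unip Uu1.
  have [c a d] := upper_conj (HG Hu1) (HG Hn) cu1 (torus_upper Cn).
  by rewrite in_setD1 conjg_eq1 u1n inE groupJ // c a au1 !eqxx.
have cC : #|C| = (#|u1 ^: C| * #|'C_C[u1]|)%N by rewrite -index_cent1 mulnC Lagrange ?subsetIl.
have := subset_leq_card sub; have := subset_leq_card CZ.
have := cardsD1 1 U; rewrite group1 => -> h1 h2; rewrite cC mulnC.
by apply: (@leq_ltn_trans (z * #|U :\ 1|)); rewrite ?leq_mul // ltn_pmul2l ?cardG_gt0.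
Qed.

Lemma torus_split : #|'C_H[y]| %| #|F|.-1.
Proof.
have HZy := torus_noncentral.
have /cyclicP[w Cw] := cent1_cyclic chp sHG Hy nsy torus_p'.
have Cyw : w \in 'C_H[y] by rewrite Cw cycle_id.
have Hw : w \in H by case/setIP: Cyw.
have pw := cent1_p' chp sHG Hy nsy torus_p' Cyw.
have [K [f _]] := countable_algebraic_closure F.
have D := SL_det (HG Hw); rewrite (torus_upper Cyw) mulr0 subr0 in D.
have aw0 : (ea w != 0)%R by apply/eqP=> a0; move/eqP: D; rewrite a0 mul0r eq_sym oner_eq0.
have dw : ed w = (ea w)^-1%R by apply: (mulfI aw0); rewrite D mulfV.
have ew : eigen f w (f (ea w)).
  by apply/eigenP; rewrite fmorph_eq0 aw0 /tr rmorphD dw fmorphV.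
rewrite Cw -/(order w) order_dvdn (eigen_exp_eq1 chp _ (HG Hw) pw ew) -rmorphXn.
have -> : (ea w ^+ #|F|.-1 = 1)%R; last by rewrite rmorph1.
apply: (mulfI aw0); rewrite -exprS prednK ?expf_card ?mulr1 //.
exact: ltnW (finNzRing_gt1 F).
Qed.

(** Conjugation in the group of upper triangular matrices preserves the diagonal,
    and inversion exchanges its two different entries. *)
Lemma torus_not_inverted h : h \in N -> y ^ h != y^-1.
Proof.
move=> Nh; have Hh : h \in H by case/setIP: Nh.
have ch : ec h = 0%R by apply/eqP; rewrite -mem_unip_norm.
apply: contra dy => /eqP e; have [_ a _] := upper_conj (HG Hy) (HG Hh) cy ch.
by rewrite -a e !(SL_V (HG Hy)).
Qed.

End Torus.

(** The contribution of the elements of order divisible by p to the class equation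
    of H/Z: they form a single class, a Sylow p-subgroup has order p^e, its
    normalizer is an extension of it by a cyclic group of order t, and n is the
    number of Sylow p-subgroups. If t > 1 the cyclic group comes from a split
    torus C_H[y], and for n = 1 nothing in H inverts y, since the Sylow p-subgroup
    is then normal. *)
Lemma upper_parabolic_class : exists e t n u,
  [/\ 0 < e, 0 < t < p ^ e, u \in H :\: Z,
      #|H| = (z * (p ^ e * t * n))%N & #|cl u| = (z * ((p ^ e).-1 * n))%N] /\
  (forall x, x \in H :\: Z -> p %| #[x] -> x \in cl u) /\
  (1 < t -> exists y, [/\ y \in H :\: Z, ~~ (p %| #[y]), #|'C_H[y]| = (z * t)%N,
      (z * t)%N %| #|F|.-1 & n = 1%N -> forall h, h \in H -> y ^ h != y^-1]).
Proof.
have HZu0 : u0 \in H :\: Z by rewrite inHZ Hu0.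
have [e eE] := p_natP upper_unip_pgroup; have z0 : 0 < z := cardG_gt0 _.
have e0 : 0 < e.
  have [u1 Uu1 u1n] := upper_unip_ntriv.
  case: e eE => // U1; case/eqP: u1n.
  have /trivgP/subsetP : U :=: 1 by apply/eqP; rewrite trivg_card1 U1.
  by move/(_ _ Uu1)/set1gP.
have sAN : A \subset N by rewrite subsetI subsetIl normG.
pose n := #|H : N|.
have HE : #|H| = (#|N| * n)%N by rewrite Lagrange // subsetIl.
have clE : #|cl u0| = (z * ((p ^ e).-1 * n))%N.
  rewrite (card_cl sHG sZH HZu0) -/A -/N -/n card_unip_cent eE.
  have : 0 < p ^ e by rewrite expn_gt0 prime_gt0.
  by case: (p ^ e)%N => // P _; rewrite mulnS addKn /= mulnA.
have [NA | /subsetPn[y Ny nAy]] := boolP (N \subset A).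
  have AN : #|N| = (z * p ^ e)%N.
    by rewrite -eE -card_unip_cent; apply/eqP; rewrite eqn_leq !subset_leq_card.
  exists e, 1%N, n, u0; split; last by split=> // x; apply: p_singular_class.
  split=> //; last by rewrite HE AN muln1 !mulnA.
  by rewrite /= -{1}(exp1n e) ltn_exp2r // prime_gt1.
have HZy := torus_noncentral Ny nAy.
have /dvdnP[t tE] := dvd_center_cent1 sHG sZH HZy.
have NE : #|N| = (z * (p ^ e * t))%N.
  have := card_N_torus Ny nAy; rewrite card_unip_cent eE tE => h.
  by apply/eqP; rewrite -(eqn_pmul2r z0) h !mulnA.
have t0 : 0 < t by have := cardG_gt0 'C_H[y]; rewrite tE; case: t {tE NE}.
exists e, t, n, u0; split; last first.
  split=> [x | _]; first exact: p_singular_class.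
  exists y; split=> //; first exact: torus_p'.
  - by rewrite tE mulnC.
  - by rewrite mulnC -tE torus_split.
  move=> n1 h Hh; apply: torus_not_inverted => //.
  have NH : N = H by apply/eqP; rewrite eqEcard subsetIl HE n1 muln1 leqnn.
  by rewrite NH.
split=> //; last by rewrite HE NE !mulnA.
by rewrite t0 /= -(ltn_pmul2l z0) mulnC -tE -eE card_torus_lt.
Qed.

End Parabolic.

(** * Two nonconjugate tori *)

Lemma dvdn_succ_expn_odd b d : odd d -> b.+1 %| (b ^ d).+1.
Proof.
case: b => [|b] od; first exact: dvd1n.
rewrite -(odd_double_half d) od /=; elim: {d od} d./2 => [|k IH].
  by rewrite expn1.
rewrite doubleS.
have -> : (b.+1 ^ (1 + k.*2.+2) = b.+1 * b.+1 * b.+1 ^ (1 + k.*2))%N.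
  by rewrite addnS addnS expnS expnS mulnA.
move: (b.+1 ^ (1 + k.*2))%N IH => m IH.
have -> : ((b.+1 * b.+1 * m).+1 = b.+1 * b.+1 * m.+1 - b * b.+2)%N by clear; nia.
by rewrite dvdn_sub // ?dvdn_mull.
Qed.

(** Put P = p^e. Modulo P + 1 the power p^(d e) = P^d is -1 as d is odd, but it
    would be 1 if P + 1 divided p^d - 1. *)
Lemma expn_succ_ndvd p d e : 1 < p -> odd d -> 0 < e -> ~~ ((p ^ e).+1 %| (p ^ d).-1).
Proof.
move=> p1 od e0; apply/negP=> h.
have pe : 1 < p ^ e by rewrite -{1}(exp1n e) ltn_exp2r.
have h1 : (p ^ e).+1 %| (p ^ (d * e)).-1.
  by apply: (dvdn_trans h); rewrite expnM [X in _ %| X]predn_exp dvdn_mulr.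
have h2 : (p ^ e).+1 %| (p ^ (d * e)).+1 by rewrite mulnC expnM dvdn_succ_expn_odd.
have : (p ^ e).+1 %| 2.
  have pde : 0 < p ^ (d * e) by rewrite expn_gt0 ltnW.
  have -> : 2 = ((p ^ (d * e)).+1 - (p ^ (d * e)).-1)%N by clear -pde; lia.
  exact: dvdn_sub.
by move=> /dvdn_leq-/(_ isT); rewrite ltnS leqNgt pe.
Qed.

Section TwoTori.
Variables (F : finFieldType) (p d : nat).
Hypothesis chp : p \in [pchar F]%R.
Local Notation G := (SL F).
Local Notation Z := ('Z(SL F))%G.
Local Notation z := #|'Z(SL F)|.
Local Notation q := #|F|.
Implicit Types (x y : GL2 F).
Variable H : {group GL2 F}.
Hypotheses (sHG : H \subset G) (sZH : Z \subset H).
Local Notation cl := (noncentral_class H Z).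
Let inHZ := in_noncentral sHG.
Let p_pr := pcharf_prime chp.
Let z0 : 0 < z := cardG_gt0 _.

Lemma cl_p' x y : x \in H :\: Z -> ~~ (p %| #[x]) -> y \in cl x -> ~~ (p %| #[y]).
Proof.
move=> HZx px xy; have := HZx; rewrite inHZ => /andP[Hx nsx].
have HZy := subsetP (cl_sub sHG HZx) _ xy; have [Hy _] := setDP HZy.
have [pC _] := cent1_type chp sHG Hx nsx px.
apply: contra pC => /dvdn_trans; apply; rewrite -(cl_card sHG HZx xy).
by apply: order_dvdG; rewrite in_setI Hy cent1id.
Qed.

(** The unions of classes in the partition of H - Z. The class equation is used by
    adding classes one at a time until their sizes exceed |H - Z|. *)
Definition class_closed (D : {set GL2 F}) :=
  (D \subset H :\: Z) && [forall y in D, cl y \subset D].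

Lemma class_closed1 x : x \in H :\: Z -> class_closed (cl x).
Proof.
move=> HZx; rewrite /class_closed cl_sub //=; apply/forall_inP=> y xy.
by rewrite (cl_eq sHG HZx xy).
Qed.

Lemma class_closedU D E : class_closed D -> class_closed E -> class_closed (D :|: E).
Proof.
move=> /andP[sD /forall_inP cD] /andP[sE /forall_inP cE].
rewrite /class_closed subUset sD sE; apply/forall_inP=> y; rewrite in_setU.
case/orP=> [/cD | /cE] h; apply: (subset_trans h); [exact: subsetUl | exact: subsetUr].
Qed.

Lemma card_class_closedU D x : class_closed D -> x \in H :\: Z -> x \notin D ->
  #|D :|: cl x| = (#|D| + #|cl x|)%N.
Proof.
move=> /andP[sD /forall_inP cD] HZx nDx; rewrite cardsU disjoint_setI0 ?cards0 ?subn0 //.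
apply: contraR nDx => /pred0Pn[w /andP[/= Dw xw]].
by apply: (subsetP (cD _ Dw)); rewrite (cl_eq sHG HZx xw) cl_refl.
Qed.

Lemma class_closed_outside D : class_closed D -> #|D| < #|H :\: Z| ->
  exists2 x, x \in H :\: Z & x \notin D.
Proof.
case/andP=> sD _ cD; have : ~~ (H :\: Z \subset D).
  by apply/negP=> /subset_leq_card; rewrite leqNgt cD.
by case/subsetPn=> x; exists x.
Qed.

(** A single class takes up at least the fraction 1/4 of H/Z, at least 1/3 if a >
    2, and twice as much if the torus is its own normalizer. *)
Lemma class_arith a s k g : 1 < a -> 0 < s <= 2 -> g = (s * a * k)%N ->
  [/\ g = (s * (a.-1 * k + k))%N, g <= 4 * (a.-1 * k),
      (s = 1%N -> g <= 2 * (a.-1 * k)) &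
      (2 < a -> g <= 3 * (a.-1 * k) /\ (s = 1%N -> 2 * g <= 3 * (a.-1 * k)))].
Proof.
move=> a1 /andP[s0 s2] gE.
have e : (a.-1 * k + k = a * k)%N by rewrite -{2}(prednK (ltnW a1)) mulSn addnC.
have k2 : 2 * k <= a * k by rewrite leq_mul2r a1 orbT.
rewrite gE -mulnA; case: s s0 s2 gE => [|[|[|s]]] // _ _ _; split; rewrite ?e //; try lia.
  by move=> a2; have k3 : 3 * k <= a * k by [rewrite leq_mul2r a2 orbT]; lia.
by move=> a2; have k3 : 3 * k <= a * k by [rewrite leq_mul2r a2 orbT]; lia.
Qed.

Hypothesis cardF : q = (p ^ d)%N.
Hypothesis od : odd d.
Hypotheses (n5m : ~~ (5 %| q.-1)) (n5p : ~~ (5 %| q.+1)).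
Hypotheses (n12m : ~~ (12 %| q.-1)) (n12p : ~~ (12 %| q.+1)).
Hypothesis upperH : p %| #|H| -> exists u0, [/\ u0 \in H, ~~ homothety u0, ec u0 = 0%R &
  (tr u0 ^+ 2 = 4)%R].

Section Pair.
Variables (x1 x2 : GL2 F) (m r : nat).
Hypotheses (HZ1 : x1 \in H :\: Z) (p1 : ~~ (p %| #[x1])).
Hypotheses (HZ2 : x2 \in H :\: Z) (p2 : ~~ (p %| #[x2])).
Hypothesis mE : m = q.-1 \/ m = q.+1.
Hypotheses (C1m : #|'C_H[x1]| %| m) (C2m : #|'C_H[x2]| %| m).
Hypotheses (r_pr : prime r) (r_odd : odd r).
Hypotheses (r1 : r %| #|'C_H[x1]|) (r2 : ~~ (r %| #|'C_H[x2]|)).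
Hypothesis n21 : ~~ (#|'C_H[x2]| %| #|'C_H[x1]|).
Hypothesis N2 : #|'C_H[x2]| = 4 -> #|'N_H('C_H[x2])| <> 4.
Hypothesis nfuse : x2 \notin cl x1.

Let n5 : ~~ (5 %| m). Proof. by case: mE => ->. Qed.
Let n12 : ~~ (12 %| m). Proof. by case: mE => ->. Qed.

Let r3 : 2 < r.
Proof. by case: r r_odd (prime_gt1 r_pr) => [|[|[|]]]. Qed.

Lemma center_m_even : 2 %| m -> z = 2.
Proof.
move=> m2; apply: (card_center_odd chp).
have q0 : 0 < q := ltnW (finNzRing_gt1 F).
case: mE m2 => ->; rewrite dvdn2; last by rewrite oddS negbK.
by move=> h; rewrite -(prednK q0) oddS.
Qed.

(** The class of a self-normalizing torus is so large that no second class fits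
    beside it, apart from the case excluded by [N2]; so both tori are inverted by
    their normalizers. The arithmetic conclusions come from 5 and 12 not dividing
    m and from r dividing only one of the orders. *)
Lemma two_tori_data : exists g a1 s1 k1 a2 s2 k2,
  [/\ #|H| = (z * g)%N,
      [/\ #|'C_H[x1]| = (z * a1)%N, g = (s1 * a1 * k1)%N & #|cl x1| = (z * (a1.-1 * k1))%N],
      [/\ #|'C_H[x2]| = (z * a2)%N, g = (s2 * a2 * k2)%N & #|cl x2| = (z * (a2.-1 * k2))%N] &
      [/\ s1 = 2, s2 = 2, 2 < a1 & 1 < a2] /\
      [/\ a1 != 4, a1 != 5, a2 != 5 & [/\ a1 = 3 -> odd a2, a1 = 3 -> a2 != 3 & ~~ (a2 %| a1)]]].
Proof.
have [a1 [s1 [k1 [C1 a1g s1b [_ H1 c1 _]]]]] := semisimple_class chp sHG sZH HZ1 p1.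
have [a2 [s2 [k2 [C2 a2g s2b [NC2 H2 c2 _]]]]] := semisimple_class chp sHG sZH HZ2 p2.
have gE : (s1 * a1 * k1 = s2 * a2 * k2)%N.
  by apply/eqP; rewrite -(eqn_pmul2l z0) -H1 H2.
have za1 : a1 %| m by apply: dvdn_trans C1m; rewrite C1 dvdn_mull.
have za2 : a2 %| m by apply: dvdn_trans C2m; rewrite C2 dvdn_mull.
have ra1 : r %| a1.
  move: r1; rewrite C1 Euclid_dvdM // => /orP[] // rz.
  by have := leq_trans r3 (leq_trans (dvdn_leq z0 rz) (card_center_le2 F)).
have a13 : 2 < a1 by apply: leq_trans r3 (dvdn_leq (ltnW a1g) ra1).
have a14 : a1 != 4.
  apply/eqP=> e; move: ra1; rewrite e (_ : 4 = 2 ^ 2)%N // Euclid_dvdX // andbT.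
  by rewrite dvdn_prime2 // => /eqP r2e; move: r_odd; rewrite r2e.
have a15 : a1 != 5 by apply: contra n5 => /eqP <-.
have a25 : a2 != 5 by apply: contra n5 => /eqP <-.
have odd2 : a1 = 3 -> odd a2.
  move=> e; apply: contraNT n12 => ea2; have d2 : 2 %| a2 by rewrite dvdn2.
  have z2 : z = 2 by apply: center_m_even; apply: dvdn_trans za2.
  have d4 : 4 %| m.
    by apply: dvdn_trans C2m; rewrite C2 z2 (_ : 4 = 2 * 2)%N // dvdn_pmul2l.
  by rewrite (@Gauss_dvd 4 3) // d4 -e za1.
have n33 : a1 = 3 -> a2 != 3.
  move=> e; apply: contra r2 => /eqP e2; rewrite C2 e2 dvdn_mull //.
  by move: ra1; rewrite e.
have nd : ~~ (a2 %| a1) by move: n21; rewrite C1 C2 dvdn_pmul2l.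
have [A1 A2 A3 A4] := class_arith a1g s1b (erefl (s1 * a1 * k1)%N).
have [B1 B2 B3 B4] := class_arith a2g s2b gE.
have [A5 A6] := A4 a13.
(* Both classes lie in H - Z, of size z (g - 1). *)
have sum : a1.-1 * k1 + a2.-1 * k2 < s1 * a1 * k1.
  have := subset_leq_card (_ : cl x1 :|: cl x2 \subset H :\: Z).
  rewrite subUset !(cl_sub sHG) // => /(_ isT).
  rewrite (cl_sum2 sHG) // noncentral_card // c1 c2 H1 -mulnDr.
  have -> : (z * (s1 * a1 * k1) - z = z * (s1 * a1 * k1).-1)%N by rewrite -subn1 mulnBr muln1.
  rewrite leq_pmul2l // => h; rewrite (leq_ltn_trans h) // prednK //.
  by move: (cardG_gt0 H); rewrite H1 muln_gt0 => /andP[].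
have s22 : s2 = 2.
  case/andP: s2b => s20 s22; apply/eqP; rewrite eqn_leq s22 ltn_neqAle s20 andbT eq_sym.
  apply/eqP=> s21; have B3' := B3 s21.
  case: (ltnP 2 a2) => a2l; first by have [_ /(_ s21)] := B4 a2l; clear -A5 sum gE; lia.
  have a22 : a2 = 2 by apply/eqP; rewrite eqn_leq a2l.
  have z2 : z = 2 by apply: center_m_even; rewrite -a22.
  have C4 : #|'C_H[x2]| = 4 by rewrite C2 z2 a22.
  by apply: (N2 C4); rewrite NC2 s21 mul1n -C2.
have s12 : s1 = 2.
  case/andP: s1b => s10 s12; apply/eqP; rewrite eqn_leq s12 ltn_neqAle s10 andbT eq_sym.
  apply/eqP=> s11; have A6' := A6 s11.
  case: (ltnP 2 a2) => a2l; first by have [] := B4 a2l; clear -A6' sum gE; lia.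
  have a22 : a2 = 2 by apply/eqP; rewrite eqn_leq a2l.
  case: (ltnP 3 a1) => a1l; last first.
    by have /odd2 : a1 = 3 by [apply/eqP; rewrite eqn_leq a1l]; rewrite a22.
  have : 4 * k1 <= a1 * k1 by rewrite leq_mul2r a1l orbT.
  by clear -A1 A6' B2 sum s11 a1g; rewrite s11 in A1 sum *; lia.
by exists (s1 * a1 * k1)%N, a1, s1, k1, a2, s2, k2.
Qed.

(** If no element of H has order divisible by p, the two classes leave room for
    exactly one more, and [three_split_classes] applies. Otherwise the class of
    unipotent type must be the third, its normalizer contains a torus, and this
    torus must be one of the two, which is the situation of
    [parabolic_split_classes]. *)
Lemma two_tori_absurd : False.
Proof.
have [g [a1 [s1 [k1 [a2 [s2 [k2 [Hg [C1 g1 c1] [C2 g2 c2] [[s12 s22 a13 a2g] [a14 a15 a25 [odd2 n33 nd]]]]]]]]]]] :=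
  two_tori_data.
rewrite s12 in g1; rewrite s22 in g2.
have a1g : 1 < a1 by apply: ltnW.
have g0 : 0 < g by move: (cardG_gt0 H); rewrite Hg muln_gt0 => /andP[].
have [A1 A2 _ /(_ a13)[A5 _]] := @class_arith a1 2 k1 g a1g isT g1.
have [B1 B2 _ _] := @class_arith a2 2 k2 g a2g isT g2.
have totE : #|H :\: Z| = (z * g.-1)%N.
  by rewrite noncentral_card // Hg -subn1 mulnBr muln1.
have kg1 : 2 <= k1 * 2.
  by rewrite muln2 -(doubleS 0) leq_double lt0n; apply: contraTneq g0 => k0; rewrite g1 k0 muln0.
have kg2 : 2 <= k2 * 2.
  by rewrite muln2 -(doubleS 0) leq_double lt0n; apply: contraTneq g0 => k0; rewrite g2 k0 muln0.
pose D := cl x1 :|: cl x2.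
have clD : class_closed D by apply: class_closedU; apply: class_closed1.
have cD : #|D| = (z * (a1.-1 * k1 + a2.-1 * k2))%N.
  by rewrite card_class_closedU ?class_closed1 // c1 c2 mulnDr.
have le_tot (E : {set GL2 F}) c : class_closed E -> #|E| = (z * c)%N -> c <= g.-1.
  by move=> /andP[sE _] cE; rewrite -(leq_pmul2l z0) -cE -totE subset_leq_card.
have add_class (E : {set GL2 F}) c x a k : class_closed E -> #|E| = (z * c)%N ->
    x \in H :\: Z -> x \notin E -> #|cl x| = (z * (a * k))%N ->
    class_closed (E :|: cl x) /\ #|E :|: cl x| = (z * (c + a * k))%N.
  move=> clE cE HZx nEx cx; split; first by rewrite class_closedU ?class_closed1.
  by rewrite card_class_closedU // cE cx -mulnDr.
have ss_weight x : x \in H :\: Z -> ~~ (p %| #[x]) -> exists a s k,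
    [/\ #|'C_H[x]| = (z * a)%N, 1 < a, 0 < s <= 2, g = (s * a * k)%N & #|cl x| = (z * (a.-1 * k))%N] /\
     (s = 2 -> exists2 h, h \in H & x ^ h = x^-1).
  move=> HZx px; have [a [s [k [C ag sb [_ Hx c inv]]]]] := semisimple_class chp sHG sZH HZx px.
  exists a, s, k; split; last by case/inv=> h /setIP[Hh _] xh; exists h.
  by split=> //; apply/eqP; rewrite -(eqn_pmul2l z0) -Hg Hx.
have [/existsP[x0 /andP[HZx0 px0]] | nsing] := boolP [exists x in H :\: Z, p %| #[x]]; last first.
  have p'H x : x \in H :\: Z -> ~~ (p %| #[x]).
    by move=> HZx; apply: contra nsing => px; apply/existsP; exists x; rewrite HZx.
  have [|x3 HZ3 nD3] := class_closed_outside clD.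
    by rewrite cD totE ltn_pmul2l //; clear -A1 B1 kg1 kg2 g0; lia.
  have [a3 [s3 [k3 [[C3 a3g s3b g3 c3] _]]]] := ss_weight _ HZ3 (p'H _ HZ3).
  have [E1 E2 E3 _] := class_arith a3g s3b g3.
  have [clD3 cD3] := add_class _ _ _ _ _ clD cD HZ3 nD3 c3.
  have le3 := le_tot _ _ clD3 cD3.
  have s32 : s3 = 2.
    case/andP: s3b => s30 s32; apply/eqP; rewrite eqn_leq s32 ltn_neqAle s30 andbT eq_sym.
    by apply/eqP=> /E3; clear -A5 B2 le3 g0; lia.
  have [lt | ge] := ltnP #|D :|: cl x3| #|H :\: Z|.
    have [x4 HZ4 nD4] := class_closed_outside clD3 lt.
    have [a4 [s4 [k4 [[C4 a4g s4b g4 c4] _]]]] := ss_weight _ HZ4 (p'H _ HZ4).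
    have [_ E2' _ _] := class_arith a4g s4b g4.
    have [clD4 cD4] := add_class _ _ _ _ _ clD3 cD3 HZ4 nD4 c4.
    by have := le_tot _ _ clD4 cD4; clear -A5 B2 E2 E2' g0; lia.
  apply: (@three_split_classes g a1 a2 a3 k1 k2 k3) => //; first by rewrite g3 s32.
  move: ge; rewrite totE cD3 leq_pmul2l // => ge.
  by rewrite s32 in E1; clear -ge le3 A1 B1 E1 g0; lia.
have [Hx0 _] := setDP HZx0.
have pH : p %| #|H| by apply: dvdn_trans px0 (order_dvdG Hx0).
have [u0 [Hu0 nsu0 cu0 tu0]] := upperH pH.
have [e [t [n [u [[e0 /andP[t0 tP] HZu Hpar cu] [sing tor]]]]]] :=
  upper_parabolic_class chp sHG sZH Hu0 nsu0 cu0 tu0.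
set P := (p ^ e)%N in tP Hpar cu.
have gP : g = (P * t * n)%N by apply/eqP; rewrite -(eqn_pmul2l z0) -Hg Hpar.
have P2 : 1 < P by apply: leq_ltn_trans t0 tP.
have n0 : 0 < n by move: g0; rewrite gP muln_gt0 => /andP[].
have Pn : (P.-1 * n + n = P * n)%N by rewrite -{2}(prednK (ltnW P2)) mulSn addnC.
have P2n : 2 * n <= P * n by rewrite leq_mul2r P2 orbT.
(* The classes of elements of order prime to p do not meet the class of u. *)
have not_sing x y : x \in H :\: Z -> ~~ (p %| #[x]) -> y \in cl x -> y \notin cl u.
  move=> HZx px xy; apply/negP=> uy.
  have := cl_p' HZx px (_ : x0 \in cl x).
  rewrite px0 -(cl_eq sHG HZx xy) (cl_eq sHG HZu uy) sing //.
  by move/(_ isT).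
have uD : u \notin D.
  rewrite in_setU; apply/negP=> /orP[] h.
    by have := not_sing _ _ HZ1 p1 h; rewrite (cl_refl sHG).
  by have := not_sing _ _ HZ2 p2 h; rewrite (cl_refl sHG).
have [clDu cDu] := add_class _ _ _ _ _ clD cD HZu uD cu.
have leu := le_tot _ _ clDu cDu.
have [tle | t1] := leqP t 1.
  have te : t = 1%N by apply/eqP; rewrite eqn_leq tle.
  by rewrite te muln1 in gP; clear -A5 B2 leu gP P2n Pn g0; lia.
have [y [HZy py Cy tq ninv]] := tor t1.
have [a [s [k [[Cy' ag sb gy cy] inv]]]] := ss_weight _ HZy py.
have ta : t = a by apply/eqP; rewrite -(eqn_pmul2l z0) -Cy Cy'.
subst a.
(* The unipotent class and that of its torus take up at least half of H/Z, and the
   two given classes more than half; so the torus of y belongs to one of the two.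
   *)
have w : g <= 2 * (P.-1 * n + t.-1 * k).
  have [E1 _ E3 _] := class_arith ag sb gy.
  case/andP: (sb) => s0; rewrite leq_eqVlt => /orP[/eqP se | sl].
    have kk : (2 * k = P * n)%N.
      apply/eqP; rewrite -(eqn_pmul2l t0); apply/eqP; move: gP; rewrite gy se.
      by clear; lia.
    by rewrite se in E1; clear -E1 kk Pn P2n; lia.
  have s1' : s = 1%N by apply/eqP; rewrite eqn_leq s0 -ltnS sl.
  by rewrite (leq_trans (E3 s1')) // leq_mul2l leq_addl orbT.
have q0 : 0 < q := ltnW (finNzRing_gt1 F).
(* The case where the torus of y is the torus of xi, and xj is the other one. *)
have key xi ai ki xj aj kj : xi \in H :\: Z -> ~~ (p %| #[xj]) -> xj \in H :\: Z ->
    y \in cl xi -> #|cl xi| = (z * (ai.-1 * ki))%N ->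
    g = (2 * ai * ki)%N -> #|'C_H[xi]| = (z * ai)%N -> #|'C_H[xi]| %| m ->
    1 < aj -> g = (2 * aj * kj)%N -> #|'C_H[xj]| = (z * aj)%N -> #|'C_H[xj]| %| m -> 
    (a1.-1 * k1 + a2.-1 * k2 = ai.-1 * ki + aj.-1 * kj)%N -> False.
  move=> HZi pj HZj yi ci gi Ci Cim ajg gj Cj Cjm sumE.
  have ti : t = ai by apply/eqP; rewrite -(eqn_pmul2l z0) -Cy -Ci (cl_card sHG HZi yi).
  subst ai.
  have kk : k = ki.
    have t10 : 0 < t.-1 by rewrite -subn1 subn_gt0.
    apply/eqP; rewrite -(eqn_pmul2l t10) -(eqn_pmul2l z0) -cy -ci.
    by rewrite (cl_eq sHG HZi yi).
  subst ki.
  have ttk : 0 < t * k by move: g0; rewrite gi -mulnA muln_gt0.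
  have se : s = 2.
    by apply/eqP; rewrite -(eqn_pmul2r ttk) mulnA -gy gi mulnA.
  have [h Hh yh] := inv se.
  (* The torus of y is inverted in H, so the Sylow p-subgroup is not normal. *)
  have n1 : 1 < n.
    rewrite ltn_neqAle n0 andbT eq_sym; apply/eqP=> n1.
    by have /eqP := ninv n1 h Hh.
  (* The torus of y is split, and its order z t does not divide 2. *)
  have mq : m = q.-1.
    case: mE => // mq.
    have zt2 : z * t %| 2.
      have -> : 2 = (q.+1 - q.-1)%N by clear -q0; lia.
      by rewrite dvdn_sub // -mq -Ci.
    have zte : (z * t = 2)%N.
      apply/eqP; rewrite eqn_leq dvdn_leq //= (leq_trans t1) // leq_pmull //.
    have z2 : z = 2 by apply: center_m_even; rewrite -zte -Ci.
    by move: zte; rewrite z2 => zte; clear -zte t1; lia.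
  have [_ wj _ _] := @class_arith aj 2 kj g ajg isT gj.
  have [lt | ge] := ltnP #|D :|: cl u| #|H :\: Z|.
    have [x4 HZ4 nD4] := class_closed_outside clDu lt.
    have p4 : ~~ (p %| #[x4]).
      by apply: contra nD4 => p4; rewrite in_setU sing ?orbT.
    have [a4 [s4 [k4 [[C4 a4g s4b g4 c4] _]]]] := ss_weight _ HZ4 p4.
    have [_ E4 _ _] := class_arith a4g s4b g4.
    have [clD4 cD4] := add_class _ _ _ _ _ clDu cDu HZ4 nD4 c4.
    by have := le_tot _ _ clD4 cD4; rewrite sumE; clear -wj E4 g0 w; lia.
  (* The three classes exhaust H - Z, which is the class equation. *)
  rewrite totE cDu leq_pmul2l // sumE in ge.
  have eqn : (P.-1 * n + t.-1 * k + aj.-1 * kj + 1 = g)%N.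
    by rewrite sumE in leu; clear -ge leu g0; lia.
  have paj : coprime aj P.
    rewrite /P coprime_sym coprimeXl // prime_coprime //.
    have := HZj; rewrite inHZ => /andP[Hj nsj].
    have [pC _] := cent1_type chp sHG Hj nsj pj.
    by apply: contra pC => h'; rewrite Cj dvdn_mull.
  have par : odd P \/ (4 %| P) && odd t.
    have [p_2 | p_odd] := even_prime p_pr; last by left; rewrite /P oddX p_odd orbT.
    right; apply/andP; split.
      rewrite /P p_2 (_ : 4 = 2 ^ 2)%N // dvdn_exp2l //.
      rewrite ltnNge; apply/negP=> e1; have : P <= 2 ^ 1 by rewrite /P p_2 leq_exp2l.
      by rewrite leqNgt (leq_ltn_trans t1 tP).
    apply: dvdn_odd (dvdn_trans (dvdn_mull z (dvdnn t)) tq) _.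
    have : ~~ odd q by rewrite cardF p_2 oddX orbF; case: (d) od.
    by rewrite -{1}(prednK q0) oddS negbK.
  case: (parabolic_split_classes t1 tP n1 (ltnW ajg) paj par gP _ gj eqn).
  - by rewrite {1}gi; congr (_ * _)%N; rewrite mulnC.
  - by move=> aj5; case/negP: n5; apply: dvdn_trans Cjm; rewrite Cj aj5 dvdn_mull.
  (* The order of the torus of xj would be divisible by P + 1, and this torus is
     split. *)
  move=> Paj; case/negP: (expn_succ_ndvd (prime_gt1 p_pr) od e0); rewrite -cardF -/P -mq.
  have [oq | eq] := boolP (odd q).
    by apply: dvdn_trans Paj _; rewrite -(card_center_odd chp oq) -Cj.
  apply: (@dvdn_trans aj); last by apply: dvdn_trans Cjm; rewrite Cj dvdn_mull.
  rewrite -(@Gauss_dvdr _ 2) // coprimen2 oddS.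
  have : ~~ odd p.
    by apply: contra eq; rewrite cardF oddX => ->; rewrite orbT.
  by apply: contra; rewrite /P oddX orbC; case: (odd p) => //=; rewrite eqn0Ngt e0.
have [Dy | nDy] := boolP (y \in D); last first.
  have nDuy : y \notin D :|: cl u.
    by rewrite in_setU (negPf nDy) (not_sing _ _ HZy py) // (cl_refl sHG).
  have [clDy cDy] := add_class _ _ _ _ _ clDu cDu HZy nDuy cy.
  by have := le_tot _ _ clDy cDy; clear -A5 B2 w g0; lia.
move: Dy; rewrite in_setU => /orP[] yi.
  by apply: (key _ _ _ _ _ _ HZ1 p2 HZ2 yi c1 g1 C1 C1m a2g g2 C2 C2m).
by apply: (key _ _ _ _ _ _ HZ2 p1 HZ1 yi c2 g2 C2 C2m a1g g1 C1 C1m); rewrite addnC.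
Qed.

End Pair.
End TwoTori.

(** * Elements of the required order *)

Section Relevant.
Variables (F : finFieldType) (p : nat).
Hypothesis chp : p \in [pchar F]%R.
Local Notation G := (SL F).
Local Notation Z := ('Z(SL F))%G.
Local Notation z := #|'Z(SL F)|.
Local Notation q := #|F|.
Implicit Types (x y : GL2 F).
Variable H : {group GL2 F}.
Hypotheses (sHG : H \subset G) (sZH : Z \subset H).
Local Notation cl := (noncentral_class H Z).
Let inHZ := in_noncentral sHG.
Let p_pr := pcharf_prime chp.
Let z0 : 0 < z := cardG_gt0 _.
Let q0 : 0 < q := ltnW (finNzRing_gt1 F).

Variable m : nat.
Hypothesis mE : m = q.-1 \/ m = q.+1.

Lemma torus_index_gt0 : 0 < m.
Proof. by case: mE => -> //; rewrite -subn1 subn_gt0 finNzRing_gt1. Qed.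

Lemma p_ndvd_torus : ~~ (p %| m).
Proof.
have [k k0 cF] := card_char chp.
have pq : p %| q by rewrite cF dvdn_exp.
apply/negP=> pm; have : p %| 1; last by rewrite dvdn1 => /eqP p1; move: p_pr; rewrite p1.
case: mE pm => -> pm; last by rewrite -(dvdn_addr _ pq) addn1.
by rewrite -(dvdn_addr _ pm) addn1 prednK.
Qed.

(** Up to the factor q the order of G is m times the other number m', and gcd(m,
    m') divides 2. *)
Lemma card_SL_torus : exists m', [/\ m' = q.-1 \/ m' = q.+1, #|G| = (q * (m * m'))%N,
  2 %| m -> 2 %| m' & forall r, 2 < r -> r %| m -> ~~ (r %| m')].
Proof.
have d2 : q.+1 = (q.-1 + 2)%N by rewrite addn2 prednK.
have nd r : 2 < r -> r %| q.-1 -> r %| q.+1 -> False.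
  move=> r2 rm; rewrite d2 dvdn_addr // => /dvdn_leq-/(_ isT).
  by rewrite leqNgt r2.
case: mE => mE'; [exists q.+1 | exists q.-1]; rewrite mE' card_SL -?mulnA; split; auto.
- by rewrite d2 => h; rewrite dvdn_addr.
- by move=> r r2 rm; apply/negP; apply: nd.
- by rewrite (mulnC q.-1).
- by rewrite d2 => h; rewrite -(dvdn_addl _ (dvdnn 2)).
by move=> r r2 rm; apply/negP => rm'; apply: nd rm' rm.
Qed.

(** A prime power greater than 2 divides only one of q - 1 and q + 1, so it
    decides whether a torus is split. *)
Lemma torus_type_dvd x r : x \in H :\: Z -> ~~ (p %| #[x]) -> 2 < r ->
  r %| m -> r %| #|'C_H[x]| -> #|'C_H[x]| %| m.
Proof.
move=> HZx px r2 rm rC; have := HZx; rewrite inHZ => /andP[Hx nsx].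
have d2 : q.+1 = (q.-1 + 2)%N by rewrite addn2 prednK.
have nd : r %| q.-1 -> r %| q.+1 -> False.
  move=> rm'; rewrite d2 dvdn_addr // => /dvdn_leq-/(_ isT).
  by rewrite leqNgt r2.
have [_ [] C] := cent1_type chp sHG Hx nsx px; case: mE rm => -> // rm.
  by case: nd; first exact: dvdn_trans C.
by case: nd => //; exact: dvdn_trans C.
Qed.

Local Notation i := #|G : H|.
Local Notation n := (m %/ gcdn m #|G : H|).

Lemma card_SL_index : (#|H| * i = #|G|)%N. Proof. exact: Lagrange. Qed.

(** The factor i' is |G:H| / d for d = gcd(m, |G:H|), and m k | |H| |G:H| is
    divided by d. *)
Lemma needed_coprime : exists2 i', coprime n i' & forall k, m * k %| #|G| -> n * k %| i' * #|H|.
Proof.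
have d0 : 0 < gcdn m i by rewrite gcdn_gt0 torus_index_gt0.
exists (i %/ gcdn m i).
  by rewrite /coprime -(eqn_pmul2r d0) muln_gcdl !divnK ?dvdn_gcdl ?dvdn_gcdr // mul1n.
move=> k h; rewrite -(dvdn_pmul2r d0) (mulnAC _ k) (mulnAC _ #|H|).
by rewrite !divnK ?dvdn_gcdl ?dvdn_gcdr // (mulnC i) card_SL_index.
Qed.

Lemma needed_dvd : n %| #|H|.
Proof.
have [i' co h] := needed_coprime; have [m' [_ cG _ _]] := card_SL_torus.
rewrite -(Gauss_dvdr _ co) -[n]muln1; apply: h.
by rewrite muln1 cG dvdn_mull // dvdn_mulr.
Qed.

(** If m is even so is the other factor of |G| = q m m', so 2 m divides |G|. *)
Lemma needed_dvd2 : 2 %| n -> 2 * n %| #|H|.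
Proof.
move=> n2; have [i' co h] := needed_coprime; have [m' [_ cG mm _]] := card_SL_torus.
have m2 : 2 %| m by apply: dvdn_trans n2 (dvdn_div _); apply: dvdn_gcdl.
have co2 : coprime (n * 2) i' by rewrite coprimeMl co (coprime_dvdl n2).
rewrite mulnC -(Gauss_dvdr _ co2); apply: h.
by rewrite cG dvdn_mull // dvdn_pmul2l ?torus_index_gt0 // mm.
Qed.

Let nm : n %| m. Proof. by apply: dvdn_div; apply: dvdn_gcdl. Qed.
Let n0 : 0 < n.
Proof. by rewrite divn_gt0 ?gcdn_gt0 ?torus_index_gt0 // dvdn_leq ?torus_index_gt0 ?dvdn_gcdl. Qed.

(** A central element x of a Sylow r-subgroup S of H is noncentral in H because r
    > 2, and its centralizer contains S. Since centralizers partition H - Z, every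
    other centralizer of order divisible by r is conjugate to this one. *)
Lemma odd_prime_torus r : prime r -> odd r -> r %| n ->
  exists x, [/\ x \in H :\: Z, ~~ (p %| #[x]), n`_r %| #|'C_H[x]|, #|'C_H[x]| %| m &
   forall y, y \in H :\: Z -> r %| #|'C_H[y]| -> y \in cl x].
Proof.
move=> r_pr r_odd rn; have r3 : 2 < r by have := prime_gt1 r_pr; case: (r) r_odd => [|[|[|]]].
have [S sylS] := Sylow_exists r H; have sSH := pHall_sub sylS; have rS := pHall_pgroup sylS.
have rH : r %| #|H| by apply: dvdn_trans rn needed_dvd.
have pr : p != r by apply: contraNneq p_ndvd_torus => ->; apply: dvdn_trans rn nm.
have noncentral_r x : x \in H -> r.-elt x -> x != 1 -> x \in H :\: Z /\ ~~ (p %| #[x]).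
  move=> Hx rx x1; split; last first.
    by apply: contraNN pr => px; have := pnatP _ (order_gt0 x) rx p p_pr px; rewrite inE.
  rewrite in_setD Hx andbT; apply: contra x1 => Zx.
  have [k ok] := p_natP rx; rewrite -order_eq1 ok; case: k ok => // k ok.
  have : r %| z by apply: dvdn_trans (order_dvdG Zx); rewrite ok dvdn_exp.
  by move/(dvdn_leq z0); rewrite leqNgt (leq_ltn_trans (card_center_le2 F)).
have ntS : S :!=: 1.
  by rewrite -cardG_gt1 (card_Hall sylS) p_part_gt1 mem_primes r_pr cardG_gt0.
have [x Zx x1] : exists2 x, x \in 'Z(S) & x != 1.
  by apply/trivgPn; apply: contra ntS => /eqP/(trivg_center_pgroup rS) ->.
have /centerP[Sx cx] := Zx.
have [HZx px] := noncentral_r x (subsetP sSH _ Sx) (mem_p_elt rS Sx) x1.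
have sSC : S \subset 'C_H[x].
  apply/subsetP=> s Ss; rewrite in_setI (subsetP sSH) //; apply/cent1P.
  exact/commute_sym/cx.
have nC : n`_r %| #|'C_H[x]|.
  apply: dvdn_trans (cardSg sSC); rewrite (card_Hall sylS).
  by apply: partn_dvd; rewrite ?cardG_gt0 ?needed_dvd.
exists x; split=> //.
  apply: (torus_type_dvd HZx px r3); first exact: dvdn_trans rn nm.
  by apply: dvdn_trans nC; rewrite -{1}(part_pnat_id (pnat_id r_pr)) partn_dvd.
move=> y HZy /Cauchy[] // v Cv ov.
have Hv : v \in H by case/setIP: Cv.
have rv : r.-elt v by rewrite /p_elt ov pnat_id.
have v1 : v != 1 by rewrite -order_gt1 ov prime_gt1.
have [HZv _] := noncentral_r v Hv rv v1.
have [||h Hh] := Sylow_Jsub sylS (_ : <[v]> \subset H) _; rewrite ?cycle_subG //.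
rewrite -cycleJ cycle_subG => Sv.
have e1 : 'C_H[v ^ h] = 'C_H[x].
  apply: (cent1_eq (noncentral_abelian sHG)) => //.
  rewrite in_setD (subsetP sSC) // andbT.
  have := memJ_noncentral (center_cent sHG) v Hh; rewrite HZv.
  by case/setDP.
have e2 : 'C_H[v] = 'C_H[y].
  apply: (cent1_eq (noncentral_abelian sHG)) => //.
  by rewrite in_setD Cv andbT; case/setDP: HZv.
apply/(clP sHG) => //; split=> //; exists h^-1; first by rewrite groupV.
by rewrite -e2 -e1 cent1JH // conjsgK.
Qed.

(** The argument of [odd_prime_torus] fails for r = 2, as the centre of a Sylow
    subgroup S may be Z. Instead x is taken in S with central image in S/Z; its
    conjugates under S are in x Z, which costs a factor 2, and [needed_dvd2]
    provides one. The bound on the normalizer excludes a self-normalizing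
    centralizer of order 4. *)
Lemma two_torus : 4 %| n ->
  exists x, [/\ x \in H :\: Z, ~~ (p %| #[x]), n`_2 %| #|'C_H[x]|, #|'C_H[x]| %| m &
   4 < #|'N_H('C_H[x])|].
Proof.
move=> n4; have m4 : 4 %| m := dvdn_trans n4 nm.
have n2 : 2 %| n by apply: dvdn_trans n4.
have z2 : z = 2.
  apply: (card_center_odd chp); have : 2 %| m by apply: dvdn_trans m4.
  by case: mE => ->; rewrite dvdn2 -?subn1 ?oddB //= ?negbK // addbT negbK.
have p2 : p != 2 by apply: contraNneq p_ndvd_torus => ->; apply: dvdn_trans n2 nm.
have pZ : 2.-group Z by rewrite /pgroup z2.
have [S sylS sZS] := Sylow_superset sZH pZ.
have sSH := pHall_sub sylS; have tS := pHall_pgroup sylS.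
have cS : 2 * n`_2 %| #|S|.
  rewrite (card_Hall sylS) -{1}(part_pnat_id (_ : 2.-nat 2)) // -partnM //.
  by rewrite partn_dvd ?cardG_gt0 ?needed_dvd2.
have n24 : 4 %| n`_2 by rewrite -(part_pnat_id (_ : 2.-nat 4)) // partn_dvd.
have nZS : S \subset 'N(Z).
  by apply: subset_trans sSH _; apply: subset_trans (center_cent sHG) (cent_sub _).
have S8 : 8 %| #|S| by apply: dvdn_trans cS; rewrite (_ : 8 = 2 * 4)%N // dvdn_pmul2l.
have ntSZ : S / Z != 1.
  rewrite -subG1 quotient_sub1 //; apply/negP=> /subset_leq_card.
  by rewrite z2 leqNgt (leq_trans _ (dvdn_leq (cardG_gt0 S) S8)).
(* A nontrivial central element of S/Z lifts to x. *)
have [xb Zxb xb1] : exists2 x, x \in 'Z(S / Z) & x != 1.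
  apply/trivgPn; apply: contra ntSZ => /eqP/trivg_center_pgroup.
  by move/(_ 2 (quotient_pgroup _ tS)) ->.
have /centerP[/morphimP[x Nx Sx xbE] cxb] := Zxb.
have nZx : x \notin Z.
  by apply: contra xb1 => Zx; rewrite xbE; apply/eqP/coset_id.
have Hx := subsetP sSH _ Sx; have HZx : x \in H :\: Z by rewrite in_setD nZx.
have xs s : s \in S -> exists2 c, c \in 'Z(SL F) & x ^ s = x * c.
  move=> Ss; have Ns := subsetP nZS _ Ss.
  have : coset Z (x ^ s) = coset Z x.
    rewrite morphJ //=; apply/conjg_fixP/commgP; rewrite -[X in commute X]xbE.
    by apply: cxb; apply: mem_quotient.
  move=> e; exists (x^-1 * x ^ s); last by rewrite mulKVg.
  apply: coset_idr; first by rewrite groupM ?groupV ?groupJ.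
  by rewrite morphM ?groupV ?groupJ // morphV //= e mulVg.
have px : ~~ (p %| #[x]).
  have := mem_p_elt tS Sx; rewrite /p_elt => tx.
  by apply: contraNN p2 => px; have := pnatP _ (order_gt0 x) tx p p_pr px; rewrite inE.
have cSx : n`_2 %| #|'C_S[x]|.
  (* The conjugates of x under S lie in x Z. *)
  have c2 : #|x ^: S| <= 2.
    rewrite -z2 -(card_lcoset _ x) subset_leq_card //.
    by apply/subsetP=> _ /imsetP[s /xs[c Zc ->] ->]; rewrite mem_lcoset mulKg.
  have cE : #|S| = (#|x ^: S| * #|'C_S[x]|)%N by rewrite -index_cent1 mulnC Lagrange ?subsetIl.
  have tC : 2.-nat #|'C_S[x]| by apply: pgroupS tS; apply: subsetIl.
  have tn : 2.-nat (n`_2)%N by apply: part_pnat.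
  have [a aE] := p_natP tC; have [b bE] := p_natP tn.
  rewrite aE bE dvdn_exp2l // -(leq_exp2l _ _ (isT : 1 < 2)) -aE -bE.
  rewrite -(leq_pmul2l (isT : 0 < 2)).
  apply: leq_trans (dvdn_leq (cardG_gt0 S) cS) _.
  by rewrite cE leq_mul2r c2 orbT.
have nC : n`_2 %| #|'C_H[x]| by apply: dvdn_trans cSx (cardSg _); apply: setSI.
exists x; split=> //.
  by apply: (torus_type_dvd HZx px _ m4) => //; apply: dvdn_trans nC.
apply: (@leq_trans #|S|); first by apply: leq_trans (dvdn_leq (cardG_gt0 S) S8).
apply: subset_leq_card; apply/subsetP=> s Ss; have Hs := subsetP sSH _ Ss.
rewrite in_setI Hs; apply/normP; rewrite -cent1JH //.
apply: (cent1_eq (noncentral_abelian sHG)) => //.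
have HZxs : x ^ s \in H :\: Z by rewrite (memJ_noncentral (center_cent sHG)).
have [Hxs nZxs] := setDP HZxs.
rewrite in_setD nZxs in_setI Hxs; apply/cent1P.
have [c Zc ->] := xs s Ss; apply/commute_sym/commuteM; first exact: commute_refl.
by apply/commute_sym/scalar_commute; move: Zc; rewrite center_SL => /andP[].
Qed.

(** Two nonconjugate centralizers of type m that carry two different primes r and
    l, of which l = 2 counts only if 4 | m, do not occur. This is all that is
    needed to pass from primary parts to orders, and it holds for the reason in
    [two_tori_absurd] or because m has only one such prime. *)
Hypothesis fusion : forall x1 x2 r, x1 \in H :\: Z -> x2 \in H :\: Z ->
  ~~ (p %| #[x1]) -> ~~ (p %| #[x2]) ->
  #|'C_H[x1]| %| m -> #|'C_H[x2]| %| m -> prime r -> odd r ->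
  r %| #|'C_H[x1]| -> ~~ (r %| #|'C_H[x2]|) -> ~~ (#|'C_H[x2]| %| #|'C_H[x1]|) ->
  (#|'C_H[x2]| = 4 -> #|'N_H('C_H[x2])| <> 4) -> x2 \notin cl x1 ->
  (exists l, [/\ prime l, l %| #|'C_H[x2]|, l != r & l = 2 -> 4 %| m]) -> False.

Lemma cyclic_order (C : {group GL2 F}) k : cyclic C -> k %| #|C| -> exists2 w, w \in C & #[w] = k.
Proof.
case/cyclicP=> c -> kc; exists (c ^+ (#[c] %/ k)); first exact: mem_cycle.
have k0 : 0 < k by apply: dvdn_gt0 (order_gt0 c) kc.
by rewrite orderXdiv ?dvdn_div // divnA // mulKn ?order_gt0.
Qed.

(** A prime l is free if the l-part of n divides |Z|, since every centralizer
    contains Z. If some odd prime is not free, its centralizer serves the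
    remaining primes by [fusion]; if 2 is the only one that is not free, the
    centralizer of [two_torus] serves all. *)
Lemma needed_order_exists : exists2 w, w \in H & #[w] = n.
Proof.
suff [C [sCH cC nC]] : exists C : {group GL2 F}, [/\ C \subset H, cyclic C & n %| #|C|].
  by have [w Cw ow] := cyclic_order cC nC; exists w; rewrite // (subsetP sCH).
have tor x : x \in H :\: Z -> ~~ (p %| #[x]) -> n %| #|'C_H[x]| ->
    exists C : {group GL2 F}, [/\ C \subset H, cyclic C & n %| #|C|].
  move=> HZx px nC; exists [group of 'C_H[x]]; rewrite subsetIl.
  by have := HZx; rewrite inHZ => /andP[Hx nsx]; split=> //; apply: (cent1_cyclic chp).
(* If every primary part of n divides |Z|, then n divides |Z| and Z itself will
   do. *)
have [/allP allz | ] := boolP (all (fun l : nat => n`_l %| z) (primes n)).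
  exists Z; split=> //; last by apply/dvdn_partP.
  have := card_center_le2 F; case e: z z0 => [|[|[|]]] // _ _.
    by rewrite (card1_trivg e) cyclic1.
  by apply: prime_cyclic; rewrite e.
rewrite -has_predC => /hasP[l0]; rewrite mem_primes => /and3P[l0_pr _ l0n] /= l0z.
(* For n even |Z| = 2, so the prime 2 matters only if 4 | n. *)
have four : ~~ (n`_2 %| z) -> 4 %| n.
  move=> h; have [k kE] := p_natP (part_pnat 2 n).
  case: k kE => [|[|k]] kE.
  - by rewrite kE dvd1n in h.
  - have n2 : 2 %| n by rewrite -(partnC 2 n0) kE dvdn_mulr.
    case/negP: h; rewrite kE (card_center_odd chp) //.
    have : 2 %| m by apply: dvdn_trans n2 nm.
    by case: mE => ->; rewrite dvdn2 -?subn1 ?oddB //= ?negbK // addbT negbK.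
  by rewrite -(partnC 2 n0) kE !expnS mulnA -mulnA dvdn_mulr.
have [/hasP[r] | noodd] := boolP (has (fun r : nat => odd r && ~~ (n`_r %| z)) (primes n)).
  rewrite mem_primes => /and3P[r_pr _ rn] /andP[r_odd rz].
  have [x [HZx px nCx Cxm fus]] := odd_prime_torus r_pr r_odd rn.
  apply: (tor x HZx px); apply/dvdn_partP => // l; rewrite mem_primes => /and3P[l_pr _ ln].
  have [lz | lz] := boolP (n`_l %| z); first exact: dvdn_trans lz (dvd_center_cent1 sHG sZH HZx).
  apply: contraT => nlx.
  have rCx : r %| #|'C_H[x]|.
    by apply: dvdn_trans nCx; rewrite -{1}(part_pnat_id (pnat_id r_pr)) partn_dvd.
  have lr : l != r by apply: contraNneq nlx => ->.
  have [y [HZy py nCy Cym Ny]] : exists y, [/\ y \in H :\: Z, ~~ (p %| #[y]), n`_l %| #|'C_H[y]|,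
     #|'C_H[y]| %| m & (#|'C_H[y]| = 4 -> #|'N_H('C_H[y])| <> 4)].
    have [l2 | l_odd] := even_prime l_pr.
      rewrite l2 in lz *; have [y [? ? ? ? N4]] := two_torus (four lz); exists y; split=> // _ N4'.
      by rewrite N4' in N4.
    have [y [HZy py nCy Cym _]] := odd_prime_torus l_pr l_odd ln; exists y; split=> // C4.
    have : l %| 4.
      by rewrite -C4; apply: dvdn_trans nCy; rewrite -{1}(part_pnat_id (pnat_id l_pr)) partn_dvd.
    rewrite (_ : 4 = 2 ^ 2)%N // Euclid_dvdX // andbT dvdn_prime2 // => /eqP l2.
    by rewrite l2 in l_odd.
  have ncl : y \notin cl x.
    by apply: contra nlx => xy; rewrite -(cl_card sHG HZx xy).
  case: (@fusion x y r) => //.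
  - by apply: contra ncl; apply: fus.
  - by apply: contra nlx; apply: dvdn_trans.
  exists l; split=> //; last by move=> l2; rewrite l2 in lz; apply: dvdn_trans (four lz) nm.
  by apply: dvdn_trans nCy; rewrite -{1}(part_pnat_id (pnat_id l_pr)) partn_dvd.
have odd_z (l : nat) : l \in primes n -> l != 2 -> n`_l %| z.
  move=> ln l2; apply: contraR noodd => lz; apply/hasP; exists l => //; rewrite lz andbT.
  by move: ln; rewrite mem_primes => /and3P[l_pr _ _]; case: (even_prime l_pr) l2 => [->|].
have l02 : l0 = 2.
  by apply/eqP; apply: contraNT l0z; apply: odd_z; rewrite mem_primes l0_pr n0.
rewrite l02 in l0z; have [x [HZx px nCx Cxm _]] := two_torus (four l0z).
apply: (tor x HZx px); apply/dvdn_partP => // l lp.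
have [-> // | l2] := eqVneq l 2.
by apply: dvdn_trans (odd_z _ lp l2) (dvd_center_cent1 sHG sZH HZx).
Qed.

End Relevant.

(** * Weak exponentiality as existence of orders *)

Section WeaklyExponential.
Variables (F : finFieldType) (p : nat).
Hypothesis chp : p \in [pchar F]%R.
Local Notation G := (SL F).
Local Notation Z := ('Z(SL F))%G.
Local Notation q := #|F|.
Implicit Types (x y g : GL2 F) (H : {group GL2 F}).
Let p_pr := pcharf_prime chp.
Let q0 : 0 < q := ltnW (finNzRing_gt1 F).

(** The orders of the |G:H|-th powers of the elements of order q - 1 and q + 1. *)
Definition realizes_orders H := forall m, m = q.-1 \/ m = q.+1 ->
  exists2 w, w \in H & #[w] = (m %/ gcdn m #|G : H|)%N.

(** The order of x^|G:H| for an element x of order m, which exists by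
    [SL_order_exists] when m > 2. *)
Lemma weakly_exponential_order H m : weakly_exponential H G -> 2 < m ->
  m = q.-1 \/ m = q.+1 -> exists2 w, w \in H & #[w] = (m %/ gcdn m #|G : H|)%N.
Proof.
move=> wexp m2 mE; have [|x Gx ox] := @SL_order_exists F p chp m m2.
  by case: mE => <-; [left | right].
have [g Gg xg] := wexp x Gx; exists ((x ^+ #|G : H|) ^ g^-1); first by rewrite -mem_conjg.
by rewrite orderJ orderXgcd ox.
Qed.

(** For x of order prime to p, the power of x has an order dividing that of an
    element w of H, so it has a conjugate in the cyclic group of w. For other x,
    the power is central if p divides the index, and otherwise H contains a Sylow
    p-subgroup of G. *)
Lemma weakly_exponential_of_orders H : Z \subset H -> H \subset G ->
  realizes_orders H -> weakly_exponential H G.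
Proof.
move=> sZH sHG ords x Gx; set i := #|G : H|.
have Zin c : c \in 'Z(SL F) -> exists2 g, g \in G & c \in H :^ g.
  by move=> Zc; exists 1; rewrite ?group1 // conjsg1 (subsetP sZH).
have [sx | nsx] := boolP (homothety x).
  by apply: Zin; rewrite groupX // center_SL Gx.
have [px | px] := boolP (p %| #[x]); last first.
  have [m mE xm] : exists2 m, m = q.-1 \/ m = q.+1 & #[x] %| m.
    by case: (p'_type chp Gx px) => h; [exists q.-1 | exists q.+1]; auto.
  have [w Hw ow] := ords m mE; have m0 := torus_index_gt0 mE.
  have wm : #[w] %| m by rewrite ow dvdn_div ?dvdn_gcdl.
  have xi : (x ^+ i) ^+ #[w] = 1.
    apply/eqP; rewrite -expgM -order_dvdn ow (dvdn_trans xm) //.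
    by rewrite muln_divA ?dvdn_gcdl // mulnC -muln_divA ?dvdn_gcdr // dvdn_mulr.
  have pw : ~~ (p %| #[w]) by apply: contra (p_ndvd_torus chp mE) => /dvdn_trans; apply.
  have [g Gg xw] := conj_cycle chp (subsetP sHG _ Hw) (groupX i Gx) pw xi.
  by exists g => //; apply: subsetP xw; rewrite conjSg cycle_subG.
have tx : (tr x ^+ 2 = 4)%R by apply/eqP; rewrite -(p_dvd_order chp).
have [pi | pi] := boolP (p %| i).
  apply: Zin; rewrite center_SL groupX // -(divnK pi) mulnC expgM.
  by rewrite scalarX ?groupX //; apply: parabolic_expp.
have [S sylS] := Sylow_exists p H; have sSH := pHall_sub sylS.
have sylGS : p.-Sylow(G) S.
  rewrite pHallE (subset_trans sSH sHG) /= (card_Hall sylS).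
  rewrite -(Lagrange sHG) partnM ?cardG_gt0 //.
  by rewrite [X in (_ * X)%N]part_p'nat ?muln1 // p'natE.
have pxp : p.-group <[x.`_p]> by exact: p_elt_constt.
have [|g Gg xS] := Sylow_Jsub sylGS _ pxp; first by rewrite cycle_subG groupX.
have Zxp' : x.`_p^' \in 'Z(SL F).
  rewrite center_SL groupX //=; apply: contraT => nsy.
  have := disc_commute (groupX _ Gx : x.`_p^' \in G) Gx nsx _ tx.
  move=> h; have : p %| #[x.`_p^'] by rewrite (p_dvd_order chp) ?groupX // h //; apply/commute_sym/commuteX.
  by move=> py; have := p_elt_constt p^' x; rewrite /p_elt p'natE // py.
have xgH : x ^ g \in H.
  rewrite -(consttC p x) conjMg groupM //.
    by apply: (subsetP sSH); move: xS; rewrite -cycleJ cycle_subG.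
  apply: (subsetP sZH); rewrite memJ_norm // (subsetP _ _ Gg) //.
  exact: normal_norm (center_normal _).
exists g^-1; first by rewrite groupV.
by rewrite mem_conjg invgK conjXg groupX.
Qed.

Lemma realizes_ordersJ H g : g \in G -> realizes_orders (H :^ g)%G -> realizes_orders H.
Proof.
move=> Gg ords m mE; have [w Hw ow] := ords m mE.
exists (w ^ g^-1); first by rewrite -mem_conjg.
have e : #|G : H :^ g| = #|G : H| by rewrite -{1}(conjGid Gg) indexJg.
by rewrite orderJ ow /= e.
Qed.

Lemma upper_conjugate H : H \subset G -> p %| #|H| -> exists g u, [/\ g \in G, u \in H :^ g,
   ~~ homothety u, ec u = 0%R & (tr u ^+ 2 = 4)%R].
Proof.
move=> sHG /Cauchy[] // x Hx ox; have Gx := subsetP sHG _ Hx.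
have nsx : ~~ homothety x.
  by apply/negP=> sx; have := scalar_p' chp Gx sx; rewrite ox dvdnn.
have tx : (tr x ^+ 2 = 4)%R by apply/eqP; rewrite -(p_dvd_order chp) // ox.
have [g Gg cg] := conj_upper Gx tx; exists g, (x ^ g); split=> //.
- by rewrite memJ_conjg.
- apply: contra nsx => sxg; have : x ^ g \in 'Z(G) by rewrite center_SL sxg groupJ.
  rewrite memJ_norm; first by rewrite center_SL => /andP[].
  by apply: (subsetP _ _ Gg); apply: normal_norm (center_normal _).
by rewrite trJ.
Qed.

(** After conjugation H contains an upper triangular unipotent element as soon as
    p divides its order, and [two_tori_absurd] gives the property [fusion]. *)
Theorem realizes_orders_odd d H : q = (p ^ d)%N -> odd d ->
  ~~ (5 %| q.-1) -> ~~ (5 %| q.+1) -> ~~ (12 %| q.-1) -> ~~ (12 %| q.+1) ->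
  Z \subset H -> H \subset G -> realizes_orders H.
Proof.
move=> cF od n5m n5p n12m n12p sZH sHG.
have main (K : {group GL2 F}) : Z \subset K -> K \subset G ->
    (p %| #|K| -> exists u0, [/\ u0 \in K, ~~ homothety u0, ec u0 = 0%R & (tr u0 ^+ 2 = 4)%R]) ->
    realizes_orders K.
  move=> sZK sKG up m mE; apply: (needed_order_exists chp sKG sZK mE).
  move=> x1 x2 r HZ1 HZ2 p1 p2 C1 C2 r_pr r_odd r1 r2 n21 N2 ncl _.
  exact: (two_tori_absurd chp sKG sZK cF od n5m n5p n12m n12p up HZ1 p1 HZ2 p2 mE C1 C2 r_pr r_odd r1 r2 n21 N2 ncl).
have [pH | pH] := boolP (p %| #|H|); last by apply: main => // pH'; rewrite pH' in pH.
have [g [u [Gg Hu nsu cu tu]]] := upper_conjugate sHG pH.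
apply: (realizes_ordersJ Gg); apply: main; last by exists u.
  have nZ : Z :^ g = Z.
    by apply: normP; apply: (subsetP _ _ Gg); apply: normal_norm (center_normal _).
  by rewrite -nZ conjSg.
by rewrite -(conjGid Gg) conjSg.
Qed.

(** Only one prime counts, so there is nothing to fuse. *)
Theorem realizes_orders_prime_power H :
  (forall m r l, m = q.-1 \/ m = q.+1 -> prime r -> prime l -> odd r -> r %| m -> l %| m ->
     (l = 2 -> 4 %| m) -> l = r) ->
  Z \subset H -> H \subset G -> realizes_orders H.
Proof.
move=> single sZH sHG m mE; apply: (needed_order_exists chp sHG sZH mE).
move=> x1 x2 r _ _ _ _ C1 C2 r_pr r_odd r1 _ _ _ _ [l [l_pr l2 lr l4]].
case/eqP: lr; apply: (single m) => //; [exact: dvdn_trans r1 C1 | exact: dvdn_trans l2 C2].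
Qed.

End WeaklyExponential.

(** * From PSL(2,q) to SL(2,q) *)

(** Subgroups of the quotient correspond to subgroups containing N, with the same
    index, and membership in a conjugate can be tested upstairs because the
    conjugate contains N. *)
Lemma wexp_solvable_quotient (gT : finGroupType) (G N : {group gT}) : N <| G ->
  wexp_solvable (G / N)%G <->
  (forall H : {group gT}, N \subset H -> H \subset G -> weakly_exponential H G).
Proof.
move=> nNG; have nGN := normal_norm nNG; have sNG := normal_sub nNG.
split=> [wexp H sNH sHG x Gx | wexp Hb sHb].
  have nHN := subset_trans sHG nGN.
  have [|gb /morphimP[g Ng Gg ->]] := wexp (H / N)%G (quotientS N sHG) (coset N x).
    exact: mem_quotient.
  rewrite /= index_quotient_eq ?(subset_trans (subsetIr _ _)) //.
  have Nx := subsetP nGN _ Gx.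
  rewrite -morphX // -quotientJ // => xH; exists g => //.
  have sNHg : N \subset H :^ g by rewrite -(normP Ng) conjSg.
  have nNHg : N <| (H :^ g)%G.
    rewrite /normal sNHg; apply: subset_trans nGN; rewrite -(conjGid Gg).
    by rewrite conjSg.
  have : x ^+ #|G : H| \in coset N @*^-1 ((H :^ g)%G / N).
    by rewrite mem_morphpre ?groupX.
  by rewrite quotientGK.
case: (inv_quotientS nNG sHb) => H HbE sNH sHG xb /morphimP[x Nx Gx ->].
have nHN := subset_trans sHG nGN.
have [g Gg xg] := wexp H sNH sHG x Gx.
have Ng := subsetP nGN _ Gg.
exists (coset N g); first exact: mem_quotient.
rewrite HbE /= index_quotient_eq ?(subset_trans (subsetIr _ _)) //.
by rewrite -morphX // -quotientJ // mem_quotient.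
Qed.

Lemma wexp_solvable_PSL2 (F : finFieldType) : wexp_solvable (PSL2 F) <->
  (forall H : {group GL2 F}, 'Z(SL F) \subset H -> H \subset SL F ->
     weakly_exponential H (SL F)).
Proof. exact: (@wexp_solvable_quotient _ (SL F) 'Z(SL F)%G (center_normal _)). Qed.

Lemma wexp_solvable_card1 (gT : finGroupType) (G : {group gT}) :
  G :=: 1 -> wexp_solvable G.
Proof.
move=> G1 H _ x; rewrite G1 => /set1gP ->; exists 1; first exact: group1.
by rewrite expg1n conjsg1.
Qed.

(** * Quotients of PSL(2,q) *)

Section Simplicity.
Variable F : finFieldType.
Local Notation G := (SL F).
Hypothesis q5 : 5 < #|F|.

Local Notation up b := (gl2 1%R b 0%R 1%R : GL2 F).
Local Notation low c := (gl2 1%R 0%R c 1%R : GL2 F).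
Local Notation diag a := (gl2 a 0%R 0%R a^-1%R : GL2 F).

Let dup (b : F) : (1 * 1 - b * 0 = 1)%R. Proof. by ring. Qed.
Let dlow (c : F) : (1 * 1 - 0 * c = 1)%R. Proof. by ring. Qed.

(** The polynomial X (X^4 - 1) has at most 5 roots. This is where q > 5 enters:
    the squares on the diagonal in [normal_diag] must act nontrivially on the
    unipotent matrices. *)
Lemma exists_pow4_neq1 : exists2 a : F, a != 0%R & (a ^+ 4 != 1)%R.
Proof.
pose P : {poly F} := ('X^4 - 1)%R.
have [a] : exists a : F, ~~ ((a == 0%R) || root P a).
  apply/existsP; apply: contraLR q5; rewrite negb_exists => /forallP h.
  rewrite -leqNgt.
  have PX0 : ('X * P != 0)%R.
    by rewrite mulf_neq0 ?polyX_eq0 // -size_poly_eq0 size_Xn_sub_1.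
  have := max_poly_roots PX0 (_ : all (root ('X * P)) (enum F)) (enum_uniq _).
  rewrite size_mul ?polyX_eq0 -?size_poly_eq0 ?size_Xn_sub_1 // size_polyX -cardE /=.
  rewrite ltnS => -> //; apply/allP=> a _; have := h a; rewrite negbK => ha.
  by rewrite rootM rootX.
rewrite negb_or => /andP[a0 Pa]; exists a => //.
by apply: contra Pa => /eqP a4; rewrite rootE !hornerE a4 subrr.
Qed.

(** A matrix with c nonzero is upper times lower times upper. *)
Lemma unipotents_generate_SL (N : {group GL2 F}) : (forall b, up b \in N) -> (forall c, low c \in N) -> G \subset N.
Proof.
move=> upN lowN.
have main x : x \in G -> ec x != 0%R -> x \in N.
  move=> Gx cn; have dx := SL_det Gx.
  have -> : x = up ((ea x - 1) / ec x)%R * low (ec x) * up ((ed x - 1) / ec x)%R.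
    apply: entries_inj; rewrite !entE !(sl2E (dup _)) !(sl2E (dlow _)).
    - by field.
    - by apply: (mulIf cn); apply: (lincomb (k := (-1)%R) dx); field.
    - by field.
    by field.
  by rewrite !groupM.
apply/subsetP=> x Gx; have [c0 | cn] := eqVneq (ec x) 0%R; last exact: main.
rewrite -(groupMl x (lowN 1%R)); apply: main; first by rewrite groupM // gl2_SL.
have dx := SL_det Gx; rewrite !entE !(sl2E (dlow _)) c0 mulr0 addr0 mul1r.
by apply: contraPneq dx => a0; rewrite c0 a0 mul0r mulr0 subr0 => /esym/eqP; rewrite oner_eq0.
Qed.

Let weyl_det : (0 * 0 - 1 * -1 = 1 :> F)%R. Proof. by ring. Qed.
Local Notation weyl := (gl2 0%R 1%R (-1)%R 0%R : GL2 F).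

Lemma upJ_weyl (b : F) : up b ^ weyl = low (- b)%R.
Proof.
rewrite /conjg; apply: entries_inj; rewrite !entE !(SL_V (gl2_SL weyl_det));
  rewrite !(sl2E (dup _)) !(sl2E (dlow _)) !(sl2E weyl_det); ring.
Qed.

Section Normal.
Variable N : {group GL2 F}.
Hypothesis nNG : N <| G.

Let NJ x g : x \in N -> g \in G -> x ^ g \in N.
Proof. by move=> Nx Gg; rewrite memJ_norm // (subsetP (normal_norm nNG)). Qed.
Let NG x : x \in N -> x \in G. Proof. exact: subsetP (normal_sub nNG) x. Qed.

Lemma normal_c_neq0 x : x \in N -> ~~ homothety x -> exists2 y, y \in N & ec y != 0%R.
Proof.
move=> Nx nsx; have [c0 | cn] := eqVneq (ec x) 0%R; last by exists x.
have [b0 | bn] := eqVneq (eb x) 0%R.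
  exists (x ^ low 1%R); first by rewrite NJ ?gl2_SL.
  rewrite /conjg !entE !(SL_V (gl2_SL (dlow 1%R))) !(sl2E (dlow _)) b0 c0.
  apply: contra nsx => /eqP h; apply/homothetyP; split=> //.
  by apply: (lincomb (k := (-1)%R) h); ring.
exists (x ^ weyl); first by rewrite NJ ?gl2_SL.
rewrite /conjg !entE !(SL_V (gl2_SL weyl_det)) !(sl2E weyl_det) c0.
by apply: contra bn => /eqP h; apply/eqP; apply: (lincomb (k := (-1)%R) h); ring.
Qed.

(** With a conjugate w of x whose upper left entry is zero, the commutator of w
    and a diagonal matrix is upper triangular with a known diagonal. *)
Lemma normal_diag x (a : F) : x \in N -> ~~ homothety x -> a != 0%R ->
  exists v, [/\ v \in N, ec v = 0%R, ea v = (a ^+ 2)%R & ed v = (a ^- 2)%R].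
Proof.
move=> Nx nsx a0; have [y Ny cy] := normal_c_neq0 Nx nsx.
pose s := (ea y / ec y)%R.
(* Conjugation by an upper unipotent matrix shifts a by a multiple of c. *)
have [w Nw aw] : exists2 w, w \in N & ea w = 0%R.
  exists (y ^ up s); first by rewrite NJ ?gl2_SL.
  by rewrite /conjg !entE !(SL_V (gl2_SL (dup s))) !(sl2E (dup _)) /s; field.
have dd : (a * a^-1 - 0 * 0 = 1)%R by field.
have dw := SL_det (NG Nw); rewrite aw mul0r sub0r in dw.
have Nwd : w ^ diag a \in N by rewrite NJ ?gl2_SL.
exists (w^-1 * w ^ diag a); split; first by rewrite groupM ?groupV.
all: rewrite /conjg !entE !(SL_V (NG Nw)) !(SL_V (gl2_SL dd)) !(sl2E dd) ?aw.
- by field.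
- by apply: (lincomb (k := (a ^+ 2)%R) dw); ring.
by apply: (lincomb (k := (a ^- 2)%R) dw); field.
Qed.

(** The commutators of an upper triangular element v with upper unipotent matrices
    fill the upper unipotent group, as 1 - a^(-4) is nonzero. *)
Lemma normal_up x : x \in N -> ~~ homothety x -> forall b, up b \in N.
Proof.
move=> Nx nsx b; have [a a0 a4] := exists_pow4_neq1.
have [v [Nv cv av dv]] := normal_diag Nx nsx a0.
have e0 : (1 - a ^- 4 != 0)%R.
  by rewrite subr_eq0 eq_sym invr_eq1.
pose t := (b / (1 - a ^- 4))%R.
have -> : up b = v^-1 * v ^ up t.
  apply: entries_inj; rewrite /conjg !entE !(SL_V (NG Nv)) !(SL_V (gl2_SL (dup t))) !(sl2E (dup _)) cv av dv.
  - by field.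
  - rewrite /t; field.
    by rewrite a0 subr_eq0.
  - by field.
  by field.
by rewrite groupM ?groupV // NJ ?gl2_SL.
Qed.

Lemma normal_noncentral x : x \in N -> ~~ homothety x -> G \subset N.
Proof.
move=> Nx nsx; have upN := normal_up Nx nsx; apply: unipotents_generate_SL => // c.
by rewrite -[c]opprK -upJ_weyl NJ ?gl2_SL.
Qed.

End Normal.

Lemma PSL2_quotient (Nb : {group coset_of 'Z(SL2 F)}) :
  Nb <| PSL2 F -> Nb :!=: 1 -> wexp_solvable (PSL2 F / Nb)%G.
Proof.
move=> nNb ntNb; apply: wexp_solvable_card1.
have nZ : 'Z(SL F)%G <| SL F := center_normal _.
case: (@inv_quotientN _ 'Z(SL F)%G (SL F) Nb nZ nNb) => N NbE sZN nNG.
have sGN : SL F \subset N.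
  have : ~~ (N \subset 'Z(SL F)).
    apply: contra ntNb => sNZ; rewrite NbE -subG1 quotient_sub1 //.
    exact: subset_trans (normal_sub nNG) (normal_norm nZ).
  case/subsetPn=> x Nx; rewrite center_SL (subsetP (normal_sub nNG)) //= => nsx.
  exact: (normal_noncentral nNG Nx nsx).
apply/trivgP; rewrite /= quotient_sub1; last exact: normal_norm nNb.
by rewrite NbE; apply: quotientS.
Qed.

End Simplicity.

Local Open Scope ring_scope.

(** * Finite groups of unit quaternions *)

(** The integer a + b w of the quadratic ring with w^2 = u w + v, as the pair (a,
    b). *)
Definition qint := (int * int)%type.
Definition qint_add (x y : qint) : qint := (x.1 + y.1, x.2 + y.2).
Definition qint_opp (x : qint) : qint := (- x.1, - x.2).
Definition qint_mul (u v : int) (x y : qint) : qint :=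
  (x.1 * y.1 + v * (x.2 * y.2), x.1 * y.2 + x.2 * y.1 + u * (x.2 * y.2)).
(** The product of a + b w with its conjugate a + u b - b w. *)
Definition qint_norm (u v : int) (x : qint) : int :=
  x.1 * x.1 + u * (x.1 * x.2) - v * (x.2 * x.2).
(** Only even numbers are halved correctly; [quat_check] tests that this is what
    happens. *)
Definition int_half (a : int) : int :=
  match a with Posz n => Posz n./2 | Negz n => Negz n./2 end.
Definition qint_half (x : qint) : qint := (int_half x.1, int_half x.2).

(** A quaternion over the quadratic integers by its coordinates on 1, i, j, k
    multiplied by 2, so that the elements of the binary polyhedral groups have
    integral coordinates. *)
Definition quat := (qint * qint * qint * qint)%type.
Definition quat_map2 (f : qint -> qint -> qint) (x y : quat) : quat :=
  let: (a, b, c, d) := x in let: (a', b', c', d') := y in (f a a', f b b', f c c', f d d').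
Definition quat_half (x : quat) : quat :=
  let: (a, b, c, d) := x in (qint_half a, qint_half b, qint_half c, qint_half d).
Definition quat_double (x : quat) : quat := quat_map2 qint_add x x.
Definition quat_sub (x y : quat) : quat := quat_map2 (fun a b => qint_add a (qint_opp b)) x y.
Definition quat_mul (u v : int) (x y : quat) : quat :=
  let M := qint_mul u v in
  let A := qint_add in let B a b := qint_add a (qint_opp b) in
  let: (a, b, c, d) := x in let: (a', b', c', d') := y in
  (B (B (M a a') (M b b')) (A (M c c') (M d d')),
   B (A (A (M a b') (M b a')) (M c d')) (M d c'),
   A (A (B (M a c') (M b d')) (M c a')) (M d b'),
   A (B (A (M a d') (M b c')) (M c b')) (M d a')).
Definition quat_norm (u v : int) (x : quat) : qint :=
  let M := qint_mul u v in let A := qint_add in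
  let: (a, b, c, d) := x in A (A (M a a) (M b b)) (A (M c c) (M d d)).

(** The product of quaternions given by doubled coordinates, again with doubled
    coordinates. *)
Definition half_mul u v (x y : quat) : quat := quat_half (quat_mul u v x y).
Definition qint0 : qint := (0, 0).
Definition quat_one : quat := ((2, 0), qint0, qint0, qint0).
Definition quat_opp_one : quat := ((-2, 0), qint0, qint0, qint0).

(** The facts which make a list of doubled quaternions a group and survive
    reduction modulo p: it is closed under multiplication, its elements have norm
    1 (that is 4 after doubling), the norms of differences of distinct elements
    are rational integers among [ns] after taking the norm of the quadratic ring,
    so they do not vanish modulo p, and the orders divide members of [ks]. *)
Definition quat_check (u v : int) (ns ks : seq nat) (L : seq quat) : bool :=
  [&& quat_one \in L, quat_opp_one \in L, uniq L,
    all (fun x => quat_norm u v x == (4, 0)) L,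
    all (fun x => all (fun y => let w := quat_mul u v x y in
       (quat_half w \in L) && (quat_double (quat_half w) == w)) L) L,
    all (fun x => all (fun y => (x == y) ||
       (`|qint_norm u v (quat_norm u v (quat_sub x y))|%N \in ns)) L) L &
    all (fun x => has (fun k => iter k (half_mul u v x) quat_one == quat_one) ks) L].

Definition signs : seq int := [:: 1; -1].
Definition sign_pairs := [seq (a, b) | a <- signs, b <- signs].
(** The binary tetrahedral group: the 8 units 1, i, j, k up to sign and the 16
    elements with all coordinates 1/2 or -1/2. *)
Definition hurwitz_units : seq quat :=
  [seq ((2 * s, 0), qint0, qint0, qint0) | s <- signs] ++ [seq (qint0, (2 * s, 0), qint0, qint0) | s <- signs] ++
  [seq (qint0, qint0, (2 * s, 0), qint0) | s <- signs] ++ [seq (qint0, qint0, qint0, (2 * s, 0)) | s <- signs] ++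
  [seq ((s.1.1, 0), (s.1.2, 0), (s.2.1, 0), (s.2.2, 0))
     | s <- [seq (ab, cd) | ab <- sign_pairs, cd <- sign_pairs]].

Definition even_perms : seq (seq nat) :=
  [:: [:: 0;1;2;3]; [:: 0;2;3;1]; [:: 0;3;1;2]; [:: 1;0;3;2]; [:: 1;2;0;3]; [:: 1;3;2;0];
      [:: 2;0;1;3]; [:: 2;1;3;0]; [:: 2;3;0;1]; [:: 3;0;2;1]; [:: 3;1;0;2]; [:: 3;2;1;0]]%N.
(** The binary icosahedral group: besides the Hurwitz units, the 96 even
    permutations of the vectors (w, 1, w - 1, 0)/2 with all signs, where w is the
    golden ratio and w - 1 = 1/w. *)
Definition icosians : seq quat := hurwitz_units ++
  [seq (let w := [:: (0, s.1.1); (s.1.2, 0); (- s.2, s.2); qint0] in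
        let e j := nth qint0 w (nth 0%N t j) in (e 0%N, e 1%N, e 2%N, e 3%N))
     | s <- [seq (ab, c) | ab <- sign_pairs, c <- signs], t <- even_perms].

Lemma hurwitz_check : quat_check 0 0 [:: 16; 64; 144; 256]%N [:: 4; 6]%N hurwitz_units && (size hurwitz_units == 24)%N.
Proof. by vm_compute. Qed.

Lemma icosian_check : quat_check 1 1 [:: 16; 64; 80; 144; 256]%N [:: 4; 6; 10]%N icosians && (size icosians == 120)%N.
Proof. by vm_compute. Qed.

Section QuaternionGroup.
Variables (F : finFieldType) (u v : int) (w al be : F).
Hypothesis wE : w ^+ 2 = u%:~R * w + v%:~R.
Hypothesis abE : al ^+ 2 + be ^+ 2 = -1.
Hypothesis two : (2 : F) != 0.
Local Notation G := (SL F).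

Definition qint_eval (x : qint) : F := x.1%:~R + x.2%:~R * w.

Lemma qint_evalD x y : qint_eval (qint_add x y) = qint_eval x + qint_eval y.
Proof. by rewrite /qint_eval /= !rmorphD /=; ring. Qed.
Lemma qint_evalN x : qint_eval (qint_opp x) = - qint_eval x.
Proof. by rewrite /qint_eval /= !rmorphN /=; ring. Qed.
Lemma qint_evalM x y : qint_eval (qint_mul u v x y) = qint_eval x * qint_eval y.
Proof.
rewrite /qint_eval /= !(rmorphD, rmorphM) /=.
by apply: (lincomb (k := - (x.2%:~R * y.2%:~R)) wE); ring.
Qed.
(** An integer is a multiple of its conjugate, so it does not vanish in F if its
    norm does not. *)
Lemma qint_eval_norm x : qint_eval x * qint_eval (x.1 + u * x.2, - x.2) = (qint_norm u v x)%:~R.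
Proof.
rewrite /qint_eval /qint_norm /= !(rmorphD, rmorphM, rmorphN, rmorphB) /=.
by apply: (lincomb (k := - (x.2%:~R * x.2%:~R)) wE); ring.
Qed.

Definition qa (x : quat) : F := let: (a, b, c, d) := x in (qint_eval a + qint_eval c * al + qint_eval d * be) / 2.
Definition qb (x : quat) : F := let: (a, b, c, d) := x in (qint_eval b + qint_eval c * be - qint_eval d * al) / 2.
Definition qc (x : quat) : F := let: (a, b, c, d) := x in (- qint_eval b + qint_eval c * be - qint_eval d * al) / 2.
Definition qd (x : quat) : F := let: (a, b, c, d) := x in (qint_eval a - qint_eval c * al - qint_eval d * be) / 2.
(** The splitting of the quaternion algebra over F by i = [0 1; -1 0] and j = [al
    be; be -al], with al^2 + be^2 = -1. *)
Definition quat_elt (x : quat) : GL2 F := gl2 (qa x) (qb x) (qc x) (qd x).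

Lemma quat_det x : qa x * qd x - qb x * qc x = qint_eval (quat_norm u v x) / 4.
Proof.
case: x => [[[a b] c] d]; rewrite /quat_norm !(qint_evalD, qint_evalM) /=.
have n4 : (4 : F) != 0 by rewrite (_ : 4 = 2 * 2 :> F) ?mulf_neq0 //; ring.
apply: (mulIf n4); rewrite divfK //.
apply: (lincomb (k := - (qint_eval c ^+ 2 + qint_eval d ^+ 2)) abE); field.
by rewrite two.
Qed.

Lemma quat_norm4 x : quat_norm u v x = (4, 0) -> qa x * qd x - qb x * qc x = 1.
Proof.
move=> e; rewrite quat_det e /qint_eval /= mul0r addr0.
have n4 : (4 : F) != 0 by rewrite (_ : 4 = 2 * 2 :> F) ?mulf_neq0 //; ring.
exact: divff.
Qed.

Lemma quat_entM x y t : quat_double t = quat_mul u v x y ->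
  [/\ qa t = qa x * qa y + qb x * qc y, qb t = qa x * qb y + qb x * qd y,
      qc t = qc x * qa y + qd x * qc y & qd t = qc x * qb y + qd x * qd y].
Proof.
case: x => [[[a b] c] d]; case: y => [[[a' b'] c'] d']; case: t => [[[a'' b''] c''] d''].
move=> E.
have := congr1 (fun s : quat => qint_eval s.1.1.1) E; have := congr1 (fun s : quat => qint_eval s.1.1.2) E.
have := congr1 (fun s : quat => qint_eval s.1.2) E; have := congr1 (fun s : quat => qint_eval s.2) E.
rewrite /quat_double /quat_mul /= !(qint_evalD, qint_evalN, qint_evalM) {E} => hd hc hb ha.
have half s s' : s + s = s' -> s = s' / 2 :> F.
  by move=> <-; apply: (mulIf two); rewrite divfK //; ring.
rewrite (half _ _ ha) (half _ _ hb) (half _ _ hc) (half _ _ hd) {ha hb hc hd half}.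
move: (qint_eval a) (qint_eval b) (qint_eval c) (qint_eval d) (qint_eval a') (qint_eval b') (qint_eval c') (qint_eval d') => {}a {}b {}c {}d {}a' {}b' {}c' {}d'.
have abE' : be ^+ 2 = -1 - al ^+ 2 by apply: (lincomb (k := 1) abE); ring.
split; field: abE'; by rewrite two.
Qed.

Variables (ns ks : seq nat) (L : seq quat).
Hypothesis nsE : {in ns, forall k, (k%:R : F) != 0}.
Hypothesis chk : quat_check u v ns ks L.

Lemma abs_norm_neq0 (k : int) : `|k|%N \in ns -> k%:~R != 0 :> F.
Proof. by case: k => n /nsE //; rewrite NegzE mulrNz oppr_eq0. Qed.

Let norm4 x : x \in L -> qa x * qd x - qb x * qc x = 1.
Proof. by move=> Lx; apply: quat_norm4; case/and5P: chk => _ _ _ /allP/(_ x Lx)/eqP. Qed.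

Lemma quat_elt_SL x : x \in L -> quat_elt x \in G.
Proof. by move=> Lx; apply: gl2_SL; apply: norm4. Qed.

Lemma quat_eltM x y : x \in L -> y \in L ->
  half_mul u v x y \in L /\ (quat_elt x * quat_elt y)%g = quat_elt (half_mul u v x y).
Proof.
move=> Lx Ly; have [_ _ _ _ /and3P[/allP/(_ x Lx)/allP/(_ y Ly)/andP[Lt /eqP e] _ _]] := and5P chk.
split=> //; have [h1 h2 h3 h4] := quat_entM e.
by apply: entries_inj; rewrite !entE !(sl2E (norm4 _)) // ?h1 ?h2 ?h3 ?h4.
Qed.

(** The determinant of the difference of two images is the norm of the difference,
    which is nonzero in F by the test on [ns]. *)
Lemma quat_elt_inj : {in L &, injective quat_elt}.
Proof.
move=> x y Lx Ly e; have [_ _ _ _ /and3P[_ /allP/(_ x Lx)/allP/(_ y Ly) h _]] := and5P chk.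
case/orP: h => [/eqP // | /abs_norm_neq0/eqP []]; rewrite -qint_eval_norm.
have ha : qa x = qa y by rewrite -(sl2E (norm4 Lx)) -/(quat_elt x) e !(sl2E (norm4 Ly)).
have hb : qb x = qb y by rewrite -(sl2E (norm4 Lx)) -/(quat_elt x) e !(sl2E (norm4 Ly)).
have hc : qc x = qc y by rewrite -(sl2E (norm4 Lx)) -/(quat_elt x) e !(sl2E (norm4 Ly)).
have hd : qd x = qd y by rewrite -(sl2E (norm4 Lx)) -/(quat_elt x) e !(sl2E (norm4 Ly)).
suff -> : qint_eval (quat_norm u v (quat_sub x y)) = 0 by rewrite mul0r.
have -> : qint_eval (quat_norm u v (quat_sub x y)) =
    4 * ((qa x - qa y) * (qd x - qd y) - (qb x - qb y) * (qc x - qc y)).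
  case: (x) => [[[a b] c] d]; case: (y) => [[[a' b'] c'] d'].
  rewrite /quat_norm /quat_sub /= !(qint_evalD, qint_evalN, qint_evalM).
  have abE' : be ^+ 2 = -1 - al ^+ 2 by apply: (lincomb (k := 1) abE); ring.
  field: abE'; exact: two.
by rewrite ha hb hc hd; ring.
Qed.

Definition quat_set : {set GL2 F} := [set g in map quat_elt L].

Lemma quat_group_set : group_set quat_set.
Proof.
apply/group_setP; split.
  rewrite inE; apply/mapP; exists quat_one; first by case/and5P: chk.
  have L1 : quat_one \in L by case/and5P: chk.
  by apply: entries_inj; rewrite !entE !(sl2E (norm4 L1)) /= /qint_eval /=; field.
move=> g h; rewrite !inE => /mapP[x Lx ->] /mapP[y Ly ->].
by have [Lt ->] := quat_eltM Lx Ly; apply: map_f.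
Qed.
Canonical quat_group := Group quat_group_set.

Lemma card_quat_group : #|quat_group| = size L.
Proof.
rewrite cardsE (card_uniqP _) ?size_map //.
by rewrite (map_inj_in_uniq quat_elt_inj); case/and5P: chk.
Qed.

Lemma quat_group_sub : quat_group \subset G.
Proof. by apply/subsetP=> g; rewrite inE => /mapP[x Lx ->]; apply: quat_elt_SL. Qed.

(** The centre of SL(2,q) consists of the images of 1 and -1. *)
Lemma quat_group_center : 'Z(G) \subset quat_group.
Proof.
apply/subsetP=> x; rewrite center_SL => /andP[Gx /homothetyP[b0 c0 ad]].
have := SL_det Gx; rewrite b0 c0 mul0r subr0 -ad -expr2 => /eqP.
rewrite sqrf_eq1 inE => a1; apply/mapP.
have [L1 Lm] : quat_one \in L /\ quat_opp_one \in L by case/and5P: chk.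
case/orP: a1 => /eqP a1; [exists quat_one | exists quat_opp_one] => //.
  by apply: entries_inj; rewrite ?b0 ?c0 -?ad ?a1 !(sl2E (norm4 L1)) /= /qint_eval /=; field.
by apply: entries_inj; rewrite ?b0 ?c0 -?ad ?a1 !(sl2E (norm4 Lm)) /= /qint_eval /=; field.
Qed.

Lemma quat_group_exponents g : g \in quat_group -> exists2 k, k \in ks & (g ^+ k)%g = 1%g.
Proof.
rewrite inE => /mapP[x Lx ->].
have [L1 _ _ _ /and3P[_ _ /allP/(_ x Lx)/hasP[k kk /eqP e]]] := and5P chk.
exists k => //; have one1 : quat_elt quat_one = 1%g.
  by apply: entries_inj; rewrite !entE !(sl2E (norm4 L1)) /= /qint_eval /=; field.
suff [Lk <-] : iter k (half_mul u v x) quat_one \in L /\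
    quat_elt (iter k (half_mul u v x) quat_one) = (quat_elt x ^+ k)%g by rewrite e.
elim: k {kk e} => [|k [IH1 IH2]] //=.
by have [Lt <-] := quat_eltM Lx IH1; split=> //; rewrite IH2 expgS.
Qed.

End QuaternionGroup.

Local Close Scope ring_scope.

(** * The binary tetrahedral and icosahedral groups in SL(2,q) *)

Section Failures.
Variables (F : finFieldType) (p : nat).
Hypothesis chp : p \in [pchar F]%R.
Local Notation G := (SL F).
Local Notation Z := ('Z(SL F))%G.
Local Notation q := #|F|.
Implicit Types (x y : GL2 F) (H : {group GL2 F}).
Let p_pr := pcharf_prime chp.
Let q0 : 0 < q := ltnW (finNzRing_gt1 F).

Lemma prime_natF_neq0 r : prime r -> p != r -> (r%:R : F)%R != 0%R.
Proof. by move=> r_pr pr; rewrite -(dvdn_pcharf chp) dvdn_prime2. Qed.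

Lemma nat235_neq0 a b c : p != 2 -> p != 3 -> (c == 0) || (p != 5) ->
  ((2 ^ a * 3 ^ b * 5 ^ c)%:R : F)%R != 0%R.
Proof.
move=> p2 p3 p5; rewrite !natrM !natrX mulf_neq0 //.
  by rewrite mulf_neq0 ?expf_neq0 ?prime_natF_neq0.
by case: c p5 => [|c] /= p5; rewrite ?expr0 ?oner_neq0 // expf_neq0 // prime_natF_neq0.
Qed.

(** A common factor of m and the index cancels in m / gcd(m, i). *)
Lemma needed_order_eq k m1 c m i : 0 < m1 -> m = (m1 * k)%N -> i = (m1 * c)%N ->
  (m %/ gcdn m i = k %/ gcdn k c)%N.
Proof. by move=> m10 -> ->; rewrite -muln_gcdr divnMl. Qed.

Lemma hurwitz_group : p != 2 -> p != 3 -> exists H, [/\ Z \subset H, H \subset G, #|H| = 24 &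
  forall g, g \in H -> g ^+ 4 = 1 \/ g ^+ 6 = 1].
Proof.
move=> p2 p3.
have nz a b := @nat235_neq0 a b 0 p2 p3 isT.
have two : (2 : F)%R != 0%R := nz 1%N 0.
(* No irrationality is needed: the quadratic ring degenerates with w = 0. *)
have [al [be abE]] := sum_of_squares chp (-1)%R two (oner_neq0 F).
rewrite mul1r in abE.
have wE : (0 ^+ 2 = (0%:~R : F) * 0 + 0%:~R)%R by rewrite !mulr0 addr0 expr0n.
have nsE : {in [:: 16; 64; 144; 256], forall k, ((k%:R : F) != 0)%R}.
  move=> k; rewrite !inE => /or4P[]/eqP->; [exact: (nz 4 0) | exact: (nz 6 0) | | exact: (nz 8 0)].
  exact: (nz 4 2).
have /andP[chk /eqP sz] := hurwitz_check.
exists (quat_group wE abE two chk); split.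
- exact: quat_group_center.
- exact: quat_group_sub.
- by rewrite card_quat_group.
by move=> g /quat_group_exponents[k]; rewrite !inE => /orP[] /eqP ->; [left | right].
Qed.

(** The golden ratio is in F as the opposite of the trace l + 1/l of an element of
    order 5. *)
Lemma icosian_group : p != 2 -> p != 3 -> p != 5 -> 5 %| q.-1 \/ 5 %| q.+1 ->
  exists H, [/\ Z \subset H, H \subset G, #|H| = 120 &
  forall g, g \in H -> [\/ g ^+ 4 = 1, g ^+ 6 = 1 | g ^+ 10 = 1]].
Proof.
move=> p2 p3 p5 q5.
have nz a b c : ((2 ^ a * 3 ^ b * 5 ^ c)%:R : F)%R != 0%R.
  by apply: nat235_neq0 => //; rewrite p5 orbT.
have two : (2 : F)%R != 0%R := nz 1%N 0 0.
have [al [be abE]] := sum_of_squares chp (-1)%R two (oner_neq0 F).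
rewrite mul1r in abE.
have [w wE] : exists w : F, (w ^+ 2 = 1%:~R * w + 1%:~R)%R.
  have [x Gx ox] := SL_order_exists chp (isT : 2 < 5) q5.
  have px : ~~ (p %| #[x]) by rewrite ox dvdn_prime2.
  have [K [f _]] := countable_algebraic_closure F.
  have [l el] := eigen_exists f x; have /eigenP[l0 tl] := el.
  have l5 : (l ^+ 5 = 1)%R by apply/eqP; rewrite -(eigen_exp_eq1 chp _ Gx px el) -ox expg_order.
  have l1 : (l != 1)%R.
    rewrite -(expr1 l) -(eigen_exp_eq1 chp _ Gx px el) expg1 -order_eq1 ox //.
  move: (tr x) tl => t tl; exists (- t)%R; apply: (fmorph_inj f).
  rewrite !(rmorphXn, rmorphN, rmorphD, rmorphM, rmorph_int) /= tl.
  have e : (l ^+ 4 + l ^+ 3 + l ^+ 2 + l + 1 = 0)%R.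
    have : ((l - 1) * (l ^+ 4 + l ^+ 3 + l ^+ 2 + l + 1) == 0)%R.
      by apply/eqP; apply: (lincomb (k := 1%R) l5); ring.
    by rewrite mulf_eq0 subr_eq0 (negPf l1) => /eqP.
  by apply: (lincomb (k := (l ^- 2)%R) e); field.
have nsE : {in [:: 16; 64; 80; 144; 256], forall k, ((k%:R : F) != 0)%R}.
  move=> k; rewrite !inE => /or4P[|||/orP[]]/eqP->.
  - exact: (nz 4 0 0).
  - exact: (nz 6 0 0).
  - exact: (nz 4 0 1%N).
  - exact: (nz 4 2 0).
  exact: (nz 8 0 0).
have /andP[chk /eqP sz] := icosian_check.
exists (quat_group wE abE two chk); split.
- exact: quat_group_center.
- exact: quat_group_sub.
- by rewrite card_quat_group.
move=> g /quat_group_exponents[k]; rewrite !inE => /or3P[] /eqP ->; [exact: Or31 | exact: Or32 | exact: Or33].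
Qed.

Local Notation all_wexp :=
  (forall H, Z \subset H -> H \subset G -> weakly_exponential H G).

(** For the binary tetrahedral group the index is (m/12) q (m'/2) with gcd(12, q
    m'/2) = 1, so the required order is 12. *)
Lemma all_wexp_ndvd12 m : all_wexp -> m = q.-1 \/ m = q.+1 -> ~~ (12 %| m).
Proof.
move=> wexp mE; apply/negP=> m12; have [m' [_ cG m2 mr]] := card_SL_torus mE.
have pm := p_ndvd_torus chp mE.
have p2 : p != 2 by apply: contraNneq pm => ->; apply: dvdn_trans m12.
have p3 : p != 3 by apply: contraNneq pm => ->; apply: dvdn_trans m12.
have [H [sZH sHG oH expH]] := hurwitz_group p2 p3.
have m0 := torus_index_gt0 mE.
have [|w Hw ow] := weakly_exponential_order chp (wexp H sZH sHG) _ mE.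
  by apply: leq_trans (dvdn_leq m0 m12).
have /dvdnP[m1 m1E] := m12.
have /dvdnP[m'' m''E] : 2 %| m' by apply: m2; apply: dvdn_trans m12.
(* 24 |G:H| = q m m' with m = 12 m1 and m' = 2 m''. *)
have iE : #|G : H| = (m1 * (q * m''))%N.
  apply/eqP; rewrite -(eqn_pmul2l (isT : 0 < 24)) -{1}oH Lagrange // cG m1E m''E.
  by apply/eqP; ring.
have [k k0 cF] := card_char chp.
have co : coprime 12 (q * m'').
  have pc r : prime r -> r != p -> coprime r q.
    by move=> r_pr rp; rewrite cF coprimeXr // prime_coprime // dvdn_prime2.
  have co2 : coprime 2 m''.
    rewrite prime_coprime //; apply/negP=> h.
    by have /negP[] := mr 4 isT (dvdn_trans (isT : 4 %| 12) m12); rewrite m''E (_ : 4 = 2 * 2)%N // dvdn_pmul2r.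
  have co3 : coprime 3 m''.
    rewrite prime_coprime //; apply/negP=> h.
    by have /negP[] := mr 3 isT (dvdn_trans (isT : 3 %| 12) m12); rewrite m''E dvdn_mulr.
  rewrite (_ : 12 = 2 * 2 * 3)%N // !coprimeMl !coprimeMr co2 co3.
  by rewrite !pc // eq_sym.
have m10 : 0 < m1 by move: m0; rewrite m1E muln_gt0 => /andP[].
move: ow; rewrite (needed_order_eq m10 m1E iE) (eqP co) divn1 => ow.
by case: (expH w Hw) => /eqP; rewrite -order_dvdn ow.
Qed.

(** For the binary icosahedral group and 5 | m, one of m and m' is divisible by 4.
    If it is m, then 3 divides m' because 12 does not divide m, and the required
    order is 20. If it is m', then 3 divides m and the required order is divisible
    by 15. *)
Lemma all_wexp_ndvd5 m : all_wexp -> p != 2 -> p != 3 -> p != 5 ->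
  ~~ (12 %| q.-1) -> ~~ (12 %| q.+1) -> m = q.-1 \/ m = q.+1 -> ~~ (5 %| m).
Proof.
move=> wexp p2 p3 p5 n12m n12p mE; apply/negP=> m5.
have [m' [m'E cG m2 mr]] := card_SL_torus mE.
have [k k0 cF] := card_char chp.
have m0 := torus_index_gt0 mE.
have q5 : 5 %| q.-1 \/ 5 %| q.+1 by case: mE m5 => ->; auto.
have n12 : ~~ (12 %| m) by case: mE => ->.
have n12' : ~~ (12 %| m') by case: m'E => ->.
have pc r : prime r -> p != r -> coprime r q.
  by move=> r_pr rp; rewrite cF coprimeXr // prime_coprime // dvdn_prime2 // eq_sym.
have [[c2 c3] c5] := (pc 2 isT p2, pc 3 isT p3, pc 5 isT p5).
have mm' : m != m' by apply/eqP=> e; have := mr 5 isT m5; rewrite -e m5.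
have other d : d %| q.-1 \/ d %| q.+1 -> d %| m \/ d %| m'.
  by case: mE m'E mm' => -> [] ->; rewrite ?eqxx // => _ []; auto.
have odd_q : odd q by rewrite -coprime2n.
have even_m : 2 %| m.
  by case: mE => ->; rewrite dvdn2 ?oddS ?odd_q // -subn1 oddB // odd_q.
(* One of q - 1 and q + 1 is divisible by 4, and one by 3. *)
have four : 4 %| m \/ 4 %| m'.
  apply: other; have := odd_double_half q; rewrite odd_q add1n.
  have := odd_double_half q./2; case: (odd q./2) => /= <- <-; last first.
    by left; rewrite /= -!muln2 -mulnA dvdn_mull.
  by right; rewrite doubleD /= -!muln2; apply/dvdnP; exists (q./2./2 + 1)%N; ring.
have three : 3 %| m \/ 3 %| m'.
  apply: other; have : q %% 3 != 0 by rewrite -/(3 %| q) -prime_coprime.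
  have := ltn_pmod q (isT : 0 < 3); have := divn_eq q 3.
  case: (q %% 3) => [|[|[|]]] // -> _ _.
    by left; rewrite addn1 /= dvdn_mull.
  by right; apply/dvdnP; exists (q %/ 3 + 1)%N; ring.
have [H [sZH sHG oH expH]] := icosian_group p2 p3 p5 q5.
have [|w Hw ow] := weakly_exponential_order chp (wexp H sZH sHG) _ mE.
  by apply: leq_trans (dvdn_leq m0 m5).
have bad d : d %| #[w] -> ~~ (d %| 4) -> ~~ (d %| 6) -> ~~ (d %| 10) -> False.
  move=> dw d4 d6 d10; case: (expH w Hw) => /eqP; rewrite -order_dvdn => /(dvdn_trans dw).
  - by rewrite (negPf d4).
  - by rewrite (negPf d6).
  by rewrite (negPf d10).
have iE : (#|G : H| * 120 = q * (m * m'))%N by rewrite -cG -(Lagrange sHG) oH mulnC.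
have [m4 | nm4] := boolP (4 %| m).
  have nm'4 : ~~ (4 %| m') by apply: mr.
  have /dvdnP[m1 m1E] : 20 %| m by rewrite (@Gauss_dvd 4 5) // m4.
  have /dvdnP[m'' m''E] := m2 even_m.
  have iE' : (#|G : H| * 3 = q * (m1 * m''))%N.
    apply/eqP; rewrite -(eqn_pmul2r (isT : 0 < 40)) -mulnA (_ : 3 * 40 = 120)%N // iE m1E m''E.
    by apply/eqP; ring.
  have n3 : ~~ (3 %| m1).
    apply: contra n12 => h; rewrite (@Gauss_dvd 4 3) // m4 m1E.
    by rewrite dvdn_mulr.
  have : 3 %| q * (m1 * m'') by rewrite -iE' dvdn_mull.
  rewrite Gauss_dvdr // Euclid_dvdM // (negPf n3) /= => /dvdnP[m3 m3E].
  have i3 : #|G : H| = (m1 * (q * m3))%N.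
    apply/eqP; rewrite -(eqn_pmul2r (isT : 0 < 3)) iE' m3E; apply/eqP; ring.
  have co : coprime 20 (q * m3).
    rewrite (_ : 20 = 2 * 2 * 5)%N // !coprimeMl !coprimeMr c2 c5 /=.
    rewrite !prime_coprime //; apply/andP; split; [rewrite andbb|].
      apply: contra nm'4 => h; rewrite m''E m3E (_ : 4 = 2 * 2)%N // dvdn_pmul2r //.
      by rewrite dvdn_mulr.
    by apply: contra (mr 5 isT m5) => h; rewrite m''E m3E !dvdn_mulr.
  have m10 : 0 < m1 by move: m0; rewrite m1E muln_gt0 => /andP[].
  apply: (bad 20) => //; rewrite ow (needed_order_eq m10 m1E i3) (eqP co) divn1 //.
have m'4 : 4 %| m' by case: four => // h; rewrite h in nm4.
have m3 : 3 %| m.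
  by case: three => // h; case/negP: n12'; rewrite (@Gauss_dvd 4 3) // m'4.
have /dvdnP[m1 m1E] : 30 %| m by rewrite (@Gauss_dvd 2 15) // even_m (@Gauss_dvd 3 5) // m3.
have /dvdnP[m'' m''E] := m'4.
have i3 : #|G : H| = (m1 * (q * m''))%N.
  apply/eqP; rewrite -(eqn_pmul2r (isT : 0 < 120)) iE m1E m''E; apply/eqP; ring.
have co : coprime 15 (q * m'').
  rewrite (_ : 15 = 3 * 5)%N // coprimeMl !coprimeMr c3 c5 /= !prime_coprime //.
  by apply/andP; split; [apply: contra (mr 3 isT m3) | apply: contra (mr 5 isT m5)] => h;
    rewrite m''E dvdn_mulr.
have m10 : 0 < m1 by move: m0; rewrite m1E muln_gt0 => /andP[].
apply: (bad 15) => //; rewrite ow (needed_order_eq m10 m1E i3).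
have cg : coprime 15 (gcdn 30 (q * m'')) by apply: coprime_dvdr (dvdn_gcdr _ _) co.
by rewrite -(Gauss_dvdl _ cg) divnK ?dvdn_gcdl.
Qed.

End Failures.

Local Open Scope ring_scope.

(** * SL(2,q0) in SL(2,q0^2) *)

Section Subfield.
Variables (F : finFieldType) (p e : nat).
Hypothesis chp : p \in [pchar F].
Hypothesis e0 : (0 < e)%N.
Local Notation G := (SL F).
Local Notation Z := ('Z(SL F))%G.
Local Notation q := #|F|.
Local Notation q0 := (p ^ e)%N.
Hypothesis qE : q = (q0 * q0)%N.
Implicit Types (x y : GL2 F) (H : {group GL2 F}).
Let p_pr := pcharf_prime chp.
Let q01 : (1 < q0)%N. Proof. by rewrite -{1}(exp1n e) ltn_exp2r ?prime_gt1. Qed.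

Let nat_q0 (R : fieldType) : p \in [pchar R] -> [pchar R].-nat q0.
Proof. by move=> chR; rewrite (eq_pnat _ (pcharf_eq chR)) pnatX pnat_id. Qed.

Definition subfield : {set F} := [set a | a ^+ q0 == a].

(** The polynomial X^q0 - X divides X^q - X, which splits into distinct linear
    factors. *)
Lemma card_subfield : #|subfield| = q0.
Proof.
pose P : {poly F} := 'X^q0 - 'X.
have sP : size P = q0.+1.
  by rewrite /P size_polyDl size_polyXn // size_polyN size_polyX.
have P0 : P != 0 by rewrite -size_poly_eq0 sP.
apply/eqP; rewrite eqn_leq; apply/andP; split.
  rewrite -ltnS -sP cardE; apply: max_poly_roots => //; last exact: enum_uniq.
  by apply/allP=> a; rewrite mem_enum inE rootE !hornerE subr_eq0.
(* X^q - X = P^q0 + P for the polynomial P = X^q0 - X. *)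
have : P %| \prod_(a : F) ('X - a%:P).
  rewrite -finField_genPoly.
  have -> : 'X^q - 'X = P ^+ q0 + P :> {poly F}.
    have chP : p \in [pchar {poly F}] by rewrite pchar_lalg.
    have nP : [pchar {poly F}].-nat q0 by rewrite (eq_pnat _ (pcharf_eq chP)) pnatX pnat_id.
    by rewrite /P exprDn_pchar // exprNn_pchar // -exprM -qE; ring.
  by rewrite dvdp_add // -{1}[P]expr1 dvdp_exp2l // ltnW.
case/dvdp_prod_XsubC=> m Pm.
have := eqp_size Pm; rewrite sP size_prod_XsubC => -[->].
rewrite -(card_uniqP _); last by rewrite mask_uniq // index_enum_uniq.
apply/subset_leq_card/subsetP=> a am; rewrite inE -subr_eq0.
have : root P a by rewrite (eqp_root Pm) root_prod_XsubC.
by rewrite rootE !hornerE.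
Qed.

Lemma subfieldP a : reflect (a ^+ q0 = a) (a \in subfield).
Proof. by rewrite inE; apply: eqP. Qed.

Lemma subfieldD : {in subfield &, forall a b, a + b \in subfield}.
Proof.
by move=> a b /subfieldP ha /subfieldP hb; apply/subfieldP; rewrite exprDn_pchar ?nat_q0 // ha hb.
Qed.

Lemma subfieldN : {in subfield, forall a, - a \in subfield}.
Proof.
by move=> a /subfieldP ha; apply/subfieldP; rewrite exprNn_pchar ?nat_q0 // ha.
Qed.

Lemma subfieldM : {in subfield &, forall a b, a * b \in subfield}.
Proof. by move=> a b /subfieldP ha /subfieldP hb; apply/subfieldP; rewrite exprMn ha hb. Qed.

Lemma subfieldV : {in subfield, forall a, a^-1 \in subfield}.
Proof. by move=> a /subfieldP ha; apply/subfieldP; rewrite exprVn ha. Qed.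

Lemma subfield0 : 0 \in subfield.
Proof. by apply/subfieldP; rewrite expr0n; case: (q0) q01. Qed.

Lemma subfield1 : 1 \in subfield. Proof. by apply/subfieldP; rewrite expr1n. Qed.

Local Notation K := (SL_over subfield).

Lemma SL_subfield_group_set : group_set K.
Proof.
apply/group_setP; split.
  by rewrite inE group1 !entE subfield0 subfield1.
move=> x y; rewrite inE => /andP[Gx /and4P[ax bx cx dx]].
rewrite inE => /andP[Gy /and4P[ay b_y cy dy]].
by rewrite inE groupM // !entE !subfieldD ?subfieldM.
Qed.
Canonical SL_subfield_group := Group SL_subfield_group_set.

Lemma card_SL_subfield : #|K| = (q0 * (q0 ^ 2).-1)%N.
Proof.
rewrite card_SL_over ?card_subfield ?subfield0 ?subfield1 //.
- exact: subfieldM.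
- by move=> a b Sa Sb; rewrite subfieldD ?subfieldN.
exact: subfieldV.
Qed.

Lemma SL_subfield_sub : K \subset G.
Proof. by apply/subsetP=> x; rewrite inE => /andP[]. Qed.

Lemma SL_subfield_center : Z \subset K.
Proof.
apply/subsetP=> x; rewrite center_SL => /andP[Gx /homothetyP[b0 c0 ad]].
rewrite inE Gx b0 c0 -ad subfield0 /= !andbb.
have := SL_det Gx; rewrite b0 c0 mul0r subr0 -ad -expr2 => /eqP; rewrite sqrf_eq1.
by case/orP=> /eqP ->; rewrite ?subfieldN ?subfield1.
Qed.

(** Frobenius of the subfield permutes the two eigenvalues, as in [eigen_type]. *)
Lemma SL_subfield_order x : x \in K -> ~~ (p %| #[x])%N -> (#[x] <= q0.+1)%N.
Proof.
rewrite inE => /andP[Gx /and4P[ax _ _ dx]] px.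
have [L [f _]] := countable_algebraic_closure F.
have [l el] := eigen_exists f x; have /eigenP[l0 tl] := el.
have chL : p \in [pchar L] by rewrite (fmorph_pchar f).
have /subfieldP tS : tr x \in subfield by apply: subfieldD.
have : l ^+ q0 = l \/ l ^+ q0 = l^-1.
  apply: sumV_eq; rewrite ?expf_neq0 // -exprVn -exprDn_pchar ?nat_q0 // -tl.
  by rewrite -rmorphXn /= tS.
have q00 : (0 < q0)%N := ltnW q01.
case=> h.
  have : (x ^+ q0.-1 == 1)%g.
    rewrite (eigen_exp_eq1 chp _ Gx px el); apply/eqP; apply: (mulfI l0).
    by rewrite -exprS prednK // mulr1.
  rewrite -order_dvdn => /dvdn_leq h'.
  by apply: leq_trans (h' _) _; [rewrite -subn1 subn_gt0 | apply: leq_trans (leq_pred _) _].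
have : (x ^+ q0.+1 == 1)%g.
  by rewrite (eigen_exp_eq1 chp _ Gx px el) exprS h mulfV.
by rewrite -order_dvdn => /dvdn_leq; apply.
Qed.

(** The index is q0 (q + 1), and its gcd with q - 1 divides 2, so an element of
    order at least (q - 1)/2 is required; but orders are at most q0 + 1. *)
Lemma SL_subfield_wexp_le3 : weakly_exponential SL_subfield_group G -> (q0 <= 3)%N.
Proof.
move=> wexp; rewrite leqNgt; apply/negP=> q3.
have q00 : (0 < q0)%N := ltnW q01.
(* The estimate that fails for q0 = 2 and q0 = 3. *)
have big : (2 * q0.+1 < q.-1)%N by rewrite qE; clear -q3; nia.
have m2 : (2 < q.-1)%N by apply: leq_ltn_trans big; rewrite leq_pmulr.
have mE : q.-1 = q.-1 \/ q.-1 = q.+1 by left.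
have [w Kw ow] := weakly_exponential_order chp wexp m2 mE.
have pm := p_ndvd_torus chp mE.
have iE : #|G : K| = (q0 * q.+1)%N.
  have k0 : (0 < #|K|)%N by rewrite (cardG_gt0 SL_subfield_group).
  apply/eqP; rewrite -(eqn_pmul2l k0) (Lagrange SL_subfield_sub) card_SL card_SL_subfield.
  by rewrite -mulnn -qE {1}qE; apply/eqP; ring.
rewrite /= iE in ow.
have g2 : (gcdn q.-1 (q0 * q.+1) %| 2)%N.
  have co : coprime q.-1 q0 by rewrite coprime_sym coprimeXl // prime_coprime.
  rewrite Gauss_gcdr //; have -> : q.+1 = (q.-1 + 2)%N.
    by rewrite addn2 prednK // ltnW // finNzRing_gt1.
  by rewrite gcdnDl dvdn_gcdr.
have wq : (q.-1 <= 2 * #[w])%N.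
  rewrite ow -{1}(divnK (dvdn_gcdl q.-1 (q0 * q.+1))) mulnC leq_mul2r.
  by rewrite (dvdn_leq _ g2) ?orbT.
have pw : ~~ (p %| #[w])%N.
  apply: contra pm => /dvdn_trans; apply; rewrite ow.
  by apply: dvdn_div; apply: dvdn_gcdl.
have := SL_subfield_order Kw pw; clear -big wq; lia.
Qed.

End Subfield.

Local Close Scope ring_scope.
Local Close Scope group_scope.

(** * Residues modulo 120 *)

(** An odd power is p times a power of p^2, so stability of S under multiplication
    by p^2 suffices. *)
Lemma odd_pow_mod N p d (S : seq nat) : odd d -> p %% N \in S ->
  all (fun s => s * (p %% N * (p %% N)) %% N \in S) S -> p ^ d %% N \in S.
Proof.
move=> od pS /allP clS; rewrite -(odd_double_half d) od.
elim: d./2 => [|k IH]; first by rewrite expn1.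
have <- : (p ^ (true + k.*2) %% N) * (p %% N * (p %% N)) %% N = p ^ (true + k.+1.*2) %% N.
  rewrite modnMml -modnMmr modnMm modnMmr doubleS !addnS expnS expnS.
  by rewrite mulnC -mulnA.
exact: clS.
Qed.

Lemma dvdn12_neighbours q : 0 < q ->
  ((12 %| q.-1) = (q %% 12 == 1)) * ((12 %| q.+1) = (q %% 12 == 11)).
Proof. by move=> q0; split; apply/idP/eqP; lia. Qed.

Lemma dvdn5_neighbours q : 0 < q ->
  ((5 %| q.-1) = (q %% 5 == 1)) * ((5 %| q.+1) = (q %% 5 == 4)).
Proof. by move=> q0; split; apply/idP/eqP; lia. Qed.

Definition wexp_residues := [:: 2; 3; 5; 7; 17; 43; 53; 67; 77; 103; 113].

Lemma good_residue_pow p d : odd d -> 0 < p -> p %% 120 \in wexp_residues ->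
  let q := p ^ d in
  [/\ ~~ (5 %| q.-1), ~~ (5 %| q.+1), ~~ (12 %| q.-1) & ~~ (12 %| q.+1)].
Proof.
move=> od p0 pr q; have q0 : 0 < q by rewrite expn_gt0 p0.
rewrite !dvdn12_neighbours // !dvdn5_neighbours //.
have p5 : p %% 5 \in [:: 0; 2; 3].
  by rewrite -(@modn_dvdm 120 p 5) //; move: pr; move: (p %% 120); apply/allP.
have p12 : p %% 12 \in [:: 2; 3; 5; 7].
  by rewrite -(@modn_dvdm 120 p 12) //; move: pr; move: (p %% 120); apply/allP.
have q5 : q %% 5 \in [:: 0; 2; 3].
  by apply: odd_pow_mod => //; move: p5; move: (p %% 5); apply/allP.
have q12 : q %% 12 \in [:: 0; 2; 3; 4; 5; 6; 7; 8; 9; 10].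
  by apply: odd_pow_mod => //; move: p12; move: (p %% 12); apply/allP.
by split; [move: q5 | move: q5 | move: q12 | move: q12]; move: (_ %% _); apply/allP.
Qed.

Lemma bad_residue_pow p d : odd d -> prime p -> p != 2 -> p != 3 -> p != 5 ->
  let q := p ^ d in
  ~~ (5 %| q.-1) -> ~~ (5 %| q.+1) -> ~~ (12 %| q.-1) -> ~~ (12 %| q.+1) ->
  p %% 120 \in wexp_residues.
Proof.
move=> od p_pr p2 p3 p5 q; have q0 : 0 < q by rewrite expn_gt0 prime_gt0.
rewrite !dvdn12_neighbours // !dvdn5_neighbours // => n51 n54 n121 n1211.
have n5 : p %% 5 \notin [:: 1; 4].
  apply/negP=> h; have : q %% 5 \in [:: 1; 4].
    by apply: odd_pow_mod => //; move: h; move: (p %% 5); apply/allP.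
  by rewrite !inE (negPf n51) (negPf n54).
have n12 : p %% 12 \notin [:: 1; 11].
  apply/negP=> h; have : q %% 12 \in [:: 1; 11].
    by apply: odd_pow_mod => //; move: h; move: (p %% 12); apply/allP.
  by rewrite !inE (negPf n121) (negPf n1211).
have nd r : prime r -> p != r -> p %% r != 0.
  by move=> r_pr pr; rewrite -/(dvdn r p) dvdn_prime2 // eq_sym.
have := nd 2 isT p2; have := nd 3 isT p3; have := nd 5 isT p5.
rewrite -(@modn_dvdm 120 p 5) // -(@modn_dvdm 120 p 3) // -(@modn_dvdm 120 p 2) //.
rewrite -(@modn_dvdm 120 p 5) // in n5; rewrite -(@modn_dvdm 120 p 12) // in n12.
move=> h5 h3 h2; have : p %% 120 < 120 by rewrite ltn_pmod.
move: (p %% 120) h5 h3 h2 n5 n12 => r h5 h3 h2 n5 n12 r120.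
(* It remains to inspect the 120 residues. *)
have /allP/(_ r) : all (fun s => [&& s %% 5 != 0, s %% 3 != 0, s %% 2 != 0,
    s %% 5 \notin [:: 1; 4] & s %% 12 \notin [:: 1; 11]] ==> (s \in wexp_residues)) (iota 0 120).
  by vm_compute.
by rewrite mem_iota r120 h5 h3 h2 n5 n12; apply.
Qed.

(** * The characterisation *)

Section Characterisation.
Variables (F : finFieldType) (p d : nat).
Hypotheses (p_pr : prime p) (d0 : 0 < d) (qE : #|F| = p ^ d).
Local Notation q := #|F|.

Let chp : p \in [pchar F]%R. Proof. exact: card_finPcharP qE p_pr. Qed.
Let q1 : 1 < q := finNzRing_gt1 F.

Lemma wexp_solvable_PSL2_of_orders :
  (forall H : {group GL2 F}, 'Z(SL F)%g \subset H -> H \subset SL F -> realizes_orders H) ->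
  wexp_solvable (PSL2 F).
Proof.
by move=> h; apply/wexp_solvable_PSL2=> H sZH sHG; apply: (weakly_exponential_of_orders chp) => //; apply: h.
Qed.

Lemma wexp_solvable_PSL2_4 : q = 4 -> wexp_solvable (PSL2 F).
Proof.
move=> q4; apply: wexp_solvable_PSL2_of_orders => H sZH sHG.
apply: (realizes_orders_prime_power chp) => // m r l mE r_pr l_pr r_odd.
by case: mE => ->; rewrite q4 /= => rm lm _; move: rm lm; rewrite !dvdn_prime2 // => /eqP -> /eqP ->.
Qed.

(** The two numbers are 8 and 10. In 10 the prime 2 does not count, as 4 does not
    divide 10. *)
Lemma wexp_solvable_PSL2_9 : q = 9 -> wexp_solvable (PSL2 F).
Proof.
move=> q9; apply: wexp_solvable_PSL2_of_orders => H sZH sHG.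
apply: (realizes_orders_prime_power chp) => // m r l mE r_pr l_pr r_odd.
have odd_dvd k : r %| 2 ^ k -> r = 1.
  move=> h; apply/eqP; rewrite -dvdn1 -(@Gauss_dvdr _ (2 ^ k)) ?muln1 //.
  by rewrite coprimeXr // coprimen2.
case: mE => ->; rewrite q9 /=.
  by move/(odd_dvd 3) => r1; rewrite r1 in r_pr.
move=> rm lm l2; move: rm lm; rewrite (_ : 10 = 2 * 5) // !Euclid_dvdM // !dvdn_prime2 //.
case/orP=> /eqP rE; first by rewrite rE in r_odd.
by case/orP=> /eqP lE; [have := l2 lE | rewrite lE rE].
Qed.

Theorem wexp_solvable_PSL2P : wexp_solvable (PSL2 F) <->
  [\/ q = 4, q = 9 | (p %% 120 \in wexp_residues) /\ odd d].
Proof.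
split=> [/wexp_solvable_PSL2 wexp | ]; last first.
  case=> [| | [pr od]]; [exact: wexp_solvable_PSL2_4 | exact: wexp_solvable_PSL2_9 |].
  have [n5m n5p n12m n12p] := good_residue_pow od (prime_gt0 p_pr) pr.
  apply: wexp_solvable_PSL2_of_orders => H sZH sHG.
  by apply: (realizes_orders_odd chp qE); rewrite ?qE.
have [od | ed] := boolP (odd d); last first.
  (* For d even the field has a subfield of order q0 with q = q0^2. *)
  have dE : d = d./2 + d./2 by rewrite addnn -[LHS]odd_double_half (negPf ed).
  have e0 : 0 < d./2 by rewrite half_gt0; move: d0 ed; case: (d) => [|[|]].
  have qE2 : q = p ^ d./2 * p ^ d./2 by rewrite qE {1}dE expnD.
  have := SL_subfield_wexp_le3 qE2 (wexp (SL_subfield_group chp e0) (SL_subfield_center chp e0) (SL_subfield_sub _ _ _)).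
  have : 1 < p ^ d./2 by rewrite -{1}(exp1n d./2) ltn_exp2r ?prime_gt1.
  rewrite qE2; case: (p ^ d./2) => [|[|[|[|n]]]] // _ _; [exact: Or31 | exact: Or32].
constructor 3; split=> //.
have [-> // | p2] := eqVneq p 2; have [-> // | p3] := eqVneq p 3.
have [-> // | p5] := eqVneq p 5.
have L : q.-1 = q.-1 \/ q.-1 = q.+1 by left.
have R : q.+1 = q.-1 \/ q.+1 = q.+1 by right.
have n12m := all_wexp_ndvd12 chp wexp L; have n12p := all_wexp_ndvd12 chp wexp R.
have n5m := all_wexp_ndvd5 chp wexp p2 p3 p5 n12m n12p L.
have n5p := all_wexp_ndvd5 chp wexp p2 p3 p5 n12m n12p R.
by rewrite qE in n12m n12p n5m n5p; apply: (bad_residue_pow od).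
Qed.

(** The prime powers up to 5 are 2, 3, 4 and 5, and each satisfies the criterion.
    *)
Lemma wexp_nonsolvable_card : wexp_nonsolvable (PSL2 F) -> 5 < q.
Proof.
move=> nw; rewrite ltnNge; apply/negP=> q5; apply: nw; apply/wexp_solvable_PSL2P.
have p1 := prime_gt1 p_pr; have d2 : d < 3.
  rewrite ltnNge; apply/negP=> d3; move: q5; rewrite leqNgt qE => /negP[].
  by apply: (@leq_trans (2 ^ 3)) => //; apply: leq_trans (_ : 2 ^ d <= _);
    rewrite ?leq_exp2l // leq_exp2r.
move: q5 d0 d2; rewrite qE; case: (d) => [|[|[|]]] // + _ _.
  rewrite expn1 => p5; constructor 3; split=> //.
  by move: p_pr p5; case: (p) => [|[|[|[|[|[|]]]]]].
move=> p5; constructor 1; suff -> : p = 2 by [].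
apply/eqP; rewrite eqn_leq p1 andbT leqNgt; apply/negP=> p3.
by have : 3 ^ 2 <= p ^ 2 by [rewrite leq_exp2r]; move=> h; have := leq_trans h p5.
Qed.

End Characterisation.

Lemma minimal_of_nonsolvable (F : finFieldType) :
  wexp_nonsolvable (PSL2 F) -> minimal_wexp_nonsolvable (PSL2 F).
Proof.
move=> nw; split=> // N nN ntN; apply: PSL2_quotient => //.
have [p p_pr chp] := finPcharP F; have [d d0 qE] := card_char chp.
exact: wexp_nonsolvable_card p_pr d0 qE nw.
Qed.

Theorem theorem1p12 :
  (forall (q p d : nat) (F : finFieldType),
      prime p -> 0 < d -> q = p ^ d -> #|F| = q ->
      (wexp_solvable (PSL2 F) <->
       [\/ q = 4,
           q = 9
         | (p %% 120 \in [:: 2; 3; 5; 7; 17; 43; 53; 67; 77; 103; 113])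
           /\ odd d])) /\
  (forall N : nat,
      exists2 F : finFieldType, N < #|F| & wexp_solvable (PSL2 F)) /\
  (forall N : nat,
      exists2 F : finFieldType,
        N < #|F| & wexp_nonsolvable (PSL2 F)
                   /\ minimal_wexp_nonsolvable (PSL2 F)) /\
  (forall F : finFieldType,
      wexp_nonsolvable (PSL2 F) -> minimal_wexp_nonsolvable (PSL2 F)).
Proof.
split; last split; last split.
- move=> q p d F p_pr d0 qE cF; rewrite -cF; apply: wexp_solvable_PSL2P => //.
  by rewrite cF.
(* Fields of order 2^d with d odd, as p = 2 is in the list. *)
- move=> N; have [F _ cF] := @pPrimePowerField 2 N.*2.+1 isT isT; exists F.
    by rewrite cF; apply: leq_trans (ltn_expl _ (isT : 1 < 2)) _; rewrite leq_exp2l // -addnn leqW // leq_addr.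
  apply/(wexp_solvable_PSL2P _ _ cF) => //; constructor 3; split=> //.
  by rewrite /= odd_double.
(* Fields of order 2^d with d even and at least 4. *)
- move=> N; have [F _ cF] := @pPrimePowerField 2 N.+2.*2 isT isT; exists F.
    rewrite cF; apply: leq_trans (ltn_expl _ (isT : 1 < 2)) _.
    by rewrite leq_exp2l // -addnn (leq_trans (leqW (leqnSn N))) // leq_addr.
  have nw : wexp_nonsolvable (PSL2 F).
    move/(wexp_solvable_PSL2P _ _ cF) => /(_ isT isT).
    have big : 16 <= #|F| by rewrite cF (_ : 16 = 2 ^ 4) // leq_exp2l.
    by case=> [e | e | [_]]; [rewrite e in big | rewrite e in big | rewrite odd_double].
  by split=> //; apply: minimal_of_nonsolvable.
exact: minimal_of_nonsolvable.
Qed.
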